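(* Let $d\ge 2$ and let $b\in C^1_\sharp(Y_d)^d$ be a vector field for which there exist a positive function $\sigma\in C^0_\sharp(Y_d)$ and functions $v_1,\dots,v_d\in C^2(\mathbb{R}^d)$ with $Y_d$-periodic gradients such that $$b\cdot\nabla v_1=1\ \text{ in }Y_d\qquad\text{and}\qquad \sigma b=\begin{cases}R_\perp\nabla v_2 & \text{if }d=2,\\ \nabla v_2\times\cdots\times\nabla v_d & \text{if }d\ge 3,\end{cases}\ \text{ in }Y_d.$$ Let $u_0\in C^1(\mathbb{R}^d)$. For $\varepsilon>0$, let $u_\varepsilon$ be the solution in $L^1_{\rm loc}(\mathbb{R}_+\times\mathbb{R}^d)$ to the transport equation $$\begin{cases}\dfrac{\partial u_\varepsilon}{\partial t}-b(x/\varepsilon)\cdot\nabla u_\varepsilon=0 & \text{in }(0,\infty)\times\mathbb{R}^d,\\ u_\varepsilon(0,x)=u_0(x) & \text{for }x\in\mathbb{R}^d.\end{cases}$$ Then, as $\varepsilon\to0$, $u_\varepsilon$ converges in $C^0_{\rm loc}(\mathbb{R}_+\times\mathbb{R}^d)$ to the function $(t,x)\mapsto u_0(x+t\xi)$, where $$\xi=\frac{\langle\sigma b\rangle}{\langle\sigma\rangle}.$$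
   Context: $Y_d:=[0,1)^d$; a function $f$ on $\mathbb{R}^d$ is $Y_d$-periodic if $f(x+\kappa)=f(x)$ for all $\kappa\in\mathbb{Z}^d$; $C^k_\sharp(Y_d)$ is the space of $Y_d$-periodic functions of class $C^k$ in $\mathbb{R}^d$; $\langle f\rangle$ is the average value of $f$ over $Y_d$. $R_\perp$ is the clockwise $90^\circ$ rotation matrix in $\mathbb{R}^{2\times2}$. For $\xi^2,\dots,\xi^d\in\mathbb{R}^d$, the cross product $\xi^2\times\cdots\times\xi^d\in\mathbb{R}^d$ is defined by $\xi^1\cdot(\xi^2\times\cdots\times\xi^d)=\det(\xi^1,\xi^2,\dots,\xi^d)$ for all $\xi^1\in\mathbb{R}^d$. The vector $\xi$ is also the limit $\lim_{|t|\to\infty}X(t,x)/t$ for every $x\in\mathbb{R}^d$, where $X$ is the flow $X'(t,x)=b(X(t,x))$, $X(0,x)=x$. Convergence in $C^0_{\rm loc}(\mathbb{R}_+\times\mathbb{R}^d)$ means uniform convergence on every compact subset of $\mathbb{R}_+\times\mathbb{R}^d$, $\mathbb{R}_+=[0,\infty)$. *)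

(* Defs.v *)
From HB Require Import structures.
From mathcomp Require Import all_boot all_order all_algebra.
From mathcomp Require Import all_classical all_reals all_analysis.

Set Implicit Arguments.
Unset Strict Implicit.
Unset Printing Implicit Defensive.

Import Order.TTheory GRing.Theory Num.Theory.
Import numFieldNormedType.Exports.

Local Open Scope classical_set_scope.
Local Open Scope ring_scope.

(* * Lebesgue measure on R^n *)

Definition rV_display : measure_display.
Proof. exact. Qed.

Section measurable_rV.
Context (R : realType) (n : nat).

(* The sigma-algebra generated by the coordinates, i.e. the Borel one. *)
Let coords : 'I_n -> 'rV[R]_n -> measurableTypeR R := fun i x => x ord0 i.

Let rV_set0 : g_sigma_preimage coords set0.
Proof. exact: sigma_algebra0. Qed.

Let rV_setC A : g_sigma_preimage coords A -> g_sigma_preimage coords (~` A).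
Proof. exact: sigma_algebraC. Qed.

Let rV_bigcup (F : (set 'rV[R]_n)^nat) :
  (forall i, g_sigma_preimage coords (F i)) ->
  g_sigma_preimage coords (\bigcup_i (F i)).
Proof. exact: sigma_algebra_bigcup. Qed.

HB.instance Definition _ := @isMeasurable.Build rV_display
  'rV[R]_n (g_sigma_preimage coords) rV_set0 rV_setC rV_bigcup.

Lemma measurable_coord (i : 'I_n) :
  measurable_fun [set: 'rV[R]_n] (fun x => x ord0 i : measurableTypeR R).
Proof.
move=> _ Y mY; rewrite setTI; apply: sub_sigma_algebra => /=.
rewrite -bigcup_seq/=; exists i => /=; first by rewrite mem_index_enum.
by exists Y => //; rewrite setTI.
Qed.

Lemma measurable_fun_coordP d (T : measurableType d) (f : T -> 'rV[R]_n) :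
  measurable_fun [set: T] f <->
  forall i, measurable_fun [set: T] (fun x => f x ord0 i : measurableTypeR R).
Proof.
split=> [mf i|mf _ A].
  exact: (measurableT_comp (measurable_coord i) mf).
rewrite setTI; move: A; apply: smallest_sub.
  split.
  - by rewrite /= preimage_set0.
  - by move=> A /= mA; rewrite setTD -preimage_setC; exact: measurableC.
  - by move=> F /= mF; rewrite preimage_bigcup; exact: bigcup_measurable.
rewrite -bigcup_seq => A [i _] [Y mY <-]; rewrite setTI /=.
have := mf i measurableT Y mY.
by rewrite setTI.
Qed.

End measurable_rV.

Section row_cons.
Context (R : realType) (n : nat).

Definition row_cons (p : measurableTypeR R * 'rV[R]_n) : 'rV[R]_n.+1 :=
  row_mx (p.1 : R)%:M p.2.

Definition row_uncons (v : 'rV[R]_n.+1) : measurableTypeR R * 'rV[R]_n :=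
  (v ord0 ord0 : R, \row_j v ord0 (lift ord0 j)).

Lemma row_cons0 p : row_cons p ord0 ord0 = p.1.
Proof.
rewrite /row_cons mxE; case: splitP => [j _|j] //.
by rewrite !ord1 mxE.
Qed.

Lemma row_consS p j : row_cons p ord0 (lift ord0 j) = p.2 ord0 j.
Proof.
rewrite /row_cons mxE; case: splitP => [k|k] /=.
  by rewrite ord1.
by rewrite /bump /= !add1n => -[/val_inj ->].
Qed.

Lemma row_consK : cancel row_cons row_uncons.
Proof.
move=> p; rewrite /row_uncons row_cons0 [RHS]surjective_pairing; congr pair.
by apply/rowP => j; rewrite mxE row_consS.
Qed.

Lemma row_unconsK : cancel row_uncons row_cons.
Proof.
move=> v; apply/rowP => i; case: (unliftP ord0 i) => [j|] ->.
  by rewrite row_consS mxE.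
by rewrite row_cons0.
Qed.

Lemma measurable_row_cons : measurable_fun setT row_cons.
Proof.
apply/measurable_fun_coordP => i; case: (unliftP ord0 i) => [j|] ->.
  rewrite (_ : (fun _ => _) =
    (fun y : 'rV[R]_n => y ord0 j : measurableTypeR R) \o snd).
    exact: (measurableT_comp (measurable_coord j)).
  by apply/funext => p /=; rewrite row_consS.
rewrite (_ : (fun _ => _) = fst) //.
by apply/funext => p /=; rewrite row_cons0.
Qed.

Lemma measurable_row_uncons : measurable_fun setT row_uncons.
Proof.
apply/measurable_fun_pairP; split => /=; first exact: measurable_coord.
apply/measurable_fun_coordP => i.
rewrite (_ : (fun _ => _) =
  (fun y : 'rV[R]_n.+1 => y ord0 (lift ord0 i) : measurableTypeR R)).
  exact: measurable_coord.
by apply/funext => p /=; rewrite mxE.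
Qed.

End row_cons.

Section lebesgue_rVS.
Context (R : realType) (n : nat).
Variable mu : {sigma_finite_measure set 'rV[R]_n -> \bar R}.

Definition lebesgue_rVS : set 'rV[R]_n.+1 -> \bar R :=
  pushforward (@lebesgue_measure R \x mu)%E (@row_cons R n).

Let lebesgue_rVS0 : lebesgue_rVS set0 = 0%E.
Proof. by rewrite /lebesgue_rVS /pushforward preimage_set0 measure0. Qed.

Let lebesgue_rVS_ge0 A : (0 <= lebesgue_rVS A)%E.
Proof. by rewrite /lebesgue_rVS /pushforward measure_ge0. Qed.

Let lebesgue_rVS_sigma_additive : semi_sigma_additive lebesgue_rVS.
Proof.
move=> F mF tF mUF; rewrite /lebesgue_rVS /pushforward preimage_bigcup.
have mpre A : measurable A -> measurable (@row_cons R n @^-1` A).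
  by move=> mA; rewrite -[X in measurable X]setTI; exact: measurable_row_cons.
apply: measure_semi_sigma_additive => //.
- by move=> k; exact: mpre.
- apply/trivIsetP => /= i j _ _ ij; rewrite -preimage_setI.
  by move/trivIsetP : tF => /(_ _ _ _ _ ij) ->//; rewrite preimage_set0.
- by rewrite -preimage_bigcup; exact: mpre.
Qed.

HB.instance Definition _ := isMeasure.Build _ _ _ lebesgue_rVS
  lebesgue_rVS0 lebesgue_rVS_ge0 lebesgue_rVS_sigma_additive.

Let lebesgue_rVS_sigma_finite : sigma_finite setT lebesgue_rVS.
Proof.
have /sigma_finiteP[F [TF ndF Foo]] := sigma_finiteT (@lebesgue_measure R).
have /sigma_finiteP[G [TG ndG Goo]] := sigma_finiteT mu.
exists (fun k => @row_uncons R n @^-1` (F k `*` G k)).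
  apply/seteqP; split => // v _.
  have [k _ Fk] : (\bigcup_k F k) (row_uncons v).1 by rewrite -TF.
  have [l _ Gl] : (\bigcup_k G k) (row_uncons v).2 by rewrite -TG.
  exists (maxn k l) => //; split.
  - by move: Fk; exact/subsetPset/ndF/leq_maxl.
  - by move: Gl; exact/subsetPset/ndG/leq_maxr.
move=> k; have [mF Fk] := Foo k; have [mG Gk] := Goo k; split.
  rewrite -[X in measurable X]setTI.
  by apply: measurable_row_uncons => //; exact: measurableX.
rewrite /lebesgue_rVS /pushforward -comp_preimage (_ : _ \o _ = id).
  by rewrite preimage_id product_measure1E// lte_mul_pinfty// ge0_fin_numE.
by apply/funext => p /=; rewrite row_consK.
Qed.

HB.instance Definition _ := Measure_isSigmaFinite.Build _ _ _ lebesgue_rVS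
  lebesgue_rVS_sigma_finite.

End lebesgue_rVS.

Fixpoint lebesgue_rV (R : realType) (n : nat) :
    {sigma_finite_measure set 'rV[R]_n -> \bar R} :=
  match n with
  | 0 => dirac (0 : 'rV[R]_0)
  | m.+1 => lebesgue_rVS (lebesgue_rV R m)
  end.

Lemma lebesgue_rV_box (R : realType) (n : nat) (A : 'I_n -> set R) :
  (forall i, measurable (A i : set (measurableTypeR R))) ->
  measurable [set x : 'rV[R]_n | forall i, A i (x ord0 i)] /\
  lebesgue_rV R n [set x : 'rV[R]_n | forall i, A i (x ord0 i)] =
  (\prod_(i < n) lebesgue_measure (A i))%E.
Proof.
elim: n A => [|n IHn] A mA.
  rewrite (_ : [set x : 'rV[R]_0 | _] = setT); last first.
    by apply/seteqP; split => // x _ [].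
  by split => //; rewrite /= diracT big_ord0.
have [mB IH] := IHn (fun i => A (lift ord0 i)) (fun i => mA _).
have E : @row_cons R n @^-1` [set x : 'rV[R]_n.+1 | forall i, A i (x ord0 i)] =
    A ord0 `*` [set x : 'rV[R]_n | forall i, A (lift ord0 i) (x ord0 i)].
  apply/seteqP; split=> [[x y] /= H|[x y] [/= H0 HS] i].
    split => [|i] /=; first by have := H ord0; rewrite row_cons0.
    by have := H (lift ord0 i); rewrite row_consS.
  by case: (unliftP ord0 i) => [j|] ->; rewrite ?row_cons0 ?row_consS.
split; last first.
  rewrite /= /lebesgue_rVS /pushforward E product_measure1E//.
  by rewrite IH big_ord_recl.
rewrite (_ : [set x : 'rV[R]_n.+1 | _] = @row_uncons R n @^-1`
    (A ord0 `*` [set x : 'rV[R]_n | forall i, A (lift ord0 i) (x ord0 i)])).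
  rewrite -[X in measurable X]setTI.
  apply: measurable_row_uncons => //; exact: measurableX.
rewrite -E -comp_preimage (_ : _ \o _ = id) //.
by apply/funext => p /=; rewrite row_unconsK.
Qed.

(* * Differential calculus *)

(* Functions of class C^k on V (used for V finite-dimensional only). Asking
   for every directional differential x |-> 'd f x v to be C^k is then the same
   as asking for the differential itself to be C^k. *)
Fixpoint Ck (R : realType) (V W : normedModType R) (k : nat) (f : V -> W)
    : Prop :=
  match k with
  | 0 => continuous f
  | m.+1 => (forall x, differentiable f x) /\
            (forall v, Ck m (fun x => 'd f x v : W))
  end.

Section calculus.
Context (R : realType) (n : nat).
Implicit Types (f : 'rV[R]_n -> R) (b : 'rV[R]_n -> 'rV[R]_n).

Definition dotv (x y : 'rV[R]_n) : R := \sum_(i < n) x ord0 i * y ord0 i.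

Definition grad f (x : 'rV[R]_n) : 'rV[R]_n :=
  \row_(i < n) 'D_(delta_mx ord0 i) f x.

Definition divergence b (x : 'rV[R]_n) : R :=
  \sum_(i < n) 'D_(delta_mx ord0 i) (fun y => b y ord0 i) x.

Definition Yd_periodic (T : Type) (f : 'rV[R]_n -> T) : Prop :=
  forall (x : 'rV[R]_n) (k : 'rV[int]_n), f (x + map_mx intr k) = f x.

Definition Yd : set 'rV[R]_n := [set x | forall i, 0 <= x ord0 i < 1].

(* No normalisation is needed, see lebesgue_rV_Yd. *)
Definition mean f : R := \int[lebesgue_rV R n]_(x in Yd) f x.

Definition meanv b : 'rV[R]_n := \row_(i < n) mean (fun x => b x ord0 i).

Lemma lebesgue_rV_Yd : lebesgue_rV R n Yd = 1%E.
Proof.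
have -> : Yd = [set x : 'rV[R]_n | forall i, `[0, 1[%classic (x ord0 i)].
  by apply/seteqP; split => x Hx i; have := Hx i; rewrite /= in_itv.
have [//|_ ->] := @lebesgue_rV_box R n (fun=> `[0, 1[%classic).
rewrite big1// => i _.
by rewrite lebesgue_measure_itv/= lte_fin ltr01 sube0.
Qed.

End calculus.

(* * Cross product *)

(* det (x, w_0, ..., w_n), with the vectors as rows. *)
Definition det_rows (R : realType) (n : nat) (x : 'rV[R]_n.+2)
    (w : 'I_n.+1 -> 'rV[R]_n.+2) : R :=
  \det (col_mx x (\matrix_(j < n.+1) w j) : 'M[R]_(n.+2)).

Definition cross_product (R : realType) (n : nat) (w : 'I_n.+1 -> 'rV[R]_n.+2)
    : 'rV[R]_n.+2 :=
  \row_i det_rows (delta_mx ord0 i) w.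

Lemma cross_productP (R : realType) (n : nat) (w : 'I_n.+1 -> 'rV[R]_n.+2)
    (x : 'rV[R]_n.+2) :
  dotv x (cross_product w) = det_rows x w.
Proof.
rewrite /dotv /cross_product /det_rows.
have cofE (y : 'rV[R]_n.+2) i :
    cofactor (col_mx y (\matrix_(j < n.+1) w j) : 'M[R]_(n.+2)) ord0 i =
    cofactor (col_mx x (\matrix_(j < n.+1) w j) : 'M[R]_(n.+2)) ord0 i.
  rewrite /cofactor; congr (_ * \det _); apply/matrixP => j k; rewrite !mxE.
  by case: splitP => // l; rewrite ord1.
have topE (y : 'rV[R]_n.+2) i :
    (col_mx y (\matrix_(j < n.+1) w j) : 'M[R]_(n.+2)) ord0 i = y ord0 i.
  by rewrite mxE; case: splitP => // l _; rewrite ord1.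
rewrite [RHS](expand_det_row _ ord0); apply: eq_bigr => i _.
rewrite topE mxE (expand_det_row _ ord0) (bigD1 i)//= topE mxE !eqxx mul1r.
rewrite cofE big1 ?addr0// => j ji.
by rewrite topE mxE eqxx/= (negbTE ji) mul0r.
Qed.

(* Clockwise rotation by 90 degrees, acting on column vectors: the vector of
   coordinates (x, y) is sent to (y, - x). *)
Definition Rperp (R : realType) : 'M[R]_2 :=
  \matrix_(i, j) (if (i < j)%N then 1 else if (j < i)%N then -1 else 0).

(* With d = n.+2 and v_1, ..., v_d indexed by 0, ..., d - 1: the right-hand
   side of the equation for sigma b. *)
Definition gradient_product (R : realType) (n : nat) :
    ('I_n.+2 -> 'rV[R]_n.+2 -> R) -> 'rV[R]_n.+2 -> 'rV[R]_n.+2 :=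
  match n with
  | 0 => fun v x => (Rperp R *m (grad (v (lift ord0 ord0)) x)^T)^T
  | m.+1 => fun v x =>
      cross_product (fun j : 'I_m.+2 => grad (v (lift ord0 j)) x)
  end.

(* * The transport equation in R_+ x R^n *)

Section transport.
Context (R : realType) (n : nat).

Definition Rplus_rV : set (measurableTypeR R * 'rV[R]_n) :=
  [set p | (0 : R) <= p.1].

Definition lebesgue_tx :
    {measure set (measurableTypeR R * 'rV[R]_n)%type -> \bar R} :=
  (@lebesgue_measure R \x lebesgue_rV R n)%E.

Definition L1loc (u : R * 'rV[R]_n -> R) : Prop :=
  forall K : set (R * 'rV[R]_n), compact K -> K `<=` Rplus_rV ->
    lebesgue_tx.-integrable K (EFin \o u).

Definition test_function (phi : R * 'rV[R]_n -> R) : Prop :=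
  (forall k, Ck k phi) /\
  exists2 K : set (R * 'rV[R]_n),
    compact K & forall p, ~ K p -> phi p = 0.

(* Distributional solutions in L^1_loc of the Cauchy problem
     du/dt - c . grad u = 0  in (0, +oo) x R^n,   u(0, .) = u0;
   the test functions do not vanish at t = 0 and so account for the initial
   condition. *)
Definition transport_solution (c : 'rV[R]_n -> 'rV[R]_n) (u0 : 'rV[R]_n -> R)
    (u : R * 'rV[R]_n -> R) : Prop :=
  L1loc u /\
  forall phi, test_function phi ->
    \int[lebesgue_tx]_(p in Rplus_rV)
      (u p * ('D_(1, 0) phi p
              - divergence (fun y => phi (p.1, y) *: c y) p.2))
    + \int[lebesgue_rV R n]_x (u0 x * phi (0, x)) = 0.

(* Convergence in C^0_loc(R_+ x R^n), as e -> 0+, of a family of functions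
   defined almost everywhere: each u e has a continuous representative w e on
   R_+ x R^n, and these converge uniformly on compact sets. *)
Definition C0loc_cvg0 (u : R -> R * 'rV[R]_n -> R) (l : R * 'rV[R]_n -> R)
    : Prop :=
  exists w : R -> R * 'rV[R]_n -> R,
    (forall e, 0 < e ->
      {within (Rplus_rV : set (R * 'rV[R]_n)), continuous (w e)} /\
      {ae lebesgue_tx, forall p, Rplus_rV p -> u e p = w e p}) /\
    (forall K : set (R * 'rV[R]_n), compact K -> K `<=` Rplus_rV ->
      {uniform K, w @ 0^'+ --> l}).

End transport.

(* Main.v *)
Require Import Defs.
From HB Require Import structures.
From mathcomp Require Import all_boot all_order all_algebra.
From mathcomp Require Import all_classical all_reals all_analysis.
From mathcomp Require Import perm measurable_realfun lra ring.

Set Implicit Arguments.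
Unset Strict Implicit.
Unset Printing Implicit Defensive.

Import Order.TTheory GRing.Theory Num.Theory.
Import numFieldNormedType.Exports.

Local Open Scope classical_set_scope.
Local Open Scope ring_scope.

(*@@P1a*)
Section diff_app.
Context (R : realType) (E : normedModType R).
Implicit Types (f g : E -> R) (x v a : E).

Lemma diff_cst_app (c : R) x v : 'd (fun _ : E => c) x v = 0.
Proof. by rewrite (@diff_cst _ _ _ c x). Qed.

Lemma diffD_app f g x v : differentiable f x -> differentiable g x ->
  'd (fun y => f y + g y) x v = 'd f x v + 'd g x v.
Proof. by move=> df dg; rewrite diffD. Qed.

Lemma diffB_app f g x v : differentiable f x -> differentiable g x ->
  'd (fun y => f y - g y) x v = 'd f x v - 'd g x v.
Proof. by move=> df dg; rewrite diffB. Qed.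

Lemma diffM_app f g x v : differentiable f x -> differentiable g x ->
  'd (fun y => f y * g y) x v = f x * 'd g x v + g x * 'd f x v.
Proof. by move=> df dg; rewrite diffM. Qed.

Lemma diff_shift f a x : differentiable f (x + a) ->
  differentiable (fun y => f (y + a)) x /\
  forall v, 'd (fun y => f (y + a)) x v = 'd f (x + a) v.
Proof.
move=> df; have ds : is_diff x (fun z => z + a) id.
  apply: is_diff_eq (is_diffD (is_diff_id x) (is_diff_cst a x)) _.
  by rewrite addr0.
have [d1 E1] := is_diff_comp ds (differentiableP df).
by split => // v; rewrite -[RHS]/(('d f (x + a) \o id) v) -E1.
Qed.

Lemma diff_translate f a x : differentiable f (x + a) -> differentiable f x ->
  differentiable (fun y => f (y + a) - f y) x /\
  forall v, 'd (fun y => f (y + a) - f y) x v = 'd f (x + a) v - 'd f x v.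
Proof.
move=> dfa df; have [d1 E1] := diff_shift dfa.
split=> [|v]; first exact: differentiableB.
by rewrite -E1; exact: diffB_app.
Qed.

End diff_app.

Section continuous_app.
Context (R : realType) (T : topologicalType).

Lemma continuous_add (E : normedModType R) (f g : T -> E) :
  continuous f -> continuous g -> continuous (fun x => f x + g x).
Proof. by move=> cf cg x; exact: (cvgD (cf x) (cg x)). Qed.

Lemma continuous_sub (E : normedModType R) (f g : T -> E) :
  continuous f -> continuous g -> continuous (fun x => f x - g x).
Proof. by move=> cf cg x; exact: (cvgB (cf x) (cg x)). Qed.

Lemma continuous_mul (f g : T -> R) :
  continuous f -> continuous g -> continuous (fun x => f x * g x).
Proof. by move=> cf cg x; exact: (cvgM (cf x) (cg x)). Qed.

Lemma continuous_scale (E : normedModType R) (f : T -> R) (g : T -> E) :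
  continuous f -> continuous g -> continuous (fun x => f x *: g x).
Proof. by move=> cf cg x; exact: (cvgZ (cf x) (cg x)). Qed.

Lemma continuous_norm (E : normedModType R) (f : T -> E) :
  continuous f -> continuous (fun x => `|f x|).
Proof. by move=> cf x; exact: (cvg_norm (cf x)). Qed.

Lemma continuous_comp_app (U S : topologicalType) (f : T -> U) (g : U -> S) :
  continuous f -> continuous g -> continuous (fun x => g (f x)).
Proof. by move=> cf cg x; exact: (continuous_comp (cf x) (cg (f x))). Qed.

End continuous_app.

Lemma continuous_pair (T U S : topologicalType) (f : T -> U) (g : T -> S) :
  continuous f -> continuous g -> continuous (fun x => (f x, g x)).
Proof. by move=> cf cg x; exact: (cvg_pair (cf x) (cg x)). Qed.

Lemma continuous_id (T : topologicalType) : continuous (fun x : T => x).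
Proof. by move=> x; exact: cvg_id. Qed.

Lemma continuous_addl (R : realType) (E : normedModType R) (a : E) :
  continuous (fun y => a + y).
Proof. by apply: continuous_add; [exact: cst_continuous|exact: continuous_id]. Qed.

Lemma continuous_epsilon (R : realType) (E F : normedModType R) (f : E -> F) :
  (forall (x : E) (e : R), 0 < e -> exists2 d : R, 0 < d &
     forall z, `|z - x| < d -> `|f z - f x| <= e) -> continuous f.
Proof.
move=> H x; apply/cvgrPdist_le => e e0; have [d d0 Hd] := H x e e0.
apply/nbhs_ballP; exists d => //= z; rewrite -ball_normE/= => xz.
by rewrite distrC Hd// distrC.
Qed.

(*@@P1*)
Section C1.
Context (R : realType) (E : normedModType R).
Implicit Types (f g : E -> R).

Lemma Ck1_continuous f : Ck 1 f -> continuous f.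
Proof. by case=> df _ x; apply: differentiable_continuous. Qed.

Lemma Ck1_cst (c : R) : Ck 1 (fun _ : E => c).
Proof.
split=> [x|v x]; first exact: differentiable_cst.
rewrite (_ : (fun _ => _) = cst 0); first exact: cvg_cst.
 
by apply/funext => y; rewrite (@diff_cst _ _ _ c y).
Qed.

Lemma Ck1D f g : Ck 1 f -> Ck 1 g -> Ck 1 (fun x => f x + g x).
Proof.
move=> [df cf] [dg cg]; split=> [x|v x]; first exact: differentiableD.
have -> : (fun y => 'd (fun z => f z + g z) y v) =
    (fun y => 'd f y v + 'd g y v).
  by apply/funext => y; rewrite diffD.
exact: (cvgD (cf v x) (cg v x)).
Qed.

Lemma Ck1M f g : Ck 1 f -> Ck 1 g -> Ck 1 (fun x => f x * g x).
Proof.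
move=> Cf Cg; have [[df cf] [dg cg]] := (Cf, Cg); split=> [x|v x].
  exact: differentiableM.
have -> : (fun y => 'd (fun z => f z * g z) y v) =
    (fun y => f y * 'd g y v + g y * 'd f y v).
  by apply/funext => y; rewrite diffM.
by apply: cvgD; apply: cvgM; first [exact: Ck1_continuous|exact: cf|exact: cg].
Qed.

Lemma Ck1_prod (I : Type) (r : seq I) (F : I -> E -> R) :
  (forall i, Ck 1 (F i)) -> Ck 1 (fun x => \prod_(i <- r) F i x).
Proof.
move=> CF; elim: r => [|i r IH].
  rewrite (_ : (fun _ => _) = cst 1); first exact: Ck1_cst.
  by apply/funext => x; rewrite big_nil.
rewrite (_ : (fun _ => _) = fun x => F i x * \prod_(j <- r) F j x).
  exact: (Ck1M (CF i) IH).
by apply/funext => x; rewrite big_cons.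
Qed.

Lemma Ck1_sum (I : Type) (r : seq I) (F : I -> E -> R) :
  (forall i, Ck 1 (F i)) -> Ck 1 (fun x => \sum_(i <- r) F i x).
Proof.
move=> CF; elim: r => [|i r IH].
  rewrite (_ : (fun _ => _) = cst 0); first exact: Ck1_cst.
  by apply/funext => x; rewrite big_nil.
rewrite (_ : (fun _ => _) = fun x => F i x + \sum_(j <- r) F j x).
  exact: (Ck1D (CF i) IH).
by apply/funext => x; rewrite big_cons.
Qed.

End C1.

Lemma row_sum_delta (R : realType) m (x : 'rV[R]_m) :
  x = \sum_(i < m) x ord0 i *: delta_mx ord0 i.
Proof. exact: row_sum_delta. Qed.

Lemma continuous_sum (R : realType) (T : topologicalType) (I : Type)
    (r : seq I) (F : I -> T -> R) : (forall i, continuous (F i)) ->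
  continuous (fun x => \sum_(i <- r) F i x).
Proof. by move=> cF; apply: continuous_big => //; exact: add_continuous. Qed.

Lemma continuous_prod (R : realType) (T : topologicalType) (I : Type)
    (r : seq I) (F : I -> T -> R) : (forall i, continuous (F i)) ->
  continuous (fun x => \prod_(i <- r) F i x).
Proof. by move=> cF; apply: continuous_big => //; exact: mul_continuous. Qed.

Section chain.
Context (R : realType) (E : normedModType R) (m : nat).
Implicit Types (F : E -> 'rV[R]_m) (h : 'rV[R]_m -> R).

Lemma differentiable_rV F x :
  (forall j, differentiable (fun y => F y ord0 j) x) -> differentiable F x.
Proof.
move=> dF; rewrite (_ : F = \sum_(j < m) (fun y => F y ord0 j *: delta_mx ord0 j)).
  by apply: differentiable_sum => j; exact: differentiableZl.
by apply/funext => y; rewrite {1}[F y]row_sum_delta fct_sumE.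
Qed.

Lemma diff_rV F x v j : differentiable F x ->
  'd (fun y => F y ord0 j) x v = ('d F x v) ord0 j.
Proof.
move=> dF; have dj : differentiable (fun y => F y ord0 j) x.
  apply: (@differentiable_comp _ _ _ _ F (fun y : 'rV[R]_m => y ord0 j)) => //.
  exact: differentiable_coord.
rewrite -!deriveE// derive_mx ?mxE//.
exact: diff_derivable.
Qed.

Lemma diff_rVE h (x v : 'rV[R]_m) :
  'd h x v = \sum_(j < m) v ord0 j * 'd h x (delta_mx ord0 j).
Proof.
rewrite {1}[v]row_sum_delta linear_sum; apply: eq_bigr => j _.
by rewrite linearZ.
Qed.

Lemma diff_comp_rV F h x v : differentiable F x -> differentiable h (F x) ->
  'd (fun y => h (F y)) x v =
  \sum_(j < m) 'd (fun y => F y ord0 j) x v * 'd h (F x) (delta_mx ord0 j).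
Proof.
move=> dF dh; rewrite (_ : (fun y => h (F y)) = h \o F)// diff_comp//= diff_rVE.
by apply: eq_bigr => j _; rewrite diff_rV.
Qed.

Lemma continuous_rV (T : topologicalType) (F : T -> 'rV[R]_m) :
  (forall j, continuous (fun y => F y ord0 j)) -> continuous F.
Proof.
move=> cF x; apply/cvgrPdist_le => e e0.
have /= : \forall y \near x, forall j, `|F x ord0 j - F y ord0 j| <= e.
  by apply: filter_forall => j; exact: (cvgrPdist_le _ _).1 (cF j x) e e0.
apply: filterS => y Hy; rewrite /Num.Def.normr/= mx_normrE.
by apply: bigmax_le => [|[i j] _]; [exact: ltW|rewrite !mxE/= ord1].
Qed.

Lemma Ck1_comp F h : (forall j, Ck 1 (fun y => F y ord0 j)) -> Ck 1 h ->
  Ck 1 (fun y => h (F y)).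
Proof.
move=> CF Ch; have dF x : differentiable F x.
  by apply: differentiable_rV => j; have [] := CF j.
have cF : continuous F by move=> x; apply: differentiable_continuous.
have [dh ch] := Ch; split=> [x|v x].
  exact: (@differentiable_comp _ _ _ _ F h).
rewrite (_ : (fun _ => _) = fun y => \sum_(j < m)
    'd (fun y => F y ord0 j) y v * 'd h (F y) (delta_mx ord0 j)).
  apply: continuous_sum => j y; apply: cvgM; first exact: (CF j).2.
  by apply: (@continuous_comp _ _ _ F (fun z => 'd h z _)); [exact: cF|exact: ch].
by apply/funext => y; rewrite diff_comp_rV.
Qed.

End chain.

(*@@P1b*)
Lemma is_derive_line (R : realType) (E : normedModType R) (f : E -> R)
    (x h : E) (s : R) : differentiable f (x + s *: h) ->
  is_derive s 1 (fun r : R => f (x + r *: h)) ('d f (x + s *: h) h).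
Proof.
move=> df; have dl : is_diff s (fun r : R => x + r *: h) (fun r => r *: h).
  apply: is_diff_eq (@is_diffD _ _ _ _ _ _ _ s (is_diff_cst x s) (is_diff_scalel s h)) _.
  by rewrite add0r.
have dc : differentiable (f \o (fun r : R => x + r *: h)) s.
  exact: differentiable_comp.
apply: DeriveDef; first exact: diff_derivable.
rewrite deriveE// (_ : (fun r => f _) = f \o (fun r : R => x + r *: h))//.
by rewrite diff_comp//= [in LHS](diff_val (is_diff_def := dl)) scale1r.
Qed.

Lemma compact_ucont (R : realType) (E : normedModType R) (K : set E)
    (f : E -> R) (eta : R) : compact K -> continuous f -> 0 < eta ->
  exists2 k : R, 0 < k &
    forall x y, K x -> `|y - x| < k -> `|f y - f x| < eta.
Proof.
move=> /compact_near_coveringP cK cf eta0.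
have /= := @cK R 0^'+ (fun k x => forall y, `|y - x| < k -> `|f y - f x| < eta) _.
move=> /(_ _)[|k k0 Hk].
  move=> x Kx; have /cvgrPdist_lt/(_ (eta / 2)) := cf x.
  rewrite divr_gt0// => /(_ isT)/nbhs_normP[/= e e0 He].
  exists (ball x (e / 2), [set k | k < e / 2]) => /=.
    split; first by apply: nbhsx_ballx; rewrite divr_gt0.
    by apply: nbhs_right_lt; rewrite divr_gt0.
  case=> y k /= [xy ke] z zy.
  have H1 : `|f x - f y| < eta / 2.
    apply: He => /=; rewrite -ball_normE /= in xy.
    by lra.
  have H2 : `|f x - f z| < eta / 2.
    apply: He => /=; rewrite -ball_normE /= in xy.
    rewrite -(subrK y x) -addrA (le_lt_trans (ler_normD _ _))// [e]splitr.
    by rewrite ltrD// distrC (lt_trans zy).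
  rewrite distrC -(subrK (f x) (f y)) -addrA (le_lt_trans (ler_normD _ _))//.
  by rewrite [eta]splitr ltrD// distrC.
exists (k / 2); first by rewrite divr_gt0.
move=> x y Kx xy; apply: (Hk (k / 2)) => //=; last by rewrite divr_gt0.
by rewrite sub0r normrN gtr0_norm ?divr_gt0// ltr_pdivrMr// ltr_pMr// ltr1n.
Qed.

Lemma finite_radius (R : realType) (I : finType) (P : I -> R -> Prop) :
  (forall i k k', k' <= k -> P i k -> P i k') ->
  (forall i, exists2 k, 0 < k & P i k) ->
  exists2 k, 0 < k & forall i, P i k.
Proof.
move=> Pmono /(_ _)/cid2-/all_sig2[k k0 Pk].
exists (\big[Num.min/1]_i k i); first exact/bigmin_gtP.
by move=> i; apply: Pmono (Pk i); exact: bigmin_le.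
Qed.

Section finite_basis.
Context (R : realType) (E : normedModType R) (I : finType).
Variables (e : I -> E) (c : I -> E -> R).
Hypothesis sum_c : forall h, h = \sum_i c i h *: e i.
Hypothesis c_le : forall i h, `|c i h| <= `|h|.

Lemma diff_basis (f : E -> R) x h : 'd f x h = \sum_i c i h * 'd f x (e i).
Proof.
by rewrite {1}[h]sum_c linear_sum; apply: eq_bigr => i _; rewrite linearZ.
Qed.

Lemma Ck1_remainder (f : E -> R) (x h : E) eta : Ck 1 f ->
  (forall (y : E) i, `|y - x| <= `|h| -> `|'d f y (e i) - 'd f x (e i)| <= eta) ->
  `|f (x + h) - f x - 'd f x h| <= #|I|%:R * eta * `|h|.
Proof.
move=> [df _] Hy.
have dg (s : R) : is_derive s 1 (fun r : R => f (x + r *: h)) ('d f (x + s *: h) h).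
  exact/is_derive_line.
have [|s /[!in_itv]/= /andP[s0 s1] ] := @MVT_segment R _ _ 0 1 ler01 (fun s _ => dg s).
  apply: continuous_subspaceT => s.
  by apply/differentiable_continuous/derivable1_diffP; case: (dg s).
rewrite scale1r scale0r addr0 subr0 mulr1 => ->.
rewrite !diff_basis -sumrB (le_trans (ler_norm_sum _ _ _))//.
rewrite -mulrA mulr_natl -sumr_const ler_sum// => i _.
rewrite -mulrBr normrM mulrC ler_pM//.
by apply: Hy; rewrite addrC addKr normrZ ger0_norm// ler_piMl.
Qed.

Lemma Ck1_unif_diff (f : E -> R) (K : set E) eta : Ck 1 f -> compact K ->
  0 < eta -> exists2 k : R, 0 < k & forall x h : E, K x -> `|h| < k ->
    `|f (x + h) - f x - 'd f x h| <= eta * `|h|.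
Proof.
move=> Cf cK eta0; pose eta' := eta / (#|I|%:R + 1).
have n0 : 0 < #|I|%:R + 1 :> R by rewrite ltr_wpDl.
have eta'0 : 0 < eta' by rewrite divr_gt0.
have [|i|k k0 Hk] := @finite_radius R I
    (fun i k => forall x y, K x -> `|y - x| < k -> `|'d f y (e i) - 'd f x (e i)| < eta').
- by move=> i k k' kk' Hk x y Kx xy; apply: Hk => //; exact: lt_le_trans kk'.
- exact: compact_ucont cK (Cf.2 (e i)) eta'0.
exists k => // x h Kx hk.
apply: (@le_trans _ _ (#|I|%:R * eta' * `|h|)).
  apply: Ck1_remainder => // y i yx; apply/ltW/(Hk i) => //.
  exact: (le_lt_trans yx hk).
rewrite ler_wpM2r// /eta' mulrCA ler_piMr ?ltW// -/eta.
by rewrite ltr_pdivrMr// mul1r ltrDl.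
Qed.

End finite_basis.

(*@@P1c*)
Lemma is_diff_bound (R : realType) (V W : normedModType R) (f : V -> W)
    (df : {linear V -> W}) (x : V) : continuous df ->
  (forall eta : R, 0 < eta -> exists2 k : R, 0 < k & forall h : V, `|h| < k ->
     `|f (x + h) - f x - df h| <= eta * `|h|) -> is_diff x f df.
Proof.
move=> cdf Hf; have H : f \o shift x = cst (f x) + df +o_ 0 id.
  apply/eqaddoP => eta eta0; have [k k0 Hk] := Hf _ eta0.
  apply/nbhs_ballP; exists k => //= h; rewrite -ball_normE/= sub0r normrN => /Hk.
  by rewrite -addrA -opprD (addrC x).
have E := diff_unique cdf H.
by apply: DiffDef => //; apply/diff_locallyP; rewrite E.
Qed.

Section boxes.
Context (R : realType).

Lemma compact_rV_ball n (L : R) : compact [set x : 'rV[R]_n | `|x| <= L].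
Proof.
apply: bounded_closed_compact.
  by exists L; split; [exact: num_real|move=> y Ly x /= xL; exact: le_trans (ltW Ly)].
rewrite (_ : [set _ | _] = (fun x : 'rV[R]_n => `|x|) @^-1` [set y | y <= L])//.
by apply: closed_comp => // x _; exact: norm_continuous.
Qed.

Lemma compact_tx_ball n (L : R) : compact [set p : R * 'rV[R]_n | `|p| <= L].
Proof.
rewrite (_ : [set _ | _] = [set t : R | `|t| <= L] `*` [set x : 'rV[R]_n | `|x| <= L]).
  apply: compact_setX; last exact: compact_rV_ball.
  rewrite (_ : [set _ | _] = `[- L, L]%classic); first exact: segment_compact.
  by apply/seteqP; split=> t /=; rewrite in_itv/= ler_norml.
by apply/seteqP; split => -[t x] /=; rewrite prod_normE/= ge_max => /andP.
Qed.

Lemma rV_norm_le n (x : 'rV[R]_n) L : 0 <= L ->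
  (forall i, `|x ord0 i| <= L) -> `|x| <= L.
Proof.
move=> L0 xL; rewrite /Num.Def.normr/= mx_normrE.
by apply: bigmax_le => // -[i j] _ /=; rewrite ord1.
Qed.

Lemma coord_le_norm n (x : 'rV[R]_n) i : `|x ord0 i| <= `|x|.
Proof.
rewrite [leRHS]/Num.Def.normr/= mx_normrE.
exact: (le_bigmax _ (fun i => `|x i.1 i.2|) (ord0, i)).
Qed.

Lemma rV_norm_lt n (x : 'rV[R]_n) L : 0 < L ->
  (forall i, `|x ord0 i| < L) -> `|x| < L.
Proof.
move=> L0 xL; rewrite /Num.Def.normr/= mx_normrE.
by apply/bigmax_ltP; split => // -[i j] _ /=; rewrite ord1.
Qed.

Lemma norm_delta m (i : 'I_m) : `|delta_mx ord0 i : 'rV[R]_m| <= 1.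
Proof.
by apply: rV_norm_le => // j; rewrite !mxE; case: (_ && _); rewrite ?normr1 ?normr0.
Qed.

Lemma compact_bound (T : topologicalType) (K : set T) (f : T -> R) :
  compact K -> continuous f -> exists2 C, 0 < C & forall x, K x -> `|f x| <= C.
Proof.
move=> cK cf; have [K0|K0] := eqVneq K set0.
  by exists 1 => // x; rewrite K0.
have cf' : {within K, continuous (fun x => `|f x|)}.
  by apply: continuous_subspaceT => x; exact: (cvg_norm (cf x)).
have /set0P K0' := K0; have [c _ Hc] := compact_EVT_max K0' cK cf'.
exists (`|f c| + 1) => [|x Kx]; first by rewrite ltr_wpDl.
by rewrite (le_trans (Hc x _)) ?inE// lerDl.
Qed.

End boxes.

Section spacetime_basis.
Context (R : realType) (n : nat).

(** The index set of the coordinates of R * R^n is [option 'I_n], with [None]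
    for time. *)
Definition tx_delta (o : option 'I_n) : R * 'rV[R]_n :=
  if o is Some i then (0, delta_mx ord0 i) else (1, 0).

Definition tx_coord (o : option 'I_n) (p : R * 'rV[R]_n) : R :=
  if o is Some i then p.2 ord0 i else p.1.

Lemma sum_option (V : nmodType) (F : option 'I_n -> V) :
  \sum_o F o = F None + \sum_i F (Some i).
Proof.
rewrite (bigD1 None)//= (reindex_omap Some id)/=; last by case.
by congr (_ + _); apply: eq_bigl => i /=; rewrite eqxx.
Qed.

Lemma tx_sum_delta p : p = \sum_o tx_coord o p *: tx_delta o.
Proof.
rewrite sum_option [LHS]surjective_pairing; congr pair.
  rewrite (big_morph (fst : R * 'rV[R]_n -> R) (id1 := 0) (op1 := +%R))//=.
  by rewrite big1 ?addr0 /GRing.scale/= ?mulr1// => i _; rewrite mulr0.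
rewrite (big_morph (snd : R * 'rV[R]_n -> _) (id1 := 0) (op1 := +%R))//=.
by rewrite scaler0 add0r -row_sum_delta.
Qed.

Lemma tx_coord_le o p : `|tx_coord o p| <= `|p|.
Proof.
case: p o => t x [i|]; rewrite prod_normE/= le_max ?lexx//.
by rewrite coord_le_norm orbT.
Qed.

End spacetime_basis.

(*@@P2*)
Section rV_measure.
Context (R : realType).
Local Notation mR := (measurableTypeR R).

Lemma measurable_rV_ball n (q : 'rV[R]_n) (r : R) : 0 < r ->
  measurable [set x : 'rV[R]_n | `|q - x| < r].
Proof.
move=> r0; rewrite (_ : [set _ | _] =
  [set x : 'rV[R]_n | forall i, `]q ord0 i - r, q ord0 i + r[%classic (x ord0 i)]).
  by have [|] := @lebesgue_rV_box R n (fun i => `]q ord0 i - r, q ord0 i + r[%classic).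
apply/seteqP; split => x /= xr.
  move=> i; rewrite in_itv/=.
  have := le_lt_trans (coord_le_norm (q - x) i) xr.
  by rewrite !mxE ltr_norml; lra.
apply: rV_norm_lt => // i; have := xr i; rewrite in_itv/= !mxE ltr_norml; lra.
Qed.

Lemma open_measurable_rV n (U : set 'rV[R]_n) : open U -> measurable U.
Proof.
move=> oU; pose B (p : 'rV[rat]_n * nat) : set 'rV[R]_n :=
  [set x | `|map_mx ratr p.1 - x| < p.2.+1%:R^-1].
pose F p := if `[< B p `<=` U >] then B p else set0.
have -> : U = \bigcup_p F p.
  apply/seteqP; split=> [x Ux|x [p _]]; last by rewrite /F; case: asboolP => // BU /BU.
  move: oU; rewrite openE => /(_ _ Ux)/nbhs_ballP[e /= e0 eU].
  pose k := Num.bound (2 / e).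
  have ke : 2 / k.+1%:R < e.
    rewrite ltr_pdivrMr// -ltr_pdivrMl// mulrC.
    apply: lt_trans (archi_boundP _) _; first by rewrite divr_ge0// ltW.
    by rewrite ltr_nat.
  have k0 : 0 < k.+1%:R^-1 :> R by rewrite invr_gt0.
  have /choice[q qx] i : exists q : rat, `|ratr q - x ord0 i| < k.+1%:R^-1.
    have : x ord0 i - k.+1%:R^-1 < x ord0 i + k.+1%:R^-1.
      by rewrite ltrBlDr -addrA ltrDl addr_gt0.
    move=> /rat_in_itvoo[q]; rewrite in_itv/= => qi; exists q.
    by case/andP: qi => q1 q2; rewrite ltr_norml ltrBlDl q2 ltrBrDl q1.
  have Bx : B (\row_i q i, k) x.
    by apply: rV_norm_lt => // i; rewrite !mxE.
  exists (\row_i q i, k) => //; rewrite /F; case: asboolP => // -[] y By.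
  apply: eU; rewrite -ball_normE/=; apply: lt_trans ke.
  rewrite -(subrK (map_mx ratr (\row_i q i)) x) -addrA (le_lt_trans (ler_normD _ _))//.
  by rewrite [2 / _]mulr_natl mulr2n ltrD// distrC.
apply: countable_bigcupT_measurable => [|p]; first exact: countableP.
by rewrite /F; case: ifP => // _; apply: measurable_rV_ball; rewrite invr_gt0.
Qed.

Lemma continuous_measurable_rV n (f : 'rV[R]_n -> R) : continuous f ->
  measurable_fun setT (f : _ -> mR).
Proof.
move=> /continuousP cf; apply: (measurability _ (measurable_realfun.RGenOpens.measurableE R)).
move=> _ [_ [a [b ->] <-]]; rewrite setTI; apply: open_measurable_rV.
exact/cf/interval_open.
Qed.

Lemma continuous_row_uncons n : continuous (fun v : 'rV[R]_n.+1 =>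
  (v ord0 ord0 : R, \row_j v ord0 (lift ord0 j) : 'rV[R]_n)).
Proof.
move=> v.
have c2 : continuous (fun v : 'rV[R]_n.+1 => \row_j v ord0 (lift ord0 j) : 'rV[R]_n).
  apply: continuous_rV => j.
  by under eq_fun do rewrite mxE; exact: coord_continuous.
exact: (cvg_pair (@coord_continuous R _ _ ord0 ord0 v) (c2 v)).
Qed.

Lemma continuous_measurable_tx n (f : R * 'rV[R]_n -> R) : continuous f ->
  measurable_fun setT (f : mR * 'rV[R]_n -> mR).
Proof.
move=> cf; pose g (v : 'rV[R]_n.+1) := f (v ord0 ord0 : R, \row_j v ord0 (lift ord0 j)).
have -> : f = g \o @row_cons R n.
  by apply/funext => p; rewrite /g/= -[p in LHS]row_consK.
apply: measurableT_comp; last exact: measurable_row_cons.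
apply: continuous_measurable_rV.
by move=> x; apply: continuous_comp; [exact: continuous_row_uncons|exact: cf].
Qed.

Lemma box_lty (L : R) n :
  measurable [set x : 'rV[R]_n | `|x| <= L] /\
  (lebesgue_rV R n [set x : 'rV[R]_n | `|x| <= L]%R < +oo)%E.
Proof.
have [L0|L0] := leP 0 L; last first.
  rewrite (_ : [set _ | _] = set0) ?measure0//.
  by apply/seteqP; split => // x /= /(le_trans (normr_ge0 _)); rewrite leNgt L0.
rewrite (_ : [set _ | _] =
    [set x : 'rV[R]_n | forall i, `[- L, L]%classic (x ord0 i)]).
  have [//|mB ->] := @lebesgue_rV_box R n (fun=> `[- L, L]%classic).
  split => //; rewrite lebesgue_measure_itv/= lte_fin.
  suff : (\prod_(i < n) (if (- L < L)%R then L%:E - (- L)%:E else 0)%E)%E \is a fin_num.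
    by move=> /fin_numPlt/andP[].
  elim/big_ind : _ => // [x y|i _]; first exact: fin_numM.
  by case: ifP.
apply/seteqP; split => x /= xL.
  by move=> i; rewrite in_itv/= -ler_norml; exact: le_trans (coord_le_norm _ _) xL.
by apply: rV_norm_le => // i; have := xL i; rewrite in_itv/= ler_norml.
Qed.

Definition bounded_support (T : Type) (nrm : T -> R) (f : T -> R) : Prop :=
  exists2 C : R, 0 <= C & forall x, `|f x| <= C /\ (C < nrm x -> f x = 0).

Lemma integrable_rV n (f : 'rV[R]_n -> R) : measurable_fun setT (f : _ -> mR) ->
  bounded_support (fun x => `|x|) f ->
  (lebesgue_rV R n).-integrable setT (EFin \o f).
Proof.
move=> mf [C C0 fC]; have [mB Bfin] := box_lty C n.
have fE : f = f \_ [set x | `|x| <= C].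
  apply/funext => x; rewrite patchE; case: ifPn => // /negP; rewrite inE /=.
  by move=> /negP; rewrite -ltNge => /(fC x).2.
rewrite fE -restrict_EFin; apply: (integrable_mkcond _ mB).1.
apply: measurable_bounded_integrable => //; first exact: measurable_funTS.
by exists C; split; [exact: num_real|move=> y Cy x _; exact: le_trans (fC x).1 (ltW Cy)].
Qed.

Lemma integrable_tx n (f : R * 'rV[R]_n -> R) :
  measurable_fun setT (f : mR * 'rV[R]_n -> mR) ->
  bounded_support (fun p => `|p|) f ->
  (lebesgue_tx R n).-integrable setT (EFin \o f).
Proof.
move=> mf [C C0 fC]; have [mB Bfin] := box_lty C n.
pose D : set (mR * 'rV[R]_n) := `[- C, C]%classic `*` [set x | `|x| <= C].
have mD : measurable D by apply: measurableX => //; exact: measurable_itv.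
have fE : f = f \_ D.
  apply/funext => x; rewrite patchE; case: ifPn => // /negP; rewrite inE /D /= => Dx.
  apply: (fC x).2; rewrite ltNge; apply: contra_notN Dx.
  by rewrite prod_normE ge_max /= in_itv/= ler_norml => /andP.
rewrite fE -restrict_EFin; apply: (integrable_mkcond _ mD).1.
apply: measurable_bounded_integrable => //; last 2 first.
- exact: measurable_funTS.
- by exists C; split; [exact: num_real|move=> y Cy x _; exact: le_trans (fC x).1 (ltW Cy)].
rewrite [X in (X < _)%E](_ : _ = lebesgue_measure `[(- C)%R, C]%classic *
  lebesgue_rV R n [set x | `|x| <= C]%R)%E; last first.
  by apply: product_measure1E => //; exact: measurable_itv.
rewrite lte_mul_pinfty//; first by rewrite lebesgue_measure_itv/=; case: ifP.
Qed.

(** [x] with its [i]-th coordinate replaced by [s]. *)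
Definition set_coord n (x : 'rV[R]_n) (i : 'I_n) (s : R) : 'rV[R]_n :=
  \row_j if j == i then s else x ord0 j.

Lemma set_coord_lift n (r s : R) (y : 'rV[R]_n) j :
  set_coord (row_cons (r, y)) (lift ord0 j) s = row_cons (r, set_coord y j s).
Proof.
apply/rowP => i; case: (unliftP ord0 i) => [k|] ->.
  by rewrite [LHS]mxE [RHS]row_consS [RHS]mxE row_consS (inj_eq lift_inj).
by rewrite [LHS]mxE [RHS]row_cons0 row_cons0.
Qed.

Lemma set_coord0 n (r s : R) (y : 'rV[R]_n) :
  set_coord (row_cons (r, y)) ord0 s = row_cons (s, y).
Proof.
apply/rowP => i; case: (unliftP ord0 i) => [k|] ->.
  by rewrite [LHS]mxE [RHS]row_consS row_consS.
by rewrite [LHS]mxE [RHS]row_cons0.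
Qed.

Lemma row_cons_norm n (p : R * 'rV[R]_n) : `|p| <= `|row_cons p|.
Proof.
rewrite prod_normE ge_max/=; apply/andP; split.
  by rewrite -(row_cons0 p); exact: coord_le_norm.
by apply: rV_norm_le => // i; rewrite -row_consS coord_le_norm.
Qed.

Lemma integral_rVS n (f : 'rV[R]_n.+1 -> R) :
  measurable_fun setT (f : _ -> mR) -> bounded_support (fun x => `|x|) f ->
  (\int[lebesgue_rV R n.+1]_x (f x)%:E =
   \int[lebesgue_tx R n]_p (f (row_cons p))%:E)%E /\
  (lebesgue_tx R n).-integrable setT (fun p => (f (row_cons p))%:E).
Proof.
move=> mf [C C0 fC].
have it : (lebesgue_tx R n).-integrable setT (fun p => (f (row_cons p))%:E).
  apply: (@integrable_tx _ (fun p => f (row_cons p))).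
    by apply: (measurableT_comp mf); exact: measurable_row_cons.
  exists C => // -[t x]; split; first exact: (fC _).1.
  by move=> Cx; apply: (fC _).2; apply: lt_le_trans Cx (row_cons_norm _).
split=> //; have := @integral_pushforward _ _ _ _ R (@row_cons R n)
  (@measurable_row_cons R n) (lebesgue_tx R n) setT (EFin \o f).
rewrite preimage_setT; apply => //.
exact/measurable_EFinP.
Qed.

Lemma integral_slice0 n (f : 'rV[R]_n -> R) i :
  measurable_fun setT (f : _ -> mR) -> bounded_support (fun x => `|x|) f ->
  (forall x, \int[@lebesgue_measure R]_s (f (set_coord x i s))%:E = 0)%E ->
  (\int[lebesgue_rV R n]_x (f x)%:E = 0)%E.
Proof.
elim: n => [|n IH] in f i *; first by case: i.
move=> mf sf f0; have [-> it] := integral_rVS mf sf.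
case: (unliftP ord0 i) f0 => [j|] -> f0.
  rewrite -(integral12_prod_meas1 it) integral0_eq// => r _.
  rewrite /fubini_F; apply: (IH (fun y => f (row_cons (r, y))) j).
  - by apply: (measurableT_comp mf); exact: (measurableT_comp (@measurable_row_cons R n)).
  - case: sf => C C0 fC; exists C => // y; split; first exact: (fC _).1.
    move=> Cy; apply: (fC _).2; apply: lt_le_trans Cy _.
    by apply: le_trans (row_cons_norm _); rewrite prod_normE le_max lexx orbT.
  - by move=> x; under eq_integral do rewrite -set_coord_lift.
rewrite -(integral21_prod_meas1 it) integral0_eq// => y _.
by rewrite /fubini_G; under eq_integral do rewrite -(set_coord0 0).
Qed.

End rV_measure.

(*@@P2b*)
Section FTC.
Context (R : realType).
Local Notation mu := (@lebesgue_measure R).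

Lemma FTC_itvco (F f : R -> R) a b : a < b ->
  (forall s : R, is_derive s 1 F (f s)) -> continuous f ->
  (\int[mu]_(s in `[a, b[) (f s)%:E = (F b - F a)%:E)%E.
Proof.
move=> ab dF cf; have cF s : {for s, continuous F}.
  by apply/differentiable_continuous/derivable1_diffP; case: (dF s).
rewrite integral_itv_bndo_bndc; last first.
  apply: measurable_funTS; apply/measurable_EFinP; exact: continuous_measurable_fun.
rewrite (@continuous_FTC2 _ f F)// ?EFinB//.
- exact: continuous_subspaceT.
- split; first by move=> s _; case: (dF s).
    exact: cvg_at_right_filter (cF a).
  exact: cvg_at_left_filter (cF b).
- by move=> s _; rewrite derive1E; case: (dF s).
Qed.

Lemma set_coordE n (x : 'rV[R]_n) i s :
  set_coord x i s = set_coord x i 0 + s *: delta_mx ord0 i.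
Proof.
apply/rowP => j; rewrite !mxE eqxx/=; case: eqVneq => _ /=.
  by rewrite add0r mulr1.
by rewrite mulr0 addr0.
Qed.

Lemma continuous_set_coord n (x : 'rV[R]_n) i :
  continuous (fun s : R => set_coord x i s).
Proof.
rewrite (_ : (fun s => _) = fun s : R => set_coord x i 0 + s *: delta_mx ord0 i).
  by move=> s; apply: cvgD; [exact: cvg_cst|apply: cvgZr_tmp; exact: cvg_id].
by apply/funext => s; exact: set_coordE.
Qed.

Lemma is_derive_set_coord n (f : 'rV[R]_n -> R) x i (s : R) :
  (forall y, differentiable f y) ->
  is_derive s 1 (fun r : R => f (set_coord x i r))
    ('d f (set_coord x i s) (delta_mx ord0 i)).
Proof.
move=> df; under eq_fun do rewrite set_coordE.
by rewrite (set_coordE x i s); exact: (@is_derive_line _ _ f).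
Qed.

(** By Fubini and the fundamental theorem of calculus along the [i]-th axis. *)
Lemma integral_box_partial n (f : 'rV[R]_n -> R) (i : 'I_n) a b : a < b ->
  Ck 1 f -> (forall x, f (set_coord x i a) = f (set_coord x i b)) ->
  \int[lebesgue_rV R n]_(x in [set x : 'rV[R]_n | forall j, a <= x ord0 j < b])
    'd f x (delta_mx ord0 i) = 0.
Proof.
move=> ab [df cf] fab; set D := [set x | _].
have DE : D = [set x : 'rV[R]_n | forall j, `[a, b[%classic (x ord0 j)].
  by apply/seteqP; split => x Dx j; have := Dx j; rewrite /= in_itv.
have mD : measurable D.
  by rewrite DE; have [|] := @lebesgue_rV_box R n (fun i => `[a, b[%classic).
pose C := `|a| + `|b|.
have DC x : D x -> `|x| <= C.
  move=> Dx; apply: rV_norm_le; first exact: addr_ge0.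
  move=> j; have /andP[] := Dx j; rewrite /C ler_norml.
  have := (ler_norm b, ler_norm (- a), normr_ge0 a, normr_ge0 b).
  by rewrite normrN => -[[[]]]; lra.
rewrite /Rintegral integral_mkcond.
set g := _ \_ D; have gE : g = fun x => ((fun x => 'd f x (delta_mx ord0 i)) \_ D x)%:E.
  by apply/funext => x; rewrite /g !patchE; case: ifP.
rewrite gE (@integral_slice0 _ _ _ i)//.
- apply: (measurable_restrictT _ mD).1; apply: measurable_funTS.
  exact: (continuous_measurable_rV (cf _)).
- have [M M0 HM] := compact_bound (@compact_rV_ball R n C) (cf (delta_mx ord0 i)).
  exists (M + C); first by rewrite addr_ge0// ?addr_ge0// ltW.
  move=> x; rewrite patchE; case: ifPn => [/set_mem Dx|_].
    split; first by rewrite (le_trans (HM _ (DC _ Dx)))// lerDl addr_ge0.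
    by move=> Cx; have := DC _ Dx; lra.
  by rewrite normr0 !addr_ge0// ltW.
- move=> x; pose Dx := [set s | D (set_coord x i s)].
  have [xD|xD] := pselect (forall j, j != i -> a <= x ord0 j < b).
    transitivity (\int[mu]_(s in `[a, b[) ('d f (set_coord x i s) (delta_mx ord0 i))%:E)%E.
      rewrite [RHS]integral_mkcond; apply: eq_integral => s _.
      rewrite !patchE; have -> : (set_coord x i s \in D) = (s \in `[a, b[%classic).
        apply/idP/idP => /[!inE] /=.
          by move=> /(_ i); rewrite mxE eqxx in_itv.
        rewrite in_itv/= => sab j; rewrite mxE; case: eqVneq => // /xD.
        exact.
      by case: ifP.
    rewrite (FTC_itvco ab (fun s => is_derive_set_coord x i s df)).
      by rewrite fab subrr.
    move=> s; exact: (continuous_comp (@continuous_set_coord n x i s)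
      (cf (delta_mx ord0 i) (set_coord x i s))).
  rewrite integral0_eq// => s _; rewrite patchE; case: ifPn => // /set_mem Ds.
  exfalso; apply: xD => j ji; have := Ds j; rewrite mxE.
  by rewrite (negbTE ji).
Qed.

Lemma integral_Yd_partial n (f : 'rV[R]_n -> R) (i : 'I_n) :
  Ck 1 f -> Yd_periodic f -> mean (fun x => 'd f x (delta_mx ord0 i)) = 0.
Proof.
move=> Cf pf; rewrite /mean; apply: integral_box_partial => // x.
rewrite -(pf (set_coord x i 0) (delta_mx ord0 i)) (set_coordE x i 1) scale1r.
by congr (f (_ + _)); apply/matrixP => j k; rewrite !mxE rmorph_nat.
Qed.

Lemma diff_out_support (E : normedModType R) (f : E -> R) (L : R) (x v : E) :
  differentiable f x -> (forall x : E, L < `|x| -> f x = 0) -> L < `|x| ->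
  'd f x v = 0.
Proof.
move=> df f0 Lx; rewrite -deriveE//.
rewrite (@near_eq_derive _ _ _ f (cst 0)) ?derive_cst//.
have : \forall y \near x, L < `|y|.
  have /cvgrPdist_lt/(_ (`|x| - L)) := @norm_continuous _ _ x.
  rewrite subr_gt0 => /(_ Lx); apply: filterS => y.
  by rewrite ltr_norml => /andP[_]; lra.
by apply: filterS => y /f0.
Qed.

Lemma integral_compact_partial n (f : 'rV[R]_n -> R) (i : 'I_n) L :
  Ck 1 f -> (forall x, L < `|x| -> f x = 0) ->
  \int[lebesgue_rV R n]_x 'd f x (delta_mx ord0 i) = 0.
Proof.
move=> Cf f0; pose M : R := `|L| + 1; have LM : L < M.
  by rewrite /M (le_lt_trans (ler_norm _))// ltrDl.
have M0 : 0 < M by rewrite /M ltr_wpDl.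
have MM : - M < M by lra.
have fM s : `|s| = M -> forall x, f (set_coord x i s) = 0.
  move=> sM x; apply/f0/(lt_le_trans LM); rewrite -sM.
  by rewrite (le_trans _ (coord_le_norm _ i))// mxE eqxx.
rewrite -[RHS](@integral_box_partial n f i _ _ MM Cf); last first.
  by move=> x; rewrite !fM ?normrN// gtr0_norm.
rewrite [RHS]Rintegral_mkcond; apply: eq_Rintegral => x _; rewrite patchE.
case: ifPn => // /negP xM; apply: diff_out_support f0 _; first exact: Cf.1.
apply: (lt_le_trans LM); rewrite leNgt; apply: contra_notN xM => xM.
rewrite inE /= => j; have := le_lt_trans (coord_le_norm x j) xM.
by rewrite ltr_norml => /andP[/ltW -> ->].
Qed.

End FTC.

(*@@P3*)
Section second_differential.
Context (R : realType) (E : normedModType R).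
Implicit Types (f : E -> R) (x u v : E).

Lemma MVT_line f x v (h : R) : 0 <= h -> (forall y, differentiable f y) ->
  exists2 r : R, 0 <= r <= h & f (x + h *: v) - f x = h * 'd f (x + r *: v) v.
Proof.
move=> h0 df; have dg (s : R) : is_derive s 1 (fun r : R => f (x + r *: v))
    ('d f (x + s *: v) v) by exact: is_derive_line.
have [|r] := @MVT_segment R _ _ 0 h h0 (fun s _ => dg s).
  apply: continuous_subspaceT => s.
  by apply/differentiable_continuous/derivable1_diffP; case: (dg s).
rewrite in_itv/= subr0 scale0r addr0 mulrC => rh ->; by exists r.
Qed.

Lemma second_difference f x u v (h : R) : 0 < h -> Ck 2 f ->
  exists2 p : E, `|p - x| <= h * (`|u| + `|v|) &
   f (x + h *: u + h *: v) - f (x + h *: u) - (f (x + h *: v) - f x) =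
   h * h * 'd (fun y => 'd f y u) p v.
Proof.
move=> h0 [df Cf]; have h0' := ltW h0.
pose g y := f (y + h *: v) - f y.
have dg y : differentiable g y /\ forall w, 'd g y w = 'd f (y + h *: v) w - 'd f y w.
  exact: diff_translate.
have [r /andP[r0 rh] Er] := @MVT_line g x u h h0' (fun y => (dg y).1).
have [s /andP[s0 sh] Es] := @MVT_line (fun y => 'd f y u) (x + r *: u) v h h0' (Cf u).1.
exists (x + r *: u + s *: v).
  rewrite -[x + _ + _]addrA [x + _]addrC addrK (le_trans (ler_normD _ _))// !normrZ mulrDr !ger0_norm//.
  by rewrite lerD// ler_wpM2r.
rewrite -/(g (x + h *: u)) -/(g x) Er.
by rewrite (dg _).2 -mulrA -Es.
Qed.

Lemma Ck2_sym f x u v : Ck 2 f ->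
  'd (fun y => 'd f y u) x v = 'd (fun y => 'd f y v) x u.
Proof.
move=> Cf; apply/eqP; rewrite -subr_eq0 -normr_le0; apply/ler_addgt0Pl => e e0.
rewrite addr0; have e20 : 0 < e / 2 by rewrite divr_gt0.
have /cvgrPdist_lt/(_ _ e20)/nbhs_ballP[r r0 Hr] := (Cf.2 u).2 v x.
have /cvgrPdist_lt/(_ _ e20)/nbhs_ballP[r' r'0 Hr'] := (Cf.2 v).2 u x.
pose M := `|u| + `|v| + 1; have M0 : 0 < M by rewrite ltr_wpDl// addr_ge0.
pose m := Num.min r r'; have m0 : 0 < m by rewrite lt_min r0.
pose h := m / M; have h0 : 0 < h by rewrite divr_gt0.
have hM : h * (`|u| + `|v|) < m.
  by rewrite -[ltRHS](divfK (lt0r_neq0 M0)) ltr_pM2l// /M ltrDl.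
have [p px Ep] := second_difference x u v h0 Cf.
have [q qx Eq] := second_difference x v u h0 Cf.
rewrite [`|v| + _]addrC in qx.
have pq : 'd (fun y => 'd f y u) p v = 'd (fun y => 'd f y v) q u.
  apply: (@mulfI _ (h * h)); first by rewrite mulf_neq0// gt_eqF.
  rewrite -Ep -Eq [x + h *: v + _]addrAC; ring.
rewrite -(subrK ('d (fun y => 'd f y u) p v) ('d (fun y => 'd f y u) x v)) -addrA.
rewrite {2}pq (le_trans (ler_normD _ _))// [e]splitr lerD//; apply/ltW.
  apply: (Hr p); rewrite -ball_normE/= distrC (le_lt_trans px)//.
  by rewrite (lt_le_trans hM)// /m ge_min lexx.
rewrite distrC; apply: (Hr' q); rewrite -ball_normE/= distrC (le_lt_trans qx)//.
by rewrite (lt_le_trans hM)// /m ge_min lexx orbT.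
Qed.

End second_differential.

(*@@P3b*)
Section determinant.
Context (R : realType) (m : nat).
Implicit Types (w : 'I_m -> 'rV[R]_m) (k : 'I_m) (u : 'rV[R]_m).

Definition detr w : R := \det (\matrix_i w i).

Definition set_row w k u : 'I_m -> 'rV[R]_m := fun i => if i == k then u else w i.

Lemma set_row_id w k : set_row w k (w k) = w.
Proof. by apply/funext => i; rewrite /set_row; case: eqP => // ->. Qed.

Lemma detr_linear w k (c1 c2 : R) u1 u2 :
  detr (set_row w k (c1 *: u1 + c2 *: u2)) =
  c1 * detr (set_row w k u1) + c2 * detr (set_row w k u2).
Proof.
apply: (@determinant_multilinear _ _ _ _ _ k).
- by apply/rowP => j; rewrite !mxE /set_row eqxx !mxE.
- by apply/matrixP => i j; rewrite !mxE /set_row eq_sym (negbTE (neq_lift _ _)).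
- by apply/matrixP => i j; rewrite !mxE /set_row eq_sym (negbTE (neq_lift _ _)).
Qed.

Lemma detr0 w k : detr (set_row w k 0) = 0.
Proof. by have := detr_linear w k 0 0 0 0; rewrite !scale0r addr0 !mul0r addr0. Qed.

Lemma detr_alternate w j k : j != k -> w j = w k -> detr w = 0.
Proof.
move=> jk wjk; apply: (determinant_alternate jk) => l.
by rewrite !mxE wjk.
Qed.

Lemma detr_sum w k (I : finType) (c : I -> R) (u : I -> 'rV[R]_m) :
  detr (set_row w k (\sum_i c i *: u i)) = \sum_i c i * detr (set_row w k (u i)).
Proof.
elim/big_rec2 : _ => [|i y1 y2 _ <-]; first exact: detr0.
by rewrite -[X in detr (set_row w k (_ + X))]scale1r detr_linear mul1r.
Qed.

Lemma detr_expand w k :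
  detr w = \sum_i w k ord0 i * detr (set_row w k (delta_mx ord0 i)).
Proof. by rewrite -detr_sum -row_sum_delta set_row_id. Qed.

(** Contracting a symmetric form with two rows of the determinant gives zero. *)
Lemma detr_sym0 w j k (H : 'I_m -> 'I_m -> R) : j != k ->
  (forall i l, H i l = H l i) ->
  \sum_i \sum_l H i l *
    detr (set_row (set_row w k (delta_mx ord0 i)) j (delta_mx ord0 l)) = 0.
Proof.
move=> jk sH; pose D u1 u2 := detr (set_row (set_row w k u1) j u2).
have rowC u1 u2 : set_row (set_row w k u1) j u2 = set_row (set_row w j u2) k u1.
  apply/funext => i; rewrite /set_row; case: (eqVneq i j) => // ->.
  by rewrite (negbTE jk).
have D0 u : D u u = 0.
  by apply: (detr_alternate jk); rewrite /set_row eqxx eq_sym (negbTE jk) eqxx.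
have DC u1 u2 : D u1 u2 = - D u2 u1.
  apply/eqP; rewrite -addr_eq0; apply/eqP.
  have Dr a b c : D a (b + c) = D a b + D a c.
    by have := detr_linear (set_row w k a) j 1 1 b c; rewrite !scale1r !mul1r.
  have Dl a b c : D (b + c) a = D b a + D c a.
    rewrite /D !rowC; have := detr_linear (set_row w j a) k 1 1 b c.
    by rewrite !scale1r !mul1r.
  by have := D0 (u1 + u2); rewrite Dr !Dl !D0 add0r addr0 addrC.
have SN : forall S : R, S = - S -> S = 0 by move=> S; lra.
apply: SN; rewrite [LHS]exchange_big/= -sumrN; apply: eq_bigr => l _.
rewrite -sumrN; apply: eq_bigr => i _.
by rewrite -mulrN -/(D _ _) -/(D _ _) -DC sH.
Qed.

Variables (E : normedModType R).

Lemma is_diff_prod (I : eqType) (r : seq I) (G : I -> E -> R) (x v : E) : uniq r ->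
  (forall i, differentiable (G i) x) ->
  differentiable (fun y => \prod_(i <- r) G i y) x /\
  'd (fun y => \prod_(i <- r) G i y) x v =
  \sum_(k <- r) \prod_(i <- r) (if i == k then 'd (G k) x v else G i x).
Proof.
move=> ur dG; elim: r ur => [_|a r IH /= /andP[ar ur]].
  have -> : (fun y => \prod_(i <- [::]) G i y) = cst (1 : R).
    by apply/funext => y; rewrite big_nil.
  by split => //; rewrite diff_cst big_nil.
have [dr Er] := IH ur.
have -> : (fun y => \prod_(i <- a :: r) G i y) = fun y => G a y * \prod_(i <- r) G i y.
  by apply/funext => y; rewrite big_cons.
split; first exact: differentiableM.
rewrite (diffM_app v (dG a) dr) addrC Er mulr_sumr big_cons; congr (_ + _).
  rewrite mulrC big_cons eqxx; congr (_ * _); apply: eq_big_seq => i ir.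
  by case: eqP ir ar => // -> ->.
apply: eq_big_seq => k kr.
by rewrite big_cons; case: eqP kr ar => // -> ->.
Qed.

Lemma diff_sum (I : Type) (r : seq I) (G : I -> E -> R) (x v : E) :
  (forall i, differentiable (G i) x) ->
  differentiable (fun y => \sum_(i <- r) G i y) x /\
  'd (fun y => \sum_(i <- r) G i y) x v = \sum_(i <- r) 'd (G i) x v.
Proof.
move=> dG; elim: r => [|a r [dr Er]].
  have -> : (fun y => \sum_(i <- [::]) G i y) = cst (0 : R).
    by apply/funext => y; rewrite big_nil.
  by split => //; rewrite diff_cst big_nil.
have -> : (fun y => \sum_(i <- a :: r) G i y) = fun y => G a y + \sum_(i <- r) G i y.
  by apply/funext => y; rewrite big_cons.
by split; [exact: differentiableD|rewrite (diffD_app v (dG a) dr) big_cons Er].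
Qed.

Lemma is_diff_detr (F : 'I_m -> E -> 'rV[R]_m) (x v : E) :
  (forall i j, differentiable (fun y => F i y ord0 j) x) ->
  'd (fun y => detr (F^~ y)) x v =
  \sum_k detr (set_row (F^~ x) k (\row_j 'd (fun y => F k y ord0 j) x v)).
Proof.
move=> dF; have detE w : detr w = \sum_(s : 'S_m) (-1) ^+ s * \prod_i w i ord0 (s i).
  by apply: eq_bigr => s _; congr (_ * _); apply: eq_bigr => i _; rewrite mxE.
under eq_fun do rewrite detE.
have dP (s : 'S_m) := is_diff_prod (G := fun i y => F i y ord0 (s i)) v
  (index_enum_uniq _) (fun i => dF i (s i)).
rewrite (diff_sum _ v (fun s : 'S_m => _)).2; last first.
  by move=> s; apply: differentiableM => //; exact: (dP s).1.
under [RHS]eq_bigr do rewrite detE.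
rewrite [RHS]exchange_big/=; apply: eq_bigr => s _.
rewrite -mulr_sumr; transitivity ((-1) ^+ s * 'd (fun y => \prod_i F i y ord0 (s i)) x v).
  rewrite (diffM_app v (differentiable_cst _ _) (dP s).1).
  by rewrite diff_cst_app mulr0 addr0.
rewrite (dP s).2; congr (_ * _); apply: eq_bigr => k _; apply: eq_bigr => i _.
by rewrite /set_row; case: eqP => [->|//]; rewrite mxE.
Qed.

Lemma Ck1_detr (F : 'I_m -> E -> 'rV[R]_m) :
  (forall i j, Ck 1 (fun y => F i y ord0 j)) -> Ck 1 (fun y => detr (F^~ y)).
Proof.
move=> CF; rewrite [X in Ck 1 X](_ : _ = fun y =>
    \sum_(s : 'S_m) (-1) ^+ s * \prod_i F i y ord0 (s i)).
  by apply: Ck1_sum => s; apply: Ck1M; [exact: Ck1_cst|apply: Ck1_prod].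
apply/funext => y; apply: eq_bigr => s _; congr (_ * _).
by apply: eq_bigr => i _; rewrite mxE.
Qed.

End determinant.

(*@@P3c*)
Section piola.
Context (R : realType) (m : nat).
Implicit Types (g : 'I_m -> 'rV[R]_m -> R) (k : 'I_m) (f p : 'rV[R]_m -> R).
Local Notation dx i := (delta_mx ord0 i : 'rV[R]_m).

Definition jac g (x : 'rV[R]_m) : 'I_m -> 'rV[R]_m := fun i => grad (g i) x.

(** The [k]-th row of cofactors of the Jacobian matrix of [g]. *)
Definition cof g k (x : 'rV[R]_m) : 'rV[R]_m :=
  \row_i detr (set_row (jac g x) k (dx i)).

Lemma gradE f x i : differentiable f x -> grad f x ord0 i = 'd f x (dx i).
Proof. by move=> df; rewrite mxE deriveE. Qed.

Lemma diff_grad f x v : differentiable f x -> 'd f x v = dotv v (grad f x).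
Proof.
by move=> df; rewrite diff_rVE; apply: eq_bigr => i _; rewrite gradE.
Qed.

Lemma Ck1_grad f i : Ck 2 f -> Ck 1 (fun x => grad f x ord0 i).
Proof.
move=> [df Cf]; rewrite (_ : (fun _ => _) = fun x => 'd f x (dx i)); first exact: Cf.
by apply/funext => x; rewrite gradE.
Qed.

Lemma Ck2_Ck1 f : Ck 2 f -> Ck 1 f.
Proof. by move=> [df Cf]; split => // v; apply: Ck1_continuous; exact: Cf. Qed.

Lemma Ck1_cof g k i : (forall j, Ck 2 (g j)) -> Ck 1 (fun x => cof g k x ord0 i).
Proof.
move=> Cg; rewrite (_ : (fun _ => _) =
    fun x => detr ((fun j y => set_row (jac g y) k (dx i) j)^~ x)).
  apply: Ck1_detr => j l; rewrite /set_row; case: (j == k); first exact: Ck1_cst.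
  exact: Ck1_grad.
by apply/funext => x; rewrite mxE.
Qed.

(** Piola's identity: differentiating a cofactor row by row, every term
    contracts the symmetric second differential of some [g j] with two rows of a
    determinant. *)
Lemma div_cof g k x : (forall j, Ck 2 (g j)) ->
  \sum_i 'd (fun y => cof g k y ord0 i) x (dx i) = 0.
Proof.
move=> Cg; pose H j i l := 'd (fun y => 'd (g j) y (dx l)) x (dx i).
have HC j i l : H j i l = H j l i by exact: Ck2_sym.
have E i : 'd (fun y => cof g k y ord0 i) x (dx i) =
    \sum_(j | j != k) \sum_l H j i l *
      detr (set_row (set_row (jac g x) k (dx i)) j (dx l)).
  rewrite (_ : (fun y => _) =
      fun y => detr ((fun j y => set_row (jac g y) k (dx i) j)^~ y)); last first.
    by apply/funext => y; rewrite mxE.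
  rewrite is_diff_detr; last first.
    move=> j l; rewrite /set_row; case: (j == k); first exact: differentiable_cst.
    exact: (Ck1_grad l (Cg j)).1.
  rewrite (bigD1 k)//= [X in X + _](_ : _ = 0) ?add0r; last first.
    rewrite (_ : \row_j _ = 0) ?detr0//; apply/rowP => l; rewrite !mxE /set_row eqxx.
    exact: diff_cst_app.
  apply: eq_bigr => j jk; rewrite -(detr_sum (set_row (jac g x) k (dx i)) j (H j i)).
  set r := \row_l _; rewrite [r]row_sum_delta /r.
  congr (detr (set_row _ j _)).
  apply: eq_bigr => l _; congr (_ *: _).
  rewrite mxE /set_row (negbTE jk) /H; congr ('d _ x _).
  by apply/funext => y; rewrite /jac gradE//; exact: (Cg j).1.
under eq_bigr do rewrite E.
rewrite exchange_big/= big1// => j jk; exact: detr_sym0.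
Qed.

End piola.

(*@@P3d*)
Section mean.
Context (R : realType) (m : nat).
Implicit Types (f g : 'rV[R]_m -> R).

Lemma Yd_norm (x : 'rV[R]_m) : Yd x -> `|x| <= 1.
Proof.
move=> Yx; apply: rV_norm_le => // i; have /andP[x0 x1] := Yx i.
by rewrite ger0_norm// ltW.
Qed.

Lemma measurable_Yd : measurable (@Yd R m).
Proof.
have -> : @Yd R m = [set x | forall i, `[0, 1[%classic (x ord0 i)].
  by apply/seteqP; split => x Hx i; have := Hx i; rewrite /= in_itv.
by have [|] := @lebesgue_rV_box R m (fun=> `[0, 1[%classic).
Qed.

Lemma integrable_Yd f : continuous f ->
  (lebesgue_rV R m).-integrable (@Yd R m) (EFin \o f).
Proof.
move=> cf; apply: measurable_bounded_integrable.
- exact: measurable_Yd.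
- by apply: (@le_lt_trans _ _ 1%E); [rewrite -(lebesgue_rV_Yd R m)|exact: ltry].
- by apply: measurable_funTS; exact: continuous_measurable_rV.
have [C C0 HC] := compact_bound (@compact_rV_ball R m 1) cf.
exists C; split; first exact: num_real.
by move=> y Cy x Yx; apply: le_trans (ltW Cy); apply/HC/Yd_norm.
Qed.

Lemma mean_cst (c : R) : mean (fun _ : 'rV[R]_m => c) = c.
Proof.
rewrite /mean Rintegral_cst; last exact: measurable_Yd.
by rewrite [X in fine X](_ : _ = 1%E) ?mulr1//; exact: lebesgue_rV_Yd.
Qed.

Lemma meanD f g : continuous f -> continuous g ->
  mean (fun x => f x + g x) = mean f + mean g.
Proof.
move=> cf cg; rewrite /mean RintegralD//; try exact: integrable_Yd.
exact: measurable_Yd.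
Qed.

Lemma mean_sum (I : Type) (r : seq I) (F : I -> 'rV[R]_m -> R) :
  (forall i, continuous (F i)) ->
  mean (fun x => \sum_(i <- r) F i x) = \sum_(i <- r) mean (F i).
Proof.
move=> cF; elim: r => [|i r IH].
  rewrite big_nil -[RHS](mean_cst 0); congr mean.
  by apply/funext => x; rewrite big_nil.
rewrite big_cons -IH -meanD//; last exact: continuous_sum.
by congr mean; apply/funext => x; rewrite big_cons.
Qed.

Lemma mean_gt0 f : continuous f -> (forall x, 0 < f x) -> 0 < mean f.
Proof.
move=> cf f0; have [c cK Hc] : exists2 c, c \in [set x : 'rV[R]_m | `|x| <= 1] &
    forall t, t \in [set x : 'rV[R]_m | `|x| <= 1] -> f c <= f t.
  apply: compact_EVT_min; [|exact: compact_rV_ball|exact: (continuous_subspaceT cf)].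
  by exists 0; rewrite /= normr0.
rewrite (lt_le_trans (f0 c))// -[leLHS]mean_cst /mean.
have cc : continuous (fun _ : 'rV[R]_m => f c) by exact: cst_continuous.
have ic := integrable_Yd cc; have If := integrable_Yd cf.
apply: le_Rintegral => //; first exact: measurable_Yd.
by move=> x Yx; apply: Hc; rewrite inE; exact: Yd_norm.
Qed.

End mean.

Section periods.
Context (R : realType) (m : nat).
Implicit Types (f g p : 'rV[R]_m -> R) (u : 'rV[R]_m).
Local Notation dx i := (delta_mx ord0 i : 'rV[R]_m).

Definition periods g : 'rV[R]_m := \row_l (g (dx l) - g 0).

Lemma diff0_cst f : (forall x, differentiable f x) ->
  (forall x i, 'd f x (dx i) = 0) -> forall x y, f x = f y.
Proof.
move=> df f0 x y; have [r _] := MVT_line x (y - x) ler01 df.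
rewrite diff_rVE big1 ?mulr0; last by move=> i _; rewrite f0 mulr0.
by rewrite scale1r [x + _]addrC subrK => /eqP; rewrite subr_eq0 => /eqP.
Qed.

Lemma periodic_delta (T : Type) (f : 'rV[R]_m -> T) :
  (forall x l, f (x + dx l) = f x) -> Yd_periodic f.
Proof.
move=> fl; have fn (k : nat) x l : f (x + k%:R *: dx l) = f x.
  elim: k => [|k IH] in x *; first by rewrite scale0r addr0.
  by rewrite mulrS scalerDl scale1r addrA IH.
have fz (z : int) x l : f (x + z%:~R *: dx l) = f x.
  case: z => k; first exact: fn.
  by rewrite NegzE mulrNz -pmulrn scaleNr -(fn k.+1 (x - _) l) subrK.
have fs (r : seq 'I_m) (k : 'rV[int]_m) x :
    f (x + \sum_(l <- r) (k ord0 l)%:~R *: dx l) = f x.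
  elim: r x => [|l r IH] x; first by rewrite big_nil addr0.
  by rewrite big_cons addrA IH.
move=> x k; rewrite [map_mx _ _]row_sum_delta -[RHS](fs (index_enum _) k).
by congr (f (_ + _)); apply: eq_bigr => l _; rewrite mxE.
Qed.

Lemma periodic_diff p : (forall x, differentiable p x) ->
  (forall x l i, 'd p (x + dx l) (dx i) = 'd p x (dx i)) ->
  (forall l, p (dx l) = p 0) -> Yd_periodic p.
Proof.
move=> dp pl p0; apply: periodic_delta => x l.
have dq y := diff_translate (dp (y + dx l)) (dp y).
have q0 y i : 'd (fun z => p (z + dx l) - p z) y (dx i) = 0.
  by apply: (etrans ((dq y).2 _)); apply/eqP; rewrite subr_eq0; apply/eqP/pl.
apply/eqP; rewrite -subr_eq0 (diff0_cst (fun y => (dq y).1) q0 x 0).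
by rewrite add0r p0 subrr.
Qed.

Lemma diff_dotv u x v : differentiable (fun z => dotv z u) x /\ 'd (fun z => dotv z u) x v = dotv v u.
Proof.
have lu : linear (fun z : 'rV[R]_m => dotv z u).
  move=> c y z; rewrite /dotv scaler_sumr -big_split/=; apply: eq_bigr => i _.
  by rewrite !mxE mulrDl -mulrA.
pose L : {linear 'rV[R]_m -> R} := HB.pack (fun z => dotv z u) (GRing.isLinear.Build _ _ _ _ _ lu).
have cL : continuous L.
  by apply: continuous_sum => i y; exact: (cvgM (@coord_continuous R 1 m ord0 i y) (cvg_cst (u ord0 i))).
rewrite (_ : (fun z => dotv z u) = L)//; split; first exact: linear_differentiable.
by rewrite diff_lin.
Qed.

Lemma Ck2_dotv u : Ck 2 (fun z => dotv z u).
Proof.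
split=> [x|v]; first exact: (diff_dotv u x 0).1.
rewrite (_ : (fun x => _) = fun _ => dotv v u); first exact: Ck1_cst.
by apply/funext => x; exact: (diff_dotv u x v).2.
Qed.

Lemma dotv_delta u i : dotv (dx i) u = u ord0 i.
Proof.
rewrite /dotv (bigD1 i)//= big1 => [|j ji]; rewrite mxE ?eqxx ?mul1r ?addr0//.
by rewrite (negbTE ji) mul0r.
Qed.

Lemma grad_dotv u x : grad (fun z => dotv z u) x = u.
Proof.
apply/rowP => i; rewrite gradE; last exact: (diff_dotv u x 0).1.
by rewrite (diff_dotv u x _).2 dotv_delta.
Qed.

Lemma dotv0 u : dotv 0 u = 0.
Proof. by rewrite /dotv big1// => i _; rewrite mxE mul0r. Qed.

Lemma periods_dotv u : periods (fun z => dotv z u) = u.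
Proof. by apply/rowP => i; rewrite mxE dotv_delta dotv0 subr0. Qed.

(** A function with periodic gradient is the sum of the linear form of its
    periods and of a periodic function. *)
Lemma periodic_part g : Ck 2 g -> Yd_periodic (grad g) ->
  let p x := g x - dotv x (periods g) in
  [/\ Ck 1 p, Yd_periodic p & forall x, grad g x = periods g + grad p x].
Proof.
move=> Cg pg p; pose u := periods g.
have dp x v : differentiable p x /\ 'd p x v = 'd g x v - dotv v u.
  have [dl El] := diff_dotv u x v; split; first exact: (differentiableB (Cg.1 x) dl).
  by rewrite -El; exact: (diffB_app v (Cg.1 x) dl).
have Cp : Ck 1 p.
  split=> [x|v]; first exact: (dp x 0).1.
  rewrite (_ : (fun x => _) = fun x => 'd g x v + (- dotv v u)).
    by apply/Ck1_continuous/Ck1D; [exact: (Cg.2 v)|exact: Ck1_cst].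
  by apply/funext => x; exact: (dp x v).2.
split => //.
  apply: periodic_diff (fun x => (dp x 0).1) _ _ => [x l i|l].
    have Eg : 'd g (x + dx l) (dx i) = 'd g x (dx i).
      have gE y := gradE i (Cg.1 y).
      apply: (etrans (esym (gE _))); apply: (etrans _ (gE _)).
      have -> : x + dx l = x + map_mx intr (delta_mx ord0 l).
        by congr (_ + _); apply/matrixP => j k; rewrite !mxE rmorph_nat.
      by rewrite pg.
    exact: (etrans (dp (x + dx l) (dx i)).2 (etrans
      (congr1 (fun r => r - dotv (dx i) u) Eg) (esym (dp x (dx i)).2))).
  by rewrite /p dotv0 subr0 dotv_delta mxE opprB addrC subrK.
move=> x; apply/rowP => i; rewrite gradE; last exact: Cg.1.
rewrite [RHS]mxE gradE; last exact: (dp x 0).1.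
by rewrite (dp _ _).2 dotv_delta addrC subrK.
Qed.

End periods.

(*@@P3e*)
Section mean_det.
Context (R : realType) (m : nat).
Implicit Types (g h : 'I_m -> 'rV[R]_m -> R) (k : 'I_m) (p : 'rV[R]_m -> R).
Local Notation dx i := (delta_mx ord0 i : 'rV[R]_m).

Definition periodic_C2 g := forall j, Ck 2 (g j) /\ Yd_periodic (grad (g j)).

Lemma cof_periodic g k : periodic_C2 g -> Yd_periodic (cof g k).
Proof.
move=> Pg x z; rewrite /cof (_ : jac g (x + map_mx intr z) = jac g x)//.
by apply/funext => j; rewrite /jac (Pg j).2.
Qed.

Lemma mean_det_periodic g k p : periodic_C2 g -> Ck 1 p -> Yd_periodic p ->
  mean (fun x => detr (set_row (jac g x) k (grad p x))) = 0.
Proof.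
move=> Pg Cp pp; have Cg j := (Pg j).1.
pose q i x := p x * cof g k x ord0 i.
have Cq i : Ck 1 (q i) := Ck1M Cp (Ck1_cof k i Cg).
have -> : (fun x => detr (set_row (jac g x) k (grad p x))) =
    fun x => \sum_i 'd (q i) x (dx i).
  apply/funext => x; rewrite {1}[grad p x]row_sum_delta detr_sum.
  have dq i : 'd (q i) x (dx i) =
      p x * 'd (fun y => cof g k y ord0 i) x (dx i) + cof g k x ord0 i * 'd p x (dx i)
    := diffM_app (dx i) (Cp.1 x) ((Ck1_cof k i Cg).1 x).
  rewrite [RHS](eq_bigr _ (fun i _ => dq i)) big_split/= -mulr_sumr (div_cof k x Cg) mulr0 add0r.
  by apply: eq_bigr => i _; rewrite (gradE i (Cp.1 x)) mulrC; congr (_ * _); rewrite mxE.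
rewrite mean_sum; last by move=> i; exact: (Cq i).2.
apply: big1 => i _; apply: (integral_Yd_partial i (Cq i)) => x z.
by rewrite /q pp (cof_periodic k Pg).
Qed.

(** Jacobian determinants are null Lagrangians: a row [grad (g k)] may be
    replaced by its mean, one row after the other. *)
Lemma mean_det g : periodic_C2 g ->
  mean (fun x => detr (jac g x)) = detr (fun j => periods (g j)).
Proof.
move=> Pg; pose u j := periods (g j).
pose h (K : nat) (j : 'I_m) := if (j < K)%N then (fun x => dotv x (u j)) else g j.
have Ph K : periodic_C2 (h K).
  move=> j; rewrite /h; case: (j < K)%N; last exact: Pg.
  split; first exact: Ck2_dotv.
  by move=> x z; rewrite !grad_dotv.
have cdet K : continuous (fun x => detr (jac (h K) x)).
  apply/Ck1_continuous/(@Ck1_detr _ _ _ (fun j x => jac (h K) x j)) => i j.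
  by apply: Ck1_grad; exact: (Ph K i).1.
have step K : (K < m)%N -> mean (fun x => detr (jac (h K) x)) =
    mean (fun x => detr (jac (h K.+1) x)).
  move=> Km; pose k := Ordinal Km.
  have [Cp pp gp] := periodic_part (Pg k).1 (Pg k).2.
  set p := fun x => _ in Cp pp gp.
  have E x : detr (jac (h K) x) =
      detr (jac (h K.+1) x) + detr (set_row (jac (h K) x) k (grad p x)).
    have -> : jac (h K.+1) x = set_row (jac (h K) x) k (u k).
      apply/funext => j; rewrite /jac /set_row /h ltnS leq_eqVlt -[nat_of_ord j == K]/(j == k).
      by case: (eqVneq j k) => [->|jk]/=; rewrite ?grad_dotv.
    rewrite -[in LHS](set_row_id (jac (h K) x) k).
    have -> : jac (h K) x k = 1 *: u k + 1 *: grad p x.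
      by rewrite !scale1r -gp /jac /h ltnn.
    by rewrite detr_linear !mul1r.
  have -> : (fun x => detr (jac (h K) x)) = fun x =>
      detr (jac (h K.+1) x) + detr (set_row (jac (h K) x) k (grad p x)).
    exact/funext.
  rewrite meanD//; last first.
    rewrite (_ : (fun x => _) = fun x => detr (jac (h K) x) - detr (jac (h K.+1) x)).
      by move=> x; exact: (cvgB (cdet K x) (cdet K.+1 x)).
    by apply/funext => x; rewrite E addrC addKr.
  by rewrite mean_det_periodic// addr0.
have H K : (K <= m)%N -> mean (fun x => detr (jac (h 0%N) x)) =
    mean (fun x => detr (jac (h K) x)).
  elim: K => [_|K IH Km]; first reflexivity.
  exact: (etrans (IH (ltnW Km)) (step K Km)).
have := H m (leqnn m); rewrite [in LHS](_ : h 0%N = g); last exact/funext.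
move=> ->; rewrite -[RHS](@mean_cst R m); congr mean; apply/funext => x.
by congr detr; apply/funext => j; rewrite /jac /h ltn_ord grad_dotv.
Qed.

Lemma mean_cof g k i : periodic_C2 g ->
  mean (fun x => cof g k x ord0 i) = detr (set_row (fun j => periods (g j)) k (dx i)).
Proof.
move=> Pg; pose h j := if j == k then (fun x => dotv x (dx i)) else g j.
have Ph : periodic_C2 h.
  move=> j; rewrite /h; case: (j == k); last exact: Pg.
  split; first exact: Ck2_dotv.
  by move=> x z; rewrite !grad_dotv.
have := mean_det Ph; rewrite (_ : (fun j => periods (h j)) =
    set_row (fun j => periods (g j)) k (dx i)); last first.
  by apply/funext => j; rewrite /h /set_row; case: ifP => _ //; rewrite periods_dotv.
move=> <-; congr mean; apply/funext => x; rewrite mxE; congr detr.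
by apply/funext => j; rewrite /h /set_row /jac; case: ifP => _ //; rewrite grad_dotv.
Qed.

End mean_det.

(*@@P4*)
Lemma frac_part (R : realType) m (x : 'rV[R]_m) :
  exists k : 'rV[int]_m, Yd (x + map_mx intr k).
Proof.
exists (\row_i (- Num.floor (x ord0 i))) => i; rewrite !mxE mulrNz subr_ge0.
have := Num.Theory.floor_itv (x ord0 i).
by rewrite intrD => /andP[-> /=]; rewrite ltrBlDl addrC.
Qed.

Section diffeo.
Context (R : realType) (m : nat) (v : 'I_m -> 'rV[R]_m -> R).
Hypothesis Pv : periodic_C2 v.
Hypothesis det_neq0 : forall x, detr (jac v x) != 0.
Local Notation dx i := (delta_mx ord0 i : 'rV[R]_m).

Definition rmap (x : 'rV[R]_m) : 'rV[R]_m := \row_j v j x.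
Local Notation V := rmap.

Let Cv j : Ck 2 (v j) := (Pv j).1.
Let C1v j : Ck 1 (v j) := Ck2_Ck1 (Cv j).

Lemma continuous_rmap : continuous V.
Proof.
apply: continuous_rV => j; rewrite (_ : (fun _ => _) = v j).
  exact: Ck1_continuous.
by apply/funext => y; rewrite mxE.
Qed.

Definition drmap (x h : 'rV[R]_m) : 'rV[R]_m := \row_j 'd (v j) x h.

(** The [i]-th column of the inverse of the Jacobian matrix. *)
Definition inv_col i (x : 'rV[R]_m) : 'rV[R]_m :=
  \row_k (cof v k x ord0 i / detr (jac v x)).

Lemma cofE k i x : cof v k x ord0 i = cofactor (\matrix_j jac v x j) k i.
Proof.
rewrite mxE /detr (expand_det_row _ k) (bigD1 i)//= big1 ?addr0.
  rewrite !mxE /set_row eqxx !mxE !eqxx mul1r; congr (_ * \det _).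
  apply/matrixP => a b; rewrite !mxE /set_row eq_sym (negbTE (neq_lift _ _)).
  by rewrite ?mxE.
by move=> j ji; rewrite !mxE /set_row eqxx mxE eqxx (negbTE ji) mul0r.
Qed.

Lemma inv_colP i x h : dotv (drmap x h) (inv_col i x) = h ord0 i.
Proof.
have := mul_adj_mx (\matrix_j jac v x j).
move=> /(congr1 (fun A => (A *m h^T) i ord0)); rewrite -mulmxA mul_scalar_mx.
rewrite [LHS]mxE [RHS]mxE [h^T _ _]mxE => E.
apply: (mulfI (det_neq0 x)); rewrite -[RHS]E /dotv mulr_sumr; apply: eq_bigr => k _.
rewrite [drmap _ _ _ _]mxE [inv_col _ _ _ _]mxE [\adj _ _ _]mxE -cofE.
rewrite mulrCA [X in _ * X]mulrCA divff// mulr1 mulrC; congr (_ * _).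
rewrite mxE diff_grad; last exact: (Cv k).1.
by apply: eq_bigr => j _; rewrite !mxE mulrC.
Qed.

Lemma continuous_inv_col i k : continuous (fun x => inv_col i x ord0 k).
Proof.
rewrite (_ : (fun _ => _) = fun x => cof v k x ord0 i * (detr (jac v x))^-1).
  have cd : continuous (fun x => detr (jac v x)).
    apply/Ck1_continuous/(@Ck1_detr _ _ _ (fun j x => jac v x j)) => a b.
    exact: Ck1_grad.
  move=> x; exact: (cvgM (@Ck1_continuous _ _ _ (Ck1_cof k i Cv) x)
    (cvgV (det_neq0 x) (cd x))).
by apply/funext => x; rewrite mxE.
Qed.

Lemma jac_periodic : Yd_periodic (jac v).
Proof. by move=> x z; apply/funext => j; rewrite /jac (Pv j).2. Qed.

Lemma inv_col_bound : exists2 C, 0 < C & forall i x k, `|inv_col i x ord0 k| <= C.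
Proof.
pose F x := \sum_i \sum_k `|inv_col i x ord0 k|.
have cF : continuous F.
  apply: continuous_sum => i; apply: continuous_sum => k x.
  exact: (cvg_norm (@continuous_inv_col i k x)).
have [C C0 HC] := compact_bound (@compact_rV_ball R m 1) cF.
exists C => // i x k; have [z Yz] := frac_part x.
have -> : inv_col i x = inv_col i (x + map_mx intr z).
  by apply/rowP => j; rewrite [LHS]mxE [RHS]mxE jac_periodic (cof_periodic j Pv).
apply: le_trans (HC _ (Yd_norm Yz)); apply: le_trans (ler_norm _).
rewrite /F (bigD1 i)//= (bigD1 k)//= -addrA lerDl addr_ge0// sumr_ge0// => j _.
by apply: sumr_ge0.
Qed.

Lemma dotv_norm (x y : 'rV[R]_m) C : (forall k, `|y ord0 k| <= C) ->
  `|dotv x y| <= m%:R * C * `|x|.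
Proof.
move=> yC; rewrite (le_trans (ler_norm_sum _ _ _))//.
rewrite -mulrA mulr_natl -[X in _ *+ X]card_ord -sumr_const ler_sum// => k _.
by rewrite normrM mulrC ler_pM// coord_le_norm.
Qed.

Lemma rmap_unif_diff eta : 0 < eta -> exists2 r : R, 0 < r &
  forall x h, `|h| < r -> `|V (x + h) - V x - drmap x h| <= eta * `|h|.
Proof.
move=> eta0; have [||r r0 Hr] := @finite_radius R 'I_m (fun j r => forall x h : 'rV[R]_m,
    `|h| < r -> `|v j (x + h) - v j x - 'd (v j) x h| <= eta * `|h|).
- by move=> j k k' kk' H x h hk; apply: H; exact: lt_le_trans hk kk'.
- move=> j; have [r r0 Hr] := Ck1_unif_diff (@row_sum_delta R m)
    (fun i x => coord_le_norm x i) (C1v j) (@compact_rV_ball R m 1) eta0.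
  exists r => // x h hr; have [z Yz] := frac_part x.
  have [Cp pp gp] := periodic_part (Cv j) (Pv j).2.
  have E1 : v j (x + h) - v j x =
      v j (x + map_mx intr z + h) - v j (x + map_mx intr z).
    have pE y : v j y = (v j y - dotv y (periods (v j))) + dotv y (periods (v j)).
      by rewrite subrK.
    have dD a b : dotv (a + b) (periods (v j)) = dotv a (periods (v j)) + dotv b (periods (v j)).
      by rewrite /dotv -big_split/=; apply: eq_bigr => i _; rewrite mxE mulrDl.
    rewrite addrAC (pE (x + h)) (pE x) (pE (x + h + _)) (pE (x + map_mx _ _)).
    rewrite (pp (x + h) z) (pp x z) !dD; ring.
  have E2 : 'd (v j) x h = 'd (v j) (x + map_mx intr z) h.
    apply: (etrans (diff_grad h ((Cv j).1 x))).
    by rewrite -((Pv j).2 x z); apply/esym/(diff_grad h ((Cv j).1 _)).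
  have E := f_equal2 (fun a b => a - b) E1 E2.
  exact: (eq_ind_r (fun t => `|t| <= eta * `|h|) (Hr _ h (Yd_norm Yz) hr) E).
exists r => // x h hr; apply: rV_norm_le; first by rewrite mulr_ge0// ltW.
by move=> j; rewrite !mxE; exact: Hr.
Qed.

Lemma rmap_expand : exists c r : R, [/\ 0 < c, 0 < r &
  forall x h : 'rV[R]_m, `|h| <= r -> c * `|h| <= `|V (x + h) - V x|].
Proof.
have [C C0 HC] := inv_col_bound; pose D : R := m.+1%:R * C.
have D0 : 0 < D by rewrite mulr_gt0.
have dV x h : `|h| <= D * `|drmap x h|.
  apply: rV_norm_le; first by rewrite mulr_ge0// ltW.
  move=> i; rewrite -(inv_colP i x) (le_trans (dotv_norm _ (HC i x)))//.
  by rewrite ler_wpM2r// ler_wpM2r ?ltW// ltr_nat.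
pose c := (2 * D)^-1; have c0 : 0 < c by rewrite invr_gt0 mulr_gt0.
have [r r0 Hr] := rmap_unif_diff c0.
exists c, (r / 2); split => //; first by rewrite divr_gt0.
move=> x h hr; have hr' : `|h| < r by lra.
have H1 := Hr x h hr'; have H2 := dV x h.
have H3 : 2 * c * `|h| <= `|drmap x h|.
  by rewrite /c invfM mulrA divff// mul1r mulrC ler_pdivrMr// mulrC.
have := ler_normB (V (x + h) - V x) (V (x + h) - V x - drmap x h).
rewrite opprB addrC subrK => H4; lra.
Qed.

End diffeo.

(*@@P4b*)
Section bijection.
Context (R : realType) (m : nat) (v : 'I_m -> 'rV[R]_m -> R).
Hypothesis Pv : periodic_C2 v.
Hypothesis det_neq0 : forall x, detr (jac v x) != 0.
Local Notation V := (rmap v).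

(** A critical point of the squared distance to [y] is a preimage of [y]. *)
Lemma rmap_critical (y x : 'rV[R]_m) (r : R) : 0 < r ->
  (forall h : 'rV[R]_m, `|h| < r -> \sum_j (v j x - y ord0 j) ^+ 2 <=
     \sum_j (v j (x + h) - y ord0 j) ^+ 2) -> V x = y.
Proof.
move=> r0 xmin; pose a j := v j x - y ord0 j.
have crit i : \sum_j a j * grad (v j) x ord0 i = 0.
  pose e : 'rV[R]_m := delta_mx ord0 i.
  pose F (s : R) := \sum_j (v j (x + s *: e) - y ord0 j) ^+ 2.
  have dF (s : R) : is_derive s 1 F
      (\sum_j 2 * (v j (x + s *: e) - y ord0 j) * 'd (v j) (x + s *: e) e).
    have -> : F = \sum_(j < m) ((fun s : R => v j (x + s *: e)) - cst (y ord0 j)) ^+ 2.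
      by apply/funext => t; rewrite fct_sumE.
    apply: is_derive_sum => j.
    have dj := @is_derive_line R _ (v j) x e s ((Pv j).1.1 _).
    have dB := is_deriveB dj (is_derive_cst (y ord0 j) s 1).
    apply: is_derive_eq (is_deriveX 2 dB) _.
    by rewrite subr0 expr1.
  have F0 : is_derive (0 : R) 1 F 0.
    apply: (@derive1_at_min R F (- r) r 0); first lra.
    - by move=> s _; case: (dF s).
    - by rewrite in_itv/=; lra.
    move=> s; rewrite in_itv/= -ltr_norml => sr; rewrite /F scale0r addr0.
    by apply: xmin; rewrite normrZ (le_lt_trans _ sr)// ler_piMr// norm_delta.
  have := dF 0 => dF0; have := @derive_val _ _ _ _ _ _ _ dF0.
  rewrite (@derive_val _ _ _ _ _ _ _ F0) scale0r addr0 => E.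
  apply: (@mulfI _ 2) => //; rewrite mulr0 [RHS]E mulr_sumr; apply: eq_bigr => j _.
  by rewrite mulrA gradE//; exact: (Pv j).1.1.
apply/rowP => k; rewrite mxE; apply/eqP; rewrite -subr_eq0; apply/eqP.
apply: (mulIf (det_neq0 x)); rewrite mul0r.
have : detr (set_row (jac v x) k (\sum_j a j *: jac v x j)) = 0.
  rewrite (_ : \sum_j _ = 0) ?detr0//; apply/rowP => i; rewrite summxE mxE -[RHS](crit i).
  by apply: eq_bigr => j _; rewrite mxE.
rewrite detr_sum (bigD1 k)//= set_row_id [X in _ + X]big1 ?addr0//.
move=> j jk; rewrite (detr_alternate jk) ?mulr0//.
by rewrite /set_row eqxx (negbTE jk).
Qed.

Lemma rmap_local_surj : exists c r rho : R, [/\ 0 < c, 0 < r, 0 < rho,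
  (forall x h : 'rV[R]_m, `|h| <= r -> c * `|h| <= `|V (x + h) - V x|) &
  (forall x w : 'rV[R]_m, `|w| <= rho ->
    exists2 h : 'rV[R]_m, `|h| <= r / 4 & V (x + h) = V x + w)].
Proof.
have [c [r [c0 r0 Hr]]] := rmap_expand Pv det_neq0.
pose rho := c * r / m.+4%:R; have rho0 : 0 < rho by rewrite divr_gt0// mulr_gt0.
exists c, r, rho; split => // x w wrho.
pose F (h : 'rV[R]_m) := \sum_j (v j (x + h) - (V x + w) ord0 j) ^+ 2.
have cF : continuous F.
  apply: continuous_sum => j.
  have cj : continuous (fun h => v j (x + h) - (V x + w) ord0 j).
    apply: continuous_sub; last exact: cst_continuous.
    apply: (continuous_comp_app (@continuous_addl _ _ x)).
    exact: (Ck1_continuous (Ck2_Ck1 (Pv j).1)).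
  exact: (continuous_mul cj cj).
have [h hK hmin] : exists2 h, h \in [set h : 'rV[R]_m | `|h| <= r] &
    forall t, t \in [set h : 'rV[R]_m | `|h| <= r] -> F h <= F t.
  apply: compact_EVT_min; [|exact: compact_rV_ball|exact: (continuous_subspaceT cF)].
  by exists 0; rewrite /= normr0 ltW.
rewrite inE/= in hK.
have hr : `|h| < r.
  rewrite lt_neqAle hK andbT; apply/eqP => hr.
  have F0 : F 0 <= (m.+1%:R * rho) ^+ 2.
    apply: (@le_trans _ _ (\sum_(j < m) rho ^+ 2)).
      apply: ler_sum => j _; rewrite addr0 !mxE opprD addNKr sqrrN.
      have wj := le_trans (coord_le_norm w j) wrho.
      by rewrite -real_normK ?num_real// lerXn2r// nnegrE// ltW.
    rewrite sumr_const card_ord -[leLHS]mulr_natl [leRHS]exprMn.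
    apply: ler_wpM2r; first exact: sqr_ge0.
    rewrite (@le_trans _ _ (m.+1%:R))// ?ler_nat// expr2 ler_peMl// ler1n //.
  have Fh : F h <= (m.+1%:R * rho) ^+ 2.
    by apply: le_trans F0; apply: hmin; rewrite inE/= normr0 ltW.
  have mrho : 0 <= m.+1%:R * rho by rewrite mulr_ge0// ltW.
  have Vle : `|V (x + h) - V x| <= m.+2%:R * rho.
    apply: rV_norm_le => [|j]; first by rewrite mulr_ge0// ltW.
    have H : `|v j (x + h) - (V x + w) ord0 j| <= m.+1%:R * rho.
      rewrite -(ger0_norm mrho) -ler_sqr ?nnegrE// !real_normK ?num_real//.
      by apply: le_trans Fh; rewrite /F (bigD1 j)//= lerDl sumr_ge0// => k _; exact: sqr_ge0.
    have -> : (V (x + h) - V x) ord0 j = v j (x + h) - (V x + w) ord0 j + w ord0 j.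
      by rewrite !mxE; ring.
    rewrite (le_trans (ler_normD _ _))// [m.+2%:R]mulrS mulrDl mul1r addrC lerD//.
    exact: le_trans (coord_le_norm _ _) wrho.
  have := le_trans (Hr x h hK) Vle; rewrite hr leNgt => /negP; apply.
  have -> : c * r = m.+4%:R * rho by rewrite /rho mulrCA divff ?mulr1.
  by rewrite ltr_pM2r// ltr_nat.
have Vh : V (x + h) = V x + w.
  apply: (@rmap_critical _ _ (r - `|h|)); first by rewrite subr_gt0.
  move=> k kr; rewrite -addrA; apply: hmin; rewrite inE/=.
  by rewrite (le_trans (ler_normD _ _))//; lra.
exists h => //.
have := Hr x h hK; rewrite Vh addrC addKr => H.
have m4 : 4%:R <= m.+4%:R :> R by rewrite ler_nat.
rewrite ler_pdivlMr// -(ler_pM2l c0) mulrA.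
have -> : c * r = rho * m.+4%:R by rewrite /rho mulfVK.
apply: ler_pM => //; [by rewrite mulr_ge0// ltW|exact: le_trans H wrho].
Qed.

End bijection.

(*@@P4c*)
Section lifting.
Context (R : realType) (m : nat) (v : 'I_m -> 'rV[R]_m -> R).
Hypothesis Pv : periodic_C2 v.
Hypothesis det_neq0 : forall x, detr (jac v x) != 0.
Local Notation V := (rmap v).

(** [step x w] lifts the segment from [V x] to [V x + w]. *)
Lemma rmap_step : exists c r rho : R, exists step : 'rV[R]_m -> 'rV[R]_m -> 'rV[R]_m,
  [/\ 0 < c, 0 < r, 0 < rho,
  forall x y : 'rV[R]_m, `|y - x| <= r -> c * `|y - x| <= `|V y - V x| &
  forall x w : 'rV[R]_m, `|w| <= rho ->
    `|step x w - x| <= r / 4 /\ V (step x w) = V x + w].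
Proof.
have [c [r [rho [c0 r0 rho0 Hr Hs]]]] := rmap_local_surj Pv det_neq0.
have /choice[st stP] : forall xw : 'rV[R]_m * 'rV[R]_m, exists y : 'rV[R]_m,
    `|xw.2| <= rho -> `|y - xw.1| <= r / 4 /\ V y = V xw.1 + xw.2.
  move=> [x w] /=; have [/(Hs x)[h hr Vh]|] := boolP (`|w| <= rho); last by exists 0.
  by exists (x + h); rewrite addrC addKr.
exists c, r, rho, (fun x w => st (x, w)); split => //.
  by move=> x y xy; have := Hr x (y - x) xy; rewrite [x + _]addrC subrK.
by move=> x w wrho; exact: (stP (x, w) wrho).
Qed.

Lemma rmap_bij : exists2 W : 'rV[R]_m -> 'rV[R]_m, cancel V W & cancel W V.
Proof.
have [c [r [rho [step [c0 r0 rho0 Hr Hs]]]]] := rmap_step.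
have loc x y : `|y - x| <= r -> V y = V x -> y = x.
  move=> xy Vxy; have := Hr x y xy; rewrite Vxy subrr normr0 => H.
  apply/eqP; rewrite -subr_eq0 -normr_le0.
  by rewrite -(ler_pM2l c0) mulr0.
pose lift_ (y x : 'rV[R]_m) (N k : nat) := iter k (step ^~ (N.+1%:R^-1 *: (y - V x))) x.
have liftP y x N k : `|y - V x| <= N.+1%:R * rho ->
    V (lift_ y x N k) = V x + (k%:R / N.+1%:R) *: (y - V x).
  move=> yN; elim: k => [|k IH]; first by rewrite mul0r scale0r addr0.
  rewrite /lift_ iterS -/(lift_ y x N k) (Hs _ _ _).2.
    rewrite IH -addrA -scalerDl -[X in (_ + X) *: _]mul1r -mulrDl.
    by rewrite natr1.
  by rewrite normrZ ger0_norm ?invr_ge0// mulrC ler_pdivrMr// mulrC.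
have lift_end y x N : `|y - V x| <= N.+1%:R * rho -> V (lift_ y x N N.+1) = y.
  by move=> /liftP ->; rewrite divff// scale1r addrC subrK.
have bndN (B : R) : 0 <= B -> exists N : nat, B <= N.+1%:R * rho.
  move=> B0; exists (Num.bound (B / rho)).
  rewrite -ler_pdivrMr// (le_trans (ltW (archi_boundP _)))//; last by rewrite ler_nat.
  by rewrite divr_ge0// ltW.
have surjV y : exists x, V x = y.
  have [N yN] := bndN _ (normr_ge0 (y - V 0)).
  by exists (lift_ y 0 N N.+1); exact: lift_end.
have injV : injective V.
  move=> x0 x1 Vx; pose y := V x0; pose l (s : R) := x0 + s *: (x1 - x0).
  have cl : continuous l.
    apply: (continuous_comp_app (f := fun s : R => s *: (x1 - x0)) (g := fun z => x0 + z)).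
      by apply: continuous_scale; [exact: continuous_id|exact: cst_continuous].
    exact: continuous_addl.
  have cVl : continuous (fun s => V (l s)).
    by apply: (continuous_comp_app cl); exact: continuous_rmap.
  have cw : continuous (fun s => y - V (l s)).
    by apply: continuous_sub => //; exact: cst_continuous.
  have [B B0 HB] := compact_bound (@segment_compact R (-1) 2) (continuous_norm cw).
  have [N HN] := bndN _ (ltW B0).
  have sN s : -1 < s < 2 -> `|y - V (l s)| <= N.+1%:R * rho.
    case/andP=> /ltW s1 /ltW s2; rewrite -normr_id (le_trans _ HN)//.
    by apply: HB; rewrite /= in_itv/= s1.
  pose E k s := lift_ y (l s) N k.
  pose q k s := V (l s) + (k%:R / N.+1%:R) *: (y - V (l s)).
  have VE k s : -1 < s < 2 -> V (E k s) = q k s by move=> /sN; exact: liftP.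
  have Estep k s : -1 < s < 2 -> `|E k.+1 s - E k s| <= r / 4.
    move=> /sN s12; apply: (Hs _ _ _).1.
    by rewrite normrZ ger0_norm ?invr_ge0// mulrC ler_pdivrMr// mulrC.
  have cq k : continuous (q k).
    by apply: (continuous_add cVl (continuous_scale _ cw)); exact: cst_continuous.
  have cE k s : -1 < s < 2 -> {for s, continuous (E k)}.
    elim: k s => [|k IH] s s12; first exact: cl.
    apply/cvgrPdist_le => e e0.
    have r2 : 0 < r / 2 by rewrite divr_gt0.
    have ce : 0 < c * e by rewrite mulr_gt0.
    have near12 : \forall t \near s, -1 < t < 2.
      case/andP: s12 => s1 s2; near=> t; apply/andP; split; near: t.
        exact: lt_nbhsr.
      exact: lt_nbhsl.
    near=> t.
    have t12 : -1 < t < 2 by near: t.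
    have Ek : `|E k s - E k t| <= r / 2.
      near: t; exact: (cvgrPdist_le _ _).1 (IH s s12) _ r2.
    have qk : `|q k.+1 s - q k.+1 t| <= c * e.
      near: t; exact: (cvgrPdist_le _ _).1 (cq k.+1 s) _ ce.
    have H : `|E k.+1 s - E k.+1 t| <= r.
      have := Estep k s s12; have := Estep k t t12.
      have -> : E k.+1 s - E k.+1 t =
        (E k.+1 s - E k s) + (E k s - E k t) - (E k.+1 t - E k t).
        by rewrite subrKA opprB subrKA.
      move=> H1 H2; rewrite (le_trans (ler_normB _ _))//.
      have H3 := ler_normD (E k.+1 s - E k s) (E k s - E k t).
      by clear -H1 H2 H3 Ek; lra.
    rewrite -(ler_pM2l c0) (le_trans _ qk)// -!VE//.
    exact: Hr H.
  have i01 (s : R) : 0 <= s <= 1 -> -1 < s < 2 by move=> /andP[? ?]; apply/andP; split; lra.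
  pose phi s := `|E N.+1 s - x0|.
  have phi0 s : 0 <= s <= 1 -> phi s <= r -> phi s = 0.
    move=> /i01 /sN s12 sr; apply/eqP; rewrite normr_eq0 subr_eq0; apply/eqP.
    by apply: (loc x0) => //; exact: lift_end.
  have E0 k : E k 0 = x0.
    elim: k => [|k IH]; first by rewrite /E /lift_/= /l scale0r addr0.
    have st0 : step x0 0 = x0.
      have [|H1 H2] := Hs x0 0; first by rewrite normr0 ltW.
      by apply: loc; [lra|rewrite H2 addr0].
    have -> : E k.+1 0 = step (E k 0) (N.+1%:R^-1 *: (y - V (l 0))) by [].
    by rewrite IH /l scale0r addr0 subrr scaler0.
  have E1 k : E k 1 = x1.
    have l1 : l 1 = x1 by rewrite /l scale1r addrC subrK.
    elim: k => [//|k IH].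
    have st0 : step x1 0 = x1.
      have [|H1 H2] := Hs x1 0; first by rewrite normr0 ltW.
      by apply: loc; [lra|rewrite H2 addr0].
    have -> : E k.+1 1 = step (E k 1) (N.+1%:R^-1 *: (y - V (l 1))) by [].
    by rewrite IH l1 /y Vx subrr scaler0.
  apply/esym/eqP; rewrite -subr_eq0 -normr_eq0 -(E1 N.+1) -/(phi 1).
  apply/eqP; apply: (phi0 1); first lra.
  rewrite leNgt; apply/negP => phi1.
  have cphi : {within `[0, 1], continuous phi}.
    apply: continuous_in_subspaceT => s; rewrite inE/= in_itv/= => /i01 s12.
    apply: cvg_norm; apply: cvgB; [exact: cE|exact: cvg_cst].
  have phi00 : phi 0 = 0 by rewrite /phi E0 subrr normr0.
  have [||s] := @IVT R phi 0 1 (r / 2) _ cphi; first exact: ler01.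
    by rewrite phi00 ge_min le_max; lra.
  rewrite in_itv/= => s01 ps; have := phi0 s s01; rewrite ps => H; have : r / 2 = 0 by apply: H; lra.
  by lra.
have [W WP] := choice surjV.
by exists W => // x; apply: injV; exact: WP.
Unshelve. all: by end_near. Qed.

End lifting.

(*@@P4d*)
Section inverse.
Context (R : realType) (m : nat) (v : 'I_m -> 'rV[R]_m -> R).
Hypothesis Pv : periodic_C2 v.
Hypothesis det_neq0 : forall x, detr (jac v x) != 0.
Local Notation V := (rmap v).

Lemma dotvB (x y u : 'rV[R]_m) : dotv (x - y) u = dotv x u - dotv y u.
Proof. by rewrite /dotv -sumrB; apply: eq_bigr => i _; rewrite !mxE mulrBl. Qed.

Variable W : 'rV[R]_m -> 'rV[R]_m.
Hypotheses (VK : cancel V W) (WK : cancel W V).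

Lemma inv_lipschitz : exists c rho : R, [/\ 0 < c, 0 < rho &
  forall y h : 'rV[R]_m, `|h| <= rho -> c * `|W (y + h) - W y| <= `|h|].
Proof.
have [c [r [rho [step [c0 r0 rho0 Hr Hs]]]]] := rmap_step Pv det_neq0.
exists c, rho; split => // y h hrho; have [H1 H2] := Hs (W y) h hrho.
have E : W (y + h) = step (W y) h by rewrite -[in LHS](WK y) -H2 VK.
rewrite E -[leRHS](_ : `|V (step (W y) h) - V (W y)| = _).
  by apply: Hr; lra.
by rewrite H2 WK [y + h]addrC addrK.
Qed.

Lemma continuous_inv : continuous W.
Proof.
have [c [rho [c0 rho0 H]]] := inv_lipschitz.
apply: continuous_epsilon => y e e0.
exists (Num.min rho (c * e)); first by rewrite lt_min rho0 mulr_gt0.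
move=> z; rewrite lt_min => /andP[/ltW z1 /ltW z2].
rewrite -(ler_pM2l c0) (le_trans _ z2)//.
by have := H y (z - y) z1; rewrite [y + _]addrC subrK.
Qed.

Lemma is_diff_inv i y :
  differentiable (fun y => W y ord0 i) y /\
  forall u, 'd (fun y => W y ord0 i) y u = dotv u (inv_col v i (W y)).
Proof.
pose x := W y; pose a := inv_col v i x.
have [c [rho [c0 rho0 Hlip]]] := inv_lipschitz.
have [C C0 HC] := inv_col_bound Pv det_neq0.
have [L cL LE] : exists2 L : {linear 'rV[R]_m -> R}, continuous L &
    forall u, L u = dotv u a.
  exists ('d (fun z => dotv z a) (0 : 'rV[R]_m)).
    exact: (diff_continuous (diff_dotv a 0 0).1).
  exact: (fun u => (diff_dotv a 0 u).2).
have [d1 E1] : is_diff y (fun y => W y ord0 i) L.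
  apply: is_diff_bound => [//|eta eta0].
  have D0 : 0 < m.+1%:R * C by rewrite mulr_gt0.
  pose eta' := eta * c / (m.+1%:R * C); have eta'0 : 0 < eta' by rewrite !mulr_gt0// invr_gt0.
  have [r r0 Hr] := rmap_unif_diff Pv eta'0.
  exists (Num.min rho (c * r)) => [|h]; first by rewrite lt_min rho0 mulr_gt0.
  rewrite lt_min => /andP[h1 h2]; have hk := Hlip y h (ltW h1).
  set k := W (y + h) - W y in hk.
  have kr : `|k| < r by rewrite -(ltr_pM2l c0) (le_lt_trans hk).
  have Vk : V (x + k) - V x = h by rewrite /k [x + _]addrC subrK !WK [_ + h]addrC addrK.
  have := Hr x k kr; rewrite Vk => HR.
  have -> : W (y + h) ord0 i - W y ord0 i - L h = - dotv (h - drmap v x k) a.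
    rewrite LE dotvB (inv_colP Pv det_neq0) opprB; congr (_ - _).
    by rewrite /k !mxE.
  rewrite normrN (le_trans (dotv_norm _ (HC i x)))//.
  apply: (@le_trans _ _ (m.+1%:R * C * (eta' * `|k|))).
    by apply: ler_pM => //; [rewrite mulr_ge0// ltW|rewrite ler_wpM2r ?ler_nat// ltW].
  rewrite mulrA (_ : _ * eta' = eta * c); last by rewrite /eta' mulrC divfK// gt_eqF.
  by rewrite -mulrA ler_wpM2l// ltW.
by split => // u; exact: (etrans (congr1 (fun f => f u) E1) (LE u)).
Qed.

Lemma Ck1_inv i : Ck 1 (fun y => W y ord0 i).
Proof.
split=> [y|u]; first exact: (is_diff_inv i y).1.
rewrite (_ : (fun y => _) = fun y => dotv u (inv_col v i (W y))).
  apply: continuous_sum => k; apply: continuous_mul; first exact: cst_continuous.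
  apply: (continuous_comp_app (f := W) (g := fun x => inv_col v i x ord0 k)).
    exact: continuous_inv.
  exact: continuous_inv_col.
by apply/funext => y; exact: (is_diff_inv i y).2.
Qed.

End inverse.

(*@@P5a*)
Section kernel.
Context (R : realType).
Local Notation mu := (@lebesgue_measure R).

Lemma is_derive_quadratic (f : R -> R) (a l M : R) :
  (forall h, `|f (a + h) - f a - l * h| <= M * h ^+ 2) -> is_derive a 1 f l.
Proof.
move=> H; have M0 : 0 <= M.
  by have := le_trans (normr_ge0 _) (H 1); rewrite expr1n mulr1.
have [d E] : is_diff a f ( *:%R l).
  apply: is_diff_bound => [|eta eta0]; first exact: scaler_continuous.
  exists (eta / (M + 1)); first by rewrite divr_gt0// ltr_wpDl.
  move=> h; rewrite ltr_pdivlMr ?ltr_wpDl// => hr; rewrite (le_trans (H h))//.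
  rewrite -real_normK ?num_real// expr2 mulrA ler_wpM2r//.
  have := normr_ge0 h; lra.
apply: DeriveDef; first exact: diff_derivable.
by rewrite deriveE// E /= /GRing.scale/= mulr1.
Qed.

(** The flat functions [x ^- k * exp (- 1 / x)], extended by zero. *)
Definition flat k (x : R) : R := if 0 < x then x^-1 ^+ k * expR (- x^-1) else 0.

Lemma flat_le k x : `|flat k x| <= k.+2`!%:R * x ^+ 2.
Proof.
rewrite /flat; case: ifPn => [x0|_]; last by rewrite normr0 mulr_ge0// sqr_ge0.
have y0 : 0 <= x^-1 by rewrite invr_ge0 ltW.
rewrite ger0_norm; last by rewrite mulr_ge0// ?exprn_ge0// expR_ge0.
rewrite expRN ler_pdivrMr ?expR_gt0//.
have := expR_ge1Dxn k.+1 y0 => H.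
have {}H : x^-1 ^+ k.+2 / k.+2`!%:R <= expR x^-1 by rewrite (le_trans _ H)// lerDr.
apply: (@le_trans _ _ (k.+2`!%:R * x ^+ 2 * (x^-1 ^+ k.+2 / k.+2`!%:R))).
  have e : x ^+ 2 * x^-1 ^+ k.+2 = x^-1 ^+ k.
    by rewrite -[k.+2]addn2 exprD mulrCA -exprMn divff ?gt_eqF// expr1n mulr1.
  by rewrite mulrA -(mulrA _ (x ^+ 2)) e mulrAC divff ?mul1r// pnatr_eq0 -lt0n fact_gt0.
by rewrite ler_wpM2l// mulr_ge0// sqr_ge0.
Qed.

Lemma is_derive_flat k (x : R) :
  is_derive x 1 (flat k) (flat k.+2 x - k%:R * flat k.+1 x).
Proof.
have flat0 j : flat j 0 = 0 by rewrite /flat ltxx.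
have [x0|x0|->] := ltrgtP x 0.
- have -> : flat k.+2 x - k%:R * flat k.+1 x = 0.
    by rewrite /flat ltNge (ltW x0)/= mulr0 subrr.
  apply: (@near_eq_is_derive _ _ _ (cst 0) (flat k) x 1 0 _ (is_derive_cst (0 : R) x 1)).
  near=> y; rewrite /flat ifF//; apply/negbTE; rewrite -leNgt ltW//.
  by near: y; exact: lt_nbhsl.
- have dV : is_derive x 1 (fun y : R => y^-1) (- x ^- 2 *: 1).
    by apply: (@is_deriveV _ id); rewrite ?gt_eqF.
  have dE : is_derive x 1 (fun y : R => expR (- y^-1)) (expR (- x^-1) * - (- x ^- 2 *: 1)).
    exact: (is_derive1_comp (is_derive_expR _) (is_deriveN dV)).
  have dP := is_deriveM (is_deriveX k dV) dE.
  apply: (near_eq_is_derive (f := (fun y : R => y^-1) ^+ k * (fun y : R => expR (- y^-1)))).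
  + near=> y; rewrite /flat ifT ?mulrfctE ?exprfctE//.
    by near: y; exact: lt_nbhsr.
  apply: is_derive_eq dP _.
  rewrite /flat x0 /= exprfctE; set E := expR _; set z := x^-1.
  have -> : x ^- 2 = z ^+ 2 by rewrite exprVn.
  rewrite /GRing.scale/= mulr1; case: k => [|k] /=; first by rewrite !expr0 !mul0r; ring.
  rewrite !exprS; ring.
- rewrite !flat0 mulr0 subrr; apply: (@is_derive_quadratic _ _ _ k.+2`!%:R) => h.
  by rewrite add0r flat0 mul0r !subr0 flat_le.
Unshelve. all: by end_near. Qed.

End kernel.

(*@@P5b*)
Section segment_integral.
Context (R : realType).
Local Notation mu := (@lebesgue_measure R).

Implicit Types f g : R -> R.

Definition segint (g : R -> R) : R := \int[mu]_(s in `[-1, 1]) g s.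

Lemma segint_integrable g : continuous g -> mu.-integrable `[(-1)%R, 1%R] (EFin \o g).
Proof.
move=> cg; apply: continuous_compact_integrable; first exact: segment_compact.
exact: continuous_subspaceT.
Qed.

Lemma segintD f g : continuous f -> continuous g ->
  segint (fun s => f s + g s) = segint f + segint g.
Proof. by move=> cf cg; rewrite /segint RintegralD//; exact: segint_integrable. Qed.

Lemma segintZ (a : R) g : continuous g -> segint (fun s => a * g s) = a * segint g.
Proof. by move=> cg; rewrite /segint RintegralZl//; exact: segint_integrable. Qed.

Lemma segintB f g : continuous f -> continuous g ->
  segint (fun s => f s - g s) = segint f - segint g.
Proof. by move=> cf cg; rewrite /segint RintegralB//; exact: segint_integrable. Qed.

Lemma segint_le f g : continuous f -> continuous g ->
  (forall s, -1 <= s <= 1 -> f s <= g s) -> segint f <= segint g.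
Proof.
move=> cf cg fg; have ic := segint_integrable cf; have ig := segint_integrable cg.
apply: le_Rintegral => //.
Qed.

Lemma segint_norm_le f g : continuous f -> continuous g ->
  (forall s, -1 <= s <= 1 -> `|f s| <= g s) -> `|segint f| <= segint g.
Proof.
move=> cf cg fg; have cNg : continuous (fun s => -1 * g s).
  by apply: continuous_mul => //; exact: cst_continuous.
rewrite ler_norml -mulN1r -segintZ//; apply/andP; split; apply: segint_le => // s s1.
  by have := fg s s1; rewrite ler_norml mulN1r => /andP[].
by have := fg s s1; rewrite ler_norml => /andP[].
Qed.

Lemma segint_FTC (F f : R -> R) : (forall s : R, is_derive s 1 F (f s)) ->
  continuous f -> segint f = F 1 - F (-1).
Proof.
move=> dF cf; rewrite /segint /Rintegral -integral_itv_bndo_bndc; last first.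
  apply: measurable_funTS; apply/measurable_EFinP; exact: continuous_measurable_fun.
by rewrite (FTC_itvco _ dF cf)//; lra.
Qed.

Lemma segint_cst (c : R) : segint (fun=> c) = 2 * c.
Proof.
have dF (s : R) : is_derive s 1 (fun s : R => c * s) c.
  apply: is_derive_eq (is_deriveZ c (is_derive_id s 1)) _.
  by rewrite /GRing.scale/= mulr1.
by rewrite (segint_FTC dF); [ring|exact: cst_continuous].
Qed.

Lemma segint_gt0 g : continuous g -> (forall s, 0 <= g s) -> 0 < g 0 -> 0 < segint g.
Proof.
move=> cg g0 g00; have g2 : 0 < g 0 / 2 by rewrite divr_gt0.
have /cvgrPdist_lt/(_ _ g2)/nbhs_ballP[d /= d0 Hd] := cg 0.
pose e := Num.min 1 (d / 2); have e0 : 0 < e by rewrite lt_min ltr01 divr_gt0.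
have ed : e < d by rewrite gt_min; apply/orP; right; lra.
have e1 : e <= 1 by rewrite ge_min lexx.
rewrite /segint /Rintegral; apply: fine_gt0; rewrite integrable_lty ?andbT//; last first.
  exact: segint_integrable.
have mg D : measurable D -> measurable_fun D (EFin \o g).
  move=> _; apply: measurable_funTS; apply/measurable_EFinP.
  exact: continuous_measurable_fun.
apply: (@lt_le_trans _ _ (\int[mu]_(s in `[(- e)%R, e]) (g 0 / 2)%:E)%E).
  rewrite integral_cst// [X in (_ * X)%E]lebesgue_measure_itv/= lte_fin.
  by rewrite ifT; [rewrite -EFinB -EFinM lte_fin mulr_gt0//|]; lra.
apply: (@le_trans _ _ (\int[mu]_(s in `[(- e)%R, e]) (g s)%:E)%E).
  apply: ge0_le_integral => //.
  - by move=> s _; rewrite lee_fin ltW.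
  - exact: mg.
  move=> s; rewrite /= in_itv/= -ler_norml => se; rewrite lee_fin.
  have : `|g 0 - g s| < g 0 / 2.
    by apply: Hd; rewrite -ball_normE/= sub0r normrN (le_lt_trans se).
  by rewrite ltr_norml; lra.
apply: ge0_subset_integral => //; [exact: mg|by move=> s _; rewrite lee_fin|].
by move=> s; rewrite /= !in_itv/=; lra.
Qed.

End segment_integral.

Section mollifier.
Context (R : realType).

Definition bump_eval (l : seq (R * (nat * nat))) (x : R) : R :=
  \sum_(t <- l) t.1 * (flat t.2.1 (1 + x) * flat t.2.2 (1 - x)).

Definition bump_d (l : seq (R * (nat * nat))) : seq (R * (nat * nat)) :=
  flatten [seq [:: (t.1, (t.2.1.+2, t.2.2)); (- t.1 * t.2.1%:R, (t.2.1.+1, t.2.2));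
    (- t.1, (t.2.1, t.2.2.+2)); (t.1 * t.2.2%:R, (t.2.1, t.2.2.+1))] | t <- l].

Lemma is_derive_bump_eval l (x : R) : is_derive x 1 (bump_eval l) (bump_eval (bump_d l) x).
Proof.
elim: l => [|[c [i j]] l IH].
  rewrite [X in is_derive _ _ X](_ : _ = cst 0); last first.
    by apply/funext => y; rewrite /bump_eval big_nil.
  by apply: is_derive_eq (is_derive_cst (0 : R) x 1) _; rewrite /bump_eval big_nil.
have di : is_derive x 1 (fun y : R => flat i (1 + y))
    (flat i.+2 (1 + x) - i%:R * flat i.+1 (1 + x)).
  have dp : is_derive x 1 (fun y : R => 1 + y) 1.
    by apply: is_derive_eq (is_deriveD (is_derive_cst (1 : R) x 1) (is_derive_id x 1)) _; rewrite add0r.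
  apply: is_derive_eq (is_derive1_comp (is_derive_flat i (1 + x)) dp) _.
  by rewrite mulr1.
have dj : is_derive x 1 (fun y : R => flat j (1 - y))
    (- (flat j.+2 (1 - x) - j%:R * flat j.+1 (1 - x))).
  have dp : is_derive x 1 (fun y : R => 1 - y) (-1).
    by apply: is_derive_eq (is_deriveB (is_derive_cst (1 : R) x 1) (is_derive_id x 1)) _; rewrite sub0r.
  apply: is_derive_eq (@is_derive1_comp _ (flat j) (fun y : R => 1 - y) x _ _ (is_derive_flat j (1 - x)) dp) _.
  by rewrite mulrN1.
have dt := is_deriveD (is_deriveZ c (is_deriveM di dj)) IH.
rewrite (_ : bump_eval ((c, (i, j)) :: l) = c \*: ((fun y : R => flat i (1 + y)) *
  (fun y : R => flat j (1 - y))) + bump_eval l); last first.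
  by apply/funext => y; rewrite /bump_eval big_cons.
apply: is_derive_eq dt _; rewrite /bump_eval /bump_d /= !big_cons/= /GRing.scale/=.
by ring.
Qed.

Lemma flat_le0 k (x : R) : x <= 0 -> flat k x = 0.
Proof. by move=> x0; rewrite /flat ltNge x0. Qed.

Lemma flat0_ge0 (x : R) : 0 <= flat 0 x.
Proof. by rewrite /flat; case: ifP => // _; rewrite expr0 mul1r expR_ge0. Qed.

Lemma mollifier : exists rho : nat -> R -> R,
  [/\ forall k (s : R), is_derive s 1 (rho k) (rho k.+1 s),
   forall k, rho k (-1) = 0 /\ rho k 1 = 0,
   forall s, 0 <= rho 0%N s & segint (rho 0%N) = 1].
Proof.
pose l0 (c : R) : seq (R * (nat * nat)) := [:: (c, (0%N, 0%N))].
have cl l : continuous (bump_eval l).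
  move=> s; apply/differentiable_continuous/derivable1_diffP.
  by case: (is_derive_bump_eval l s).
have E c s : bump_eval (l0 c) s = c * (flat 0 (1 + s) * flat 0 (1 - s)).
  by rewrite /bump_eval big_seq1.
have pos : 0 < segint (bump_eval (l0 1)).
  apply: segint_gt0 => //; first by move=> s; rewrite E mul1r mulr_ge0// flat0_ge0.
  by rewrite E addr0 subr0 /flat ltr01 expr0 !mul1r mulr_gt0// expR_gt0.
exists (fun k => bump_eval (iter k bump_d (l0 (segint (bump_eval (l0 1)))^-1))).
split=> [k s|k|s|]; first exact: is_derive_bump_eval.
- rewrite /bump_eval; split; apply: big1 => t _.
    by rewrite flat_le0 ?mul0r ?mulr0//; lra.
  by rewrite [X in _ * X]mulrC flat_le0 ?mul0r ?mulr0//; lra.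
- by rewrite E mulr_ge0 ?invr_ge0 ?(ltW pos)// mulr_ge0// flat0_ge0.
rewrite (_ : bump_eval _ = fun s => (segint (bump_eval (l0 1)))^-1 * bump_eval (l0 1) s).
  by rewrite segintZ// mulVf// gt_eqF.
by apply/funext => s; rewrite !E mul1r.
Qed.

End mollifier.

(*@@P5c*)
Section convolution.
Context (R : realType) (E : normedModType R).
Hypothesis ball_compact : forall L : R, compact [set x : E | `|x| <= L].

(** Average of [f] against the kernel [k] along the segment of half-length [d]
    and direction [a]. *)
Definition lineavg (k : R -> R) (a : E) (d : R) (f : E -> R) (x : E) : R :=
  segint (fun s => k s * f (x - (d * s) *: a)).

Lemma continuous_line (a : E) (d : R) (f : E -> R) (x : E) :
  continuous f -> continuous (fun s => f (x - (d * s) *: a)).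
Proof.
move=> cf; apply: (continuous_comp_app (f := fun s : R => x - (d * s) *: a) (g := f)) => //.
apply: continuous_sub; first exact: cst_continuous.
apply: continuous_scale; last exact: cst_continuous.
by apply: continuous_mul; [exact: cst_continuous|exact: continuous_id].
Qed.

Lemma continuous_lineavg_integrand (k : R -> R) (a : E) (d : R) (f : E -> R) (x : E) :
  continuous k -> continuous f -> continuous (fun s => k s * f (x - (d * s) *: a)).
Proof. by move=> ck cf; apply: continuous_mul => //; exact: continuous_line. Qed.

Lemma lineavg_near (x a : E) (d s r : R) : 0 <= d -> -1 <= s <= 1 -> `|a| <= 1 ->
  `|x| <= r -> `|x - (d * s) *: a| <= r + d.
Proof.
move=> d0 s1 a1 xr; rewrite (le_trans (ler_normB _ _))// lerD// normrZ normrM.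
rewrite (ger0_norm d0) -mulrA ler_piMr// -[leRHS]mulr1 ler_pM// ler_norml.
exact: s1.
Qed.

Section fixed_kernel.
Variables (k : R -> R) (a : E) (d : R).
Hypotheses (ck : continuous k) (d0 : 0 <= d) (a1 : `|a| <= 1).

Lemma lineavg_sub (f g : E -> R) (x y : E) : continuous f -> continuous g ->
  lineavg k a d f x - lineavg k a d g y =
  segint (fun s => k s * (f (x - (d * s) *: a) - g (y - (d * s) *: a))).
Proof.
move=> cf cg; rewrite -segintB; last 2 first.
- exact: continuous_lineavg_integrand.
- exact: continuous_lineavg_integrand.
by congr segint; apply/funext => s; rewrite mulrBr.
Qed.

Lemma kernel_bound : exists2 B, 0 < B &
  forall g : R -> R, continuous g -> forall C : R,
    (forall s, -1 <= s <= 1 -> `|g s| <= C) -> `|segint (fun s => k s * g s)| <= B * C.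
Proof.
have [B B0 HB] := compact_bound (@segment_compact R (-1) 1) ck.
exists (2 * B); first by rewrite mulr_gt0.
move=> g cg C gC; rewrite -mulrA -segint_cst; apply: segint_norm_le.
- exact: continuous_mul.
- exact: cst_continuous.
move=> s s1; rewrite normrM ler_pM//; last exact: gC.
by apply: HB; rewrite /= in_itv.
Qed.

Lemma continuous_lineavg f : continuous f -> continuous (lineavg k a d f).
Proof.
move=> cf; have [B B0 HB] := kernel_bound.
apply: continuous_epsilon => x e e0.
have [r r0 Hr] := compact_ucont (@ball_compact (`|x| + d)) cf (divr_gt0 e0 B0).
exists r => // z zx; rewrite lineavg_sub// [leRHS](_ : _ = B * (e / B)); last first.
  by rewrite mulrC divfK// gt_eqF.
apply: HB => [|s s1].
  by apply: continuous_sub; exact: continuous_line.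
apply/ltW/Hr; first exact: lineavg_near.
by rewrite opprB addrA subrK.
Qed.

Variables (I : finType) (e : I -> E) (c : I -> E -> R).
Hypothesis sum_c : forall h, h = \sum_i c i h *: e i.
Hypothesis c_le : forall i h, `|c i h| <= `|h|.

Lemma diff_lineavg (f : E -> R) (x : E) : Ck 1 f ->
  differentiable (lineavg k a d f) x /\
  forall v, 'd (lineavg k a d f) x v = lineavg k a d (fun y => 'd f y v) x.
Proof.
move=> Cf; have [B B0 HB] := kernel_bound; have cf := Ck1_continuous Cf.
pose l h := lineavg k a d (fun y => 'd f y h) x.
have ll : linear l.
  move=> r u w; rewrite /l /lineavg /GRing.scale/= -segintZ; last first.
    exact: continuous_lineavg_integrand (Cf.2 u).
  rewrite -segintD; [|apply: continuous_mul; [exact: cst_continuous|]|].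
  - congr segint; apply/funext => s; rewrite linearP mulrDr; congr (_ + _).
    by rewrite mulrCA.
  - exact: continuous_lineavg_integrand (Cf.2 u).
  - exact: continuous_lineavg_integrand (Cf.2 w).
pose L : {linear E -> R} := HB.pack l (GRing.isLinear.Build _ _ _ _ _ ll).
have cL : continuous L.
  pose M := \sum_i `|L (e i)| + 1.
  have M0 : 0 < M by rewrite ltr_wpDl// sumr_ge0.
  apply: continuous_epsilon => y eps eps0; exists (eps / M); first by rewrite divr_gt0.
  move=> z zy; rewrite -linearB {1}[z - y]sum_c linear_sum.
  rewrite (le_trans (ler_norm_sum _ _ _))//.
  apply: (@le_trans _ _ (M * `|z - y|)); last first.
    by rewrite mulrC -ler_pdivlMr// ltW.
  rewrite /M mulrDl mul1r mulr_suml ler_wpDr// ler_sum// => i _.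
  by rewrite linearZ normrM mulrC ler_wpM2l.
have [dl El] : is_diff x (lineavg k a d f) L.
  apply: is_diff_bound => // eta eta0.
  have [r r0 Hr] := Ck1_unif_diff sum_c c_le Cf (@ball_compact (`|x| + d)) (divr_gt0 eta0 B0).
  exists r => // h hr; rewrite lineavg_sub//.
  rewrite [X in `|_ - X|](_ : _ = segint (fun s => k s * 'd f (x - (d * s) *: a) h))//.
  have c1 : continuous (fun s => f (x + h - (d * s) *: a) - f (x - (d * s) *: a)).
    by apply: continuous_sub; exact: continuous_line.
  have c2 : continuous (fun s => 'd f (x - (d * s) *: a) h).
    exact: continuous_line (Cf.2 h).
  rewrite -segintB; [|exact: continuous_mul..].
  rewrite (_ : (fun s => _) = fun s => k s * (f (x + h - (d * s) *: a) -
      f (x - (d * s) *: a) - 'd f (x - (d * s) *: a) h)); last first.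
    by apply/funext => s; rewrite -mulrBr.
  rewrite [leRHS](_ : _ = B * (eta / B * `|h|)); last first.
    by rewrite mulrA [B * _]mulrC divfK// gt_eqF.
  apply: HB => [|s s1]; first exact: continuous_sub.
  rewrite [x + h - _]addrAC; apply: Hr => //; exact: lineavg_near.
split => // v; exact: (congr1 (fun g => g v) El).
Qed.

Lemma Ck1_lineavg (f : E -> R) : Ck 1 f -> Ck 1 (lineavg k a d f).
Proof.
move=> Cf; split=> [x|v]; first exact: (diff_lineavg x Cf).1.
rewrite (_ : (fun x => _) = lineavg k a d (fun y => 'd f y v)).
  exact: continuous_lineavg (Cf.2 v).
by apply/funext => x; exact: (diff_lineavg x Cf).2.
Qed.

End fixed_kernel.
End convolution.

(*@@P5d*)
Section Ck_sum.
Context (R : realType) (E : normedModType R) (J : Type).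

Lemma Ck_lincomb k (r : seq J) (w : J -> R) (F : J -> E -> R) :
  (forall j, Ck k (F j)) -> Ck k (fun x => \sum_(j <- r) w j * F j x).
Proof.
elim: k F => [|k IH] F CF.
  apply: continuous_sum => j; apply: continuous_mul; first exact: cst_continuous.
  exact: (CF j).
have dF (q : seq J) x : differentiable (fun x => \sum_(j <- q) w j * F j x) x /\
    forall v, 'd (fun x => \sum_(j <- q) w j * F j x) x v = \sum_(j <- q) w j * 'd (F j) x v.
  elim: q => [|j q [d1 E1]].
    rewrite (_ : (fun x => _) = fun=> 0); last by apply/funext => y; rewrite big_nil.
    by split => [|v]; [exact: differentiable_cst|rewrite diff_cst_app big_nil].
  rewrite (_ : (fun x => _) = fun x => w j * F j x + \sum_(j <- q) w j * F j x); last first.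
    by apply/funext => y; rewrite big_cons.
  have dw : differentiable (fun x => w j * F j x) x.
    by apply: differentiableM; [exact: differentiable_cst|exact: (CF j).1].
  split=> [|v]; first exact: differentiableD.
  apply: (etrans (diffD_app v dw d1)); rewrite big_cons; congr (_ + _); last exact: E1.
  apply: (etrans (diffM_app v (differentiable_cst (w j) x) ((CF j).1 x))).
  by rewrite diff_cst_app mulr0 addr0.
split=> [x|v]; first exact: (dF r x).1.
rewrite (_ : (fun x => _) = fun x => \sum_(j <- r) w j * 'd (F j) x v).
  by apply: IH => j; exact: (CF j).2.
by apply/funext => x; exact: (dF r x).2.
Qed.

End Ck_sum.

Section mollify.
Context (R : realType) (E : normedModType R).
Hypothesis ball_compact : forall L : R, compact [set x : E | `|x| <= L].
Variables (I : finType) (e : I -> E) (c : I -> E -> R).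
Hypothesis sum_c : forall h, h = \sum_i c i h *: e i.
Hypothesis c_le : forall i h, `|c i h| <= `|h|.
Hypothesis e_le : forall i, `|e i| <= 1.

Variable rho : nat -> R -> R.
Hypothesis d_rho : forall k (s : R), is_derive s 1 (rho k) (rho k.+1 s).
Hypothesis rho_bd : forall k, rho k (-1) = 0 /\ rho k 1 = 0.
Hypothesis rho_ge0 : forall s, 0 <= rho 0%N s.
Hypothesis rho_int : segint (rho 0%N) = 1.

Let crho k : continuous (rho k).
Proof.
move=> s; apply/differentiable_continuous/derivable1_diffP.
by case: (d_rho k s).
Qed.

(** Integration by parts moves a derivative along the direction of averaging
    from the function to the kernel. *)
Lemma lineavg_parts k (a : E) (d : R) (f : E -> R) (x : E) : 0 < d -> Ck 1 f ->
  lineavg (rho k) a d (fun y => 'd f y a) x = d^-1 * lineavg (rho k.+1) a d f x.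
Proof.
move=> d0 Cf; have cf := Ck1_continuous Cf.
have dl (s : R) : is_derive s 1 (fun s : R => f (x - (d * s) *: a))
    (- d * 'd f (x - (d * s) *: a) a).
  rewrite (_ : (fun s : R => _) = fun s => f (x + s *: (- d *: a))).
    have := @is_derive_line R E f x (- d *: a) s (Cf.1 _).
    have E1 : x + s *: (- d *: a) = x - (d * s) *: a.
      by rewrite scalerA mulrN scaleNr mulrC.
    rewrite E1 linearZ => H; exact: H.
  by apply/funext => t; rewrite scalerA mulrN scaleNr mulrC.
have dG (s : R) := is_deriveM (d_rho k s) (dl s).
have := @segint_FTC R (rho k * (fun s : R => f (x - (d * s) *: a)))
  (fun s => rho k s * (- d * 'd f (x - (d * s) *: a) a) +
            f (x - (d * s) *: a) * rho k.+1 s) dG.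
rewrite mulrfctE !(rho_bd k).1 !(rho_bd k).2 !mul0r subrr.
have c1 : continuous (fun s => rho k s * 'd f (x - (d * s) *: a) a).
  exact: continuous_lineavg_integrand (Cf.2 a).
have c2 : continuous (fun s => rho k.+1 s * f (x - (d * s) *: a)).
  exact: continuous_lineavg_integrand.
rewrite (_ : (fun s => _) = fun s => - d * (rho k s * 'd f (x - (d * s) *: a) a) +
    rho k.+1 s * f (x - (d * s) *: a)); last first.
  by apply/funext => s; rewrite mulrCA [f _ * _]mulrC.
have c1' : continuous (fun s => - d * (rho k s * 'd f (x - (d * s) *: a) a)).
  by apply: continuous_mul => //; exact: cst_continuous.
move=> /(_ (continuous_add c1' c2)); rewrite segintD// segintZ// => H.
rewrite /lineavg; apply: (@mulfI _ d); first by rewrite gt_eqF.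
by rewrite mulrA divff ?gt_eqF// mul1r; lra.
Qed.

Definition molly (d : R) (l : seq (I * nat)) (f : E -> R) : E -> R :=
  foldr (fun p g => lineavg (rho p.2) (e p.1) d g) f l.

Lemma continuous_molly d l f : 0 <= d -> continuous f -> continuous (molly d l f).
Proof. by move=> d0 cf; elim: l => //= p l IH; exact: continuous_lineavg. Qed.

Lemma Ck1_molly d l f : 0 <= d -> Ck 1 f -> Ck 1 (molly d l f).
Proof.
move=> d0 Cf; elim: l => [|p l IH]; first exact: Cf.
rewrite -[molly d _ f]/(lineavg (rho p.2) (e p.1) d (molly d l f)).
have H := (Ck1_lineavg ball_compact (@crho p.2) d0 (e_le p.1) sum_c c_le IH).
exact: H.
Qed.

Lemma diff_molly d l f v x : 0 <= d -> Ck 1 f ->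
  'd (molly d l f) x v = molly d l (fun y => 'd f y v) x.
Proof.
move=> d0 Cf; elim: l x => //= p l IH x.
apply: (etrans ((diff_lineavg ball_compact (@crho p.2) d0 (e_le p.1) sum_c c_le x
  (Ck1_molly l d0 Cf)).2 v)).
by congr lineavg; apply/funext => y; exact: IH.
Qed.

Lemma mollyZ d l f (a : R) : continuous f -> 0 <= d ->
  molly d l (fun y => a * f y) = (fun y => a * molly d l f y).
Proof.
move=> cf d0; elim: l => //= p l ->; apply/funext => x; rewrite /lineavg -segintZ.
  by congr segint; apply/funext => s; rewrite mulrCA.
by apply: continuous_lineavg_integrand => //; exact: continuous_molly.
Qed.

Definition incr (i : I) (l : seq (I * nat)) : seq (I * nat) :=
  [seq if p.1 == i then (p.1, p.2.+1) else p | p <- l].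

Lemma diff_molly_e d l f x i : 0 < d -> Ck 1 f -> uniq (map fst l) ->
  i \in map fst l -> 'd (molly d l f) x (e i) = d^-1 * molly d (incr i l) f x.
Proof.
move=> d0 Cf; have d0' := ltW d0; elim: l x => [//|[j k] l IH] x /andP[jl ul].
have Cm := Ck1_molly l d0' Cf.
have dc : 'd (molly d ((j, k) :: l) f) x (e i) =
    lineavg (rho k) (e j) d (fun y => 'd (molly d l f) y (e i)) x :=
  (diff_lineavg ball_compact (@crho k) d0' (e_le j) sum_c c_le x Cm).2 (e i).
have [ij _|ij] := eqVneq j i.
  have -> : incr i ((j, k) :: l) = (j, k.+1) :: l.
    rewrite /incr /= ij eqxx; congr cons; rewrite -[RHS]map_id; apply/eq_in_map => p pl.
    case: eqP => // pi; move: (jl);  by rewrite /= ij -pi map_f.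
  move: dc; rewrite -ij => dc.
  exact: (etrans dc (lineavg_parts k _ x d0 Cm)).
rewrite inE eq_sym (negbTE ij) => il.
have -> : incr i ((j, k) :: l) = (j, k) :: incr i l by rewrite /incr /= (negbTE ij).
apply: (etrans dc).
rewrite (_ : (fun y => _) = fun y => d^-1 * molly d (incr i l) f y); last first.
  by apply/funext => y; exact: IH.
rewrite /lineavg -segintZ; last first.
  apply: continuous_lineavg_integrand => //.
  exact: continuous_molly d0' (Ck1_continuous Cf).
by congr segint; apply/funext => s; rewrite mulrCA.
Qed.

Lemma smooth_molly d f k l : 0 < d -> Ck 1 f -> map fst l = enum I ->
  Ck k (molly d l f).
Proof.
move=> d0 Cf; have d0' := ltW d0; elim: k l => [|k IH] l lI.
  exact: continuous_molly d0' (Ck1_continuous Cf).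
split=> [x|v]; first exact: (Ck1_molly l d0' Cf).1.
rewrite (_ : (fun x => _) = fun x => \sum_i (c i v * d^-1) * molly d (incr i l) f x).
  apply: Ck_lincomb => i; apply: IH; rewrite -lI -map_comp; apply: eq_map => p /=.
  by case: ifP.
apply/funext => x; apply: (etrans (diff_basis sum_c _ x v)); apply: eq_bigr => i _.
rewrite -mulrA; congr (_ * _); apply: diff_molly_e => //; rewrite lI ?enum_uniq//.
by rewrite mem_enum.
Qed.

(** Averages do not leave an interval which contains the values averaged. *)
Lemma molly_near d l f (x : E) (y0 eta r : R) : 0 <= d -> continuous f ->
  (forall p, p \in l -> p.2 = 0%N) ->
  (forall y, `|y - x| <= r + (size l)%:R * d -> `|f y - y0| <= eta) ->
  forall y, `|y - x| <= r -> `|molly d l f y - y0| <= eta.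
Proof.
move=> d0 cf; elim: l r => [|p l IH] r l0 H y yx; first by apply: H; rewrite mul0r addr0.
have p0 : p.2 = 0%N by apply: l0; rewrite inE eqxx.
have {}IH : forall y, `|y - x| <= r + d -> `|molly d l f y - y0| <= eta.
  apply: IH => [q ql|z zx]; first by apply: l0; rewrite inE ql orbT.
  apply: H; rewrite (le_trans zx)// /= -[in leRHS]natr1 mulrDl mul1r; lra.
rewrite /= p0 /lineavg.
have cm : continuous (molly d l f) by exact: continuous_molly.
have cl := @continuous_line _ _ (e p.1) d _ y cm.
have -> : y0 = segint (fun s => y0 * rho 0%N s) by rewrite segintZ// rho_int mulr1.
have -> : eta = segint (fun s => eta * rho 0%N s) by rewrite segintZ// rho_int mulr1.
have cr0 (a : R) : continuous (fun s => a * rho 0%N s).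
  by apply: continuous_mul => //; exact: cst_continuous.
rewrite -segintB//; last exact: continuous_mul.
apply: segint_norm_le => //; first by apply: continuous_sub => //; exact: continuous_mul.
move=> s s1; rewrite [y0 * _]mulrC -mulrBr normrM ger0_norm// mulrC ler_wpM2r//.
apply: IH; rewrite addrAC; exact: lineavg_near.
Qed.

Lemma ucont_supp (f : E -> R) (L eta : R) : continuous f ->
  (forall x : E, L < `|x| -> f x = 0) -> 0 < eta ->
  exists2 r : R, 0 < r & forall x y : E, `|y - x| < r -> `|f y - f x| <= eta.
Proof.
move=> cf f0 eta0; have [r r0 Hr] := compact_ucont (@ball_compact (L + 1)) cf eta0.
exists (Num.min r 1) => [|x y]; first by rewrite lt_min r0 ltr01.
rewrite lt_min => /andP[xr x1]; have [xL|xL] := leP `|x| (L + 1); first exact/ltW/Hr.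
have yL : L < `|y|.
  by have := ler_normB y (y - x); rewrite subKr => H; lra.
by rewrite !f0 ?subrr ?normr0 ?ltW//; lra.
Qed.

Lemma smooth_approx (f : E -> R) (L eta : R) : Ck 1 f ->
  (forall x : E, L < `|x| -> f x = 0) -> 0 < eta ->
  exists g : E -> R, [/\ forall k, Ck k g, forall x : E, L + 1 < `|x| -> g x = 0,
    forall x, `|g x - f x| <= eta &
    forall x i, `|'d g x (e i) - 'd f x (e i)| <= eta].
Proof.
move=> Cf f0 eta0; have cf := Ck1_continuous Cf.
pose h (o : option I) := if o is Some i then (fun x => 'd f x (e i)) else f.
have ch o : continuous (h o) by case: o => [i|//]; exact: Cf.2.
have h0 o (x : E) : L < `|x| -> h o x = 0.
  case: o => [i|] xL; last exact: f0.
  exact: (diff_out_support (e i) (Cf.1 x) f0 xL).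
have [||r r0 Hr] := @finite_radius R (option I)
  (fun o r => forall x y : E, `|y - x| < r -> `|h o y - h o x| <= eta).
- by move=> o k k' kk' H x y xy; apply: H; exact: lt_le_trans xy kk'.
- by move=> o; exact: ucont_supp (ch o) (h0 o) eta0.
pose l := [seq (i, 0%N) | i <- enum I]; pose N : R := (size l)%:R.
have N0 : 0 < N + 1 by rewrite ltr_wpDl.
pose d := Num.min r 1 / (N + 1).
have d0 : 0 < d by rewrite divr_gt0// lt_min r0 ltr01.
have Nd : N * d < Num.min r 1.
  by rewrite /d mulrA ltr_pdivrMr// mulrC ltr_pM2l ?lt_min ?r0 ?ltr01// ltrDl.
have l0 p : p \in l -> p.2 = 0%N by move=> /mapP[i _ ->].
have near_h o x : `|molly d l (h o) x - h o x| <= eta.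
  apply: (@molly_near d l (h o) x _ eta 0 (ltW d0) (ch o) l0) => [y|]; last by rewrite subrr normr0.
  by rewrite add0r => yx; apply: Hr; rewrite (le_lt_trans yx)// (lt_le_trans Nd)// ge_min lexx.
exists (molly d l f); split.
- by move=> k; apply: smooth_molly => //; rewrite -map_comp map_id.
- move=> x xL; apply/eqP; rewrite -normr_le0 -[molly _ _ _ _]subr0.
  apply: (@molly_near d l f x 0 0 0 (ltW d0) cf l0) => [y|]; last by rewrite subrr normr0.
  rewrite add0r => yx; rewrite f0 ?subr0 ?normr0//.
  have Nd1 : N * d < 1 by rewrite (lt_le_trans Nd)// ge_min lexx orbT.
  have := ler_normB y (y - x); rewrite subKr -/N in yx * => H; lra.
- by move=> x; exact: (near_h None).
move=> x i; have E1 : 'd (molly d l f) x (e i) = molly d l (h (Some i)) x.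
  exact: diff_molly (ltW d0) Cf.
exact: (eq_ind_r (fun t => `|t - 'd f x (e i)| <= eta) (near_h (Some i) x) E1).
Qed.

End mollify.

(*@@P5e*)
Section slices.
Context (R : realType) (n : nat).
Implicit Types (phi : R * 'rV[R]_n -> R) (x v : 'rV[R]_n) (t : R).

Lemma diff_space_slice phi t x : differentiable phi (t, x) ->
  differentiable (fun y => phi (t, y)) x /\
  forall v, 'd (fun y => phi (t, y)) x v = 'd phi (t, x) (0, v).
Proof.
move=> dphi; have dp := is_diff_pair (is_diff_cst t x) (is_diff_id x).
have [d1 E1] := is_diff_comp dp (differentiableP dphi).
by split => // v; exact: (congr1 (fun f => f v) E1).
Qed.

Lemma diff_time_slice phi t x : differentiable phi (t, x) ->
  differentiable (fun s : R => phi (s, x)) t /\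
  'd (fun s : R => phi (s, x)) t 1 = 'd phi (t, x) (1, 0).
Proof.
move=> dphi; have dp := is_diff_pair (is_diff_id t) (is_diff_cst x t).
have [d1 E1] := is_diff_comp dp (differentiableP dphi).
by split => //; exact: (congr1 (fun f => f 1) E1).
Qed.

Lemma continuous_space_slice (T : topologicalType) (f : R * 'rV[R]_n -> T) t :
  continuous f -> continuous (fun y : 'rV[R]_n => f (t, y)).
Proof.
move=> cf; apply: (continuous_comp_app (f := fun y : 'rV[R]_n => (t, y))) => //.
by apply: continuous_pair; [exact: cst_continuous|exact: continuous_id].
Qed.

Lemma continuous_time_slice (T : topologicalType) (f : R * 'rV[R]_n -> T) x :
  continuous f -> continuous (fun s : R => f (s, x)).
Proof.
move=> cf; apply: (continuous_comp_app (f := fun s : R => (s, x))) => //.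
by apply: continuous_pair; [exact: continuous_id|exact: cst_continuous].
Qed.

Lemma Ck1_space_slice phi t : Ck 1 phi -> Ck 1 (fun y => phi (t, y)).
Proof.
move=> [dphi cphi]; split=> [x|v]; first exact: (diff_space_slice (dphi (t, x))).1.
rewrite (_ : (fun x => _) = fun y => 'd phi (t, y) (0, v)).
  exact: (continuous_space_slice (cphi (0, v))).
by apply/funext => y; exact: (diff_space_slice (dphi (t, y))).2.
Qed.

Lemma continuous_snd_comp (T : topologicalType) (f : 'rV[R]_n -> T) :
  continuous f -> continuous (fun p : R * 'rV[R]_n => f p.2).
Proof.
move=> cf; apply: (continuous_comp_app (f := fun p : R * 'rV[R]_n => p.2)) => // p.
exact: cvg_snd.
Qed.

Lemma Ck1_row (E : normedModType R) (F : E -> 'rV[R]_n) : Ck 1 F ->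
  forall i, Ck 1 (fun z : E => F z ord0 i).
Proof.
move=> [dF cF] i; split=> [z|w].
  apply: (@differentiable_comp _ _ _ _ F (fun y : 'rV[R]_n => y ord0 i)) => //.
  exact: differentiable_coord.
rewrite (_ : (fun z => _) = fun z => ('d F z w) ord0 i); last first.
  by apply/funext => z; exact: diff_rV.
apply: (continuous_comp_app (f := fun z => 'd F z w) (g := fun y : 'rV[R]_n => y ord0 i)).
  exact: (cF w).
exact: coord_continuous.
Qed.

Lemma tx_delta_le1 (o : option 'I_n) : `|tx_delta R o| <= 1.
Proof.
by case: o => [i|]; rewrite prod_normE /= ge_max ?normr0 ?normr1 ?lexx ?ler01 ?norm_delta.
Qed.

Lemma smooth_approx_tx phi (L eta : R) : Ck 1 phi ->
  (forall p : R * 'rV[R]_n, L < `|p| -> phi p = 0) -> 0 < eta ->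
  exists g, [/\ forall k, Ck k g, forall p : R * 'rV[R]_n, L + 1 < `|p| -> g p = 0,
    forall p, `|g p - phi p| <= eta &
    forall p o, `|'d g p (tx_delta R o) - 'd phi p (tx_delta R o)| <= eta].
Proof.
have [rho [d_rho rho_bd rho_ge0 rho_int]] := mollifier R.
exact: (smooth_approx (@compact_tx_ball R n) (@tx_sum_delta R n)
  (@tx_coord_le R n) tx_delta_le1 d_rho rho_bd rho_ge0 rho_int).
Qed.

End slices.

(*@@P5f*)
Lemma Rintegral_close d (T : measurableType d) (R : realType)
    (mu : {measure set T -> \bar R}) (D : set T) (f1 f2 g : T -> R) (eta : R) :
  measurable D -> mu.-integrable D (EFin \o f1) -> mu.-integrable D (EFin \o f2) ->
  mu.-integrable D (EFin \o g) ->
  (forall x, D x -> `|f1 x - f2 x| <= eta * g x) ->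
  `|\int[mu]_(x in D) f1 x - \int[mu]_(x in D) f2 x| <= eta * \int[mu]_(x in D) g x.
Proof.
move=> mD i1 i2 ig fg; rewrite -RintegralB//.
have i12 : mu.-integrable D (EFin \o (fun x => f1 x - f2 x)).
  exact: (eq_integrable mD _ _ (fun x _ => erefl) (integrableB mD i1 i2)).
rewrite (le_trans (le_normr_Rintegral mD i12))// -RintegralZl//.
apply: le_Rintegral => //; first exact: integrable_norm.
exact: (eq_integrable mD _ _ (fun x _ => erefl) (integrableZl mD eta ig)).
Qed.

Section weak.
Context (R : realType) (n : nat).
Variables (c : 'rV[R]_n -> 'rV[R]_n) (u0 : 'rV[R]_n -> R) (u : R * 'rV[R]_n -> R).
Hypothesis Cc : Ck 1 c.
Hypothesis cu0 : continuous u0.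
Hypothesis u_sol : transport_solution c u0 u.
Local Notation dx i := (delta_mx ord0 i : 'rV[R]_n).
Local Notation mR := (measurableTypeR R).

Definition divc (x : 'rV[R]_n) : R := \sum_i 'd (fun y => c y ord0 i) x (dx i).

(** [d phi / dt - div (phi c)], expanded. *)
Definition transport_op (phi : R * 'rV[R]_n -> R) (p : R * 'rV[R]_n) : R :=
  'd phi p (1, 0) - \sum_i 'd phi p (0, dx i) * c p.2 ord0 i - phi p * divc p.2.

Lemma transport_opE (phi : R * 'rV[R]_n -> R) p : Ck 1 phi ->
  'D_(1, 0) phi p - divergence (fun y => phi (p.1, y) *: c y) p.2 = transport_op phi p.
Proof.
case: p => t x Cphi; rewrite /transport_op /= deriveE; last exact: Cphi.1.
rewrite -addrA -opprD; congr (_ - _); rewrite /divergence /divc mulr_sumr -big_split/=.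
apply: eq_bigr => i _.
have [d1 E1] := diff_space_slice (Cphi.1 (t, x)).
have d2 := (Ck1_row Cc i).1 x.
rewrite (_ : (fun y => _) = fun y => phi (t, y) * c y ord0 i); last first.
  by apply/funext => y; rewrite mxE.
rewrite (deriveE _ (differentiableM d1 d2)).
apply: (etrans (diffM_app (dx i) d1 d2)); rewrite addrC; congr (_ + _).
exact: (etrans (mulrC _ _) (congr1 (fun r => r * c x ord0 i) (E1 (dx i)))).
Qed.

Lemma continuous_transport_op (phi : R * 'rV[R]_n -> R) : Ck 1 phi -> continuous (transport_op phi).
Proof.
move=> Cphi; apply: continuous_sub; last first.
  apply: continuous_mul; first exact: Ck1_continuous.
  apply: (@continuous_snd_comp _ _ _ divc).
  by apply: continuous_sum => i; exact: (Ck1_row Cc i).2.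
apply: continuous_sub; first exact: Cphi.2.
apply: continuous_sum => i; apply: continuous_mul; first exact: Cphi.2.
apply: (@continuous_snd_comp _ _ _ (fun x => c x ord0 i)).
exact: (Ck1_continuous (Ck1_row Cc i)).
Qed.

Lemma transport_op_supp (phi : R * 'rV[R]_n -> R) L p : Ck 1 phi ->
  (forall p : R * 'rV[R]_n, L < `|p| -> phi p = 0) -> L < `|p| -> transport_op phi p = 0.
Proof.
move=> Cphi phi0 Lp; rewrite /transport_op phi0// mul0r subr0.
have d0 w : 'd phi p w = 0 := diff_out_support w (Cphi.1 p) phi0 Lp.
by rewrite d0 big1 ?subrr// => i _; rewrite d0 mul0r.
Qed.

Definition slab (L : R) : set (mR * 'rV[R]_n) :=
  [set p | 0 <= p.1 /\ `|p : R * 'rV[R]_n| <= L].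

Lemma measurable_slab L : measurable (slab L).
Proof.
have -> : slab L = (`[0, +oo[ `&` `[- L, L]) `*` [set x | `|x| <= L].
  apply/seteqP; split => -[t x]; rewrite /slab /= prod_normE ge_max/= !in_itv/= andbT ler_norml.
    by case=> t0 /andP[].
  by case=> -[t0 t1] xL; split => //; apply/andP.
apply: measurableX; last exact: (box_lty L n).1.
by apply: measurableI; exact: measurable_itv.
Qed.

Lemma slab_Rplus L : slab L `<=` @Rplus_rV R n.
Proof. by move=> p []. Qed.

Lemma integrable_slab L : (lebesgue_tx R n).-integrable (slab L) (EFin \o u).
Proof.
apply: u_sol.1 (@slab_Rplus L).
have -> : slab L = [set p : R * 'rV[R]_n | `|p| <= L] `&` [set p | 0 <= p.1].
  by apply/seteqP; split => p [].
apply: compact_closedI; first exact: compact_tx_ball.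
apply: (@closed_comp _ _ (fun p : R * 'rV[R]_n => p.1) [set t | 0 <= t]).
  by move=> p _; exact: cvg_fst.
exact: closed_ge.
Qed.

Lemma integrable_slabM L f : continuous f ->
  (lebesgue_tx R n).-integrable (slab L) (EFin \o (fun p => u p * f p)).
Proof.
move=> cf; have [C C0 HC] := compact_bound (@compact_tx_ball R n L) cf.
have mf : measurable_fun (slab L) (f : mR * 'rV[R]_n -> mR).
  by apply: measurable_funTS; exact: continuous_measurable_tx.
have bf : [bounded f x | x in slab L].
  exists C; split; first exact: num_real.
  by move=> y Cy x [_ xL]; apply: le_trans (ltW Cy); exact: HC.
exact: (eq_integrable (measurable_slab L) _ _ (fun x _ => erefl)
  (integrableMl (measurable_slab L) (integrable_slab L) mf bf)).
Qed.

Lemma Rintegral_slab L f : (forall p : R * 'rV[R]_n, L < `|p| -> f p = 0) ->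
  \int[lebesgue_tx R n]_(p in @Rplus_rV R n) (u p * f p) =
  \int[lebesgue_tx R n]_(p in slab L) (u p * f p).
Proof.
move=> f0; rewrite Rintegral_mkcond [RHS]Rintegral_mkcond.
apply: eq_Rintegral => p _; rewrite !patchE.
case: ifPn => [/set_mem pR|/negP pR]; case: ifPn.
- by [].
- move=> /negP pL; rewrite f0 ?mulr0// ltNge; apply/negP => pL'.
  by apply: pL; rewrite inE.
- by move=> /set_mem/slab_Rplus pL; exfalso; apply: pR; rewrite inE.
- by [].
Qed.

Lemma integrable_init (f : R * 'rV[R]_n -> R) (L : R) : continuous f ->
  (forall p : R * 'rV[R]_n, L < `|p| -> f p = 0) ->
  (lebesgue_rV R n).-integrable setT (EFin \o (fun x => u0 x * f (0, x))).
Proof.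
move=> cf f0; have cg : continuous (fun x => u0 x * f (0, x)).
  by apply: continuous_mul => //; exact: continuous_space_slice.
apply: integrable_rV; first exact: continuous_measurable_rV.
have [C C0 HC] := compact_bound (@compact_rV_ball R n L) cg.
have supp x : L < `|x| -> u0 x * f (0, x) = 0.
  by move=> xL; rewrite f0 ?mulr0// prod_normE/= lt_max xL orbT.
exists (Num.max C L); first by rewrite le_max ltW.
move=> x; split; last by rewrite gt_max => /andP[_ /supp].
have [/HC H|/supp ->] := leP `|x| L; first by rewrite le_max H.
by rewrite normr0 le_max ltW.
Qed.

(** The weak identity is continuous for the C^1 convergence of test functions
    with supports in a fixed ball. *)
Lemma weak_C1 (phi : R * 'rV[R]_n -> R) (L : R) : Ck 1 phi ->
  (forall p : R * 'rV[R]_n, L < `|p| -> phi p = 0) ->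
  \int[lebesgue_tx R n]_(p in @Rplus_rV R n) (u p * transport_op phi p) +
  \int[lebesgue_rV R n]_x (u0 x * phi (0, x)) = 0.
Proof.
move=> Cphi phi0; pose M := L + 1; have LM : L < M by rewrite ltrDl.
have phiM p : M < `|p : R * 'rV[R]_n| -> phi p = 0 by move=> /(lt_trans LM)/phi0.
have cdiv : continuous divc by apply: continuous_sum => i; exact: (Ck1_row Cc i).2.
pose A (p : R * 'rV[R]_n) := 1 + \sum_i `|c p.2 ord0 i| + `|divc p.2|.
have cA : continuous A.
  apply: continuous_add; last first.
    by apply: continuous_norm; exact: continuous_snd_comp.
  apply: continuous_add; first exact: cst_continuous.
  apply: continuous_sum => i; apply: continuous_norm.
  apply: (@continuous_snd_comp _ _ _ (fun x => c x ord0 i)).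
  exact: (Ck1_continuous (Ck1_row Cc i)).
pose B1 := \int[lebesgue_tx R n]_(p in slab M) (`|u p * A p|).
pose ball := [set x : 'rV[R]_n | `|x| <= M].
pose w := (fun x => `|u0 x|) \_ ball.
pose B2 := \int[lebesgue_rV R n]_x w x.
set T := _ + _.
suff small eta : 0 < eta -> `|T| <= eta * (B1 + B2).
  apply/eqP; rewrite -normr_le0; apply/ler_addgt0Pl => eps eps0; rewrite addr0.
  have D0 : 0 < `|B1 + B2| + 1 by rewrite ltr_wpDl.
  rewrite (le_trans (small (eps / (`|B1 + B2| + 1)) _)) ?divr_gt0//.
  rewrite mulrAC ler_pdivrMr//; apply: ler_wpM2l; first exact: ltW.
  by rewrite (le_trans (ler_norm _))// lerDl.
move=> eta0; have [g [Sg g0 gphi dgphi]] := smooth_approx_tx Cphi phi0 eta0.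
have Cg : Ck 1 g := Sg 1%N.
have sol : \int[lebesgue_tx R n]_(p in @Rplus_rV R n) (u p * transport_op g p) +
    \int[lebesgue_rV R n]_x (u0 x * g (0, x)) = 0.
  rewrite -[RHS](u_sol.2 g).
    congr (_ + _); apply: eq_Rintegral => p _; congr (_ * _).
    by rewrite transport_opE.
  split => //; exists [set p : R * 'rV[R]_n | `|p| <= M]; first exact: compact_tx_ball.
  by move=> p /negP; rewrite -ltNge; exact: g0.
have H1 : `|\int[lebesgue_tx R n]_(p in slab M) (u p * transport_op phi p) -
    \int[lebesgue_tx R n]_(p in slab M) (u p * transport_op g p)| <= eta * B1.
  apply: Rintegral_close.
  - exact: measurable_slab.
  - exact: integrable_slabM (continuous_transport_op Cphi).
  - exact: integrable_slabM (continuous_transport_op Cg).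
  - exact: integrable_norm (integrable_slabM M cA).
  move=> p _; rewrite -mulrBr !normrM mulrCA ler_wpM2l//.
  apply: (@le_trans _ _ (eta * A p)); last by apply: ler_wpM2l; [exact: ltW|exact: ler_norm].
  have -> : transport_op phi p - transport_op g p =
      ('d phi p (1, 0) - 'd g p (1, 0)) -
      \sum_i ('d phi p (0, dx i) - 'd g p (0, dx i)) * c p.2 ord0 i -
      (phi p - g p) * divc p.2.
    have alg (x x' s s' f f' z : R) : (x - s - f * z) - (x' - s' - f' * z) =
      (x - x') - (s - s') - (f - f') * z by ring.
    apply: (etrans (alg _ _ _ _ _ _ _)); congr (_ - _ - _).
    by rewrite -sumrB; apply: eq_bigr => i _; rewrite mulrBl.
  rewrite /A !mulrDr mulr1 (le_trans (ler_normB _ _))// lerD//.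
    rewrite (le_trans (ler_normB _ _))// lerD//; first by rewrite distrC; exact: (dgphi p None).
    rewrite mulr_sumr (le_trans (ler_norm_sum _ _ _))// ler_sum// => i _.
    by rewrite normrM ler_wpM2r// distrC; exact: (dgphi p (Some i)).
  by rewrite normrM ler_wpM2r// distrC.
have mball : measurable ball := (box_lty M n).1.
have iw : (lebesgue_rV R n).-integrable setT (EFin \o w).
  have cn : continuous (fun x => `|u0 x|) by exact: continuous_norm.
  have [C C0 HC] := compact_bound (@compact_rV_ball R n M) cn.
  apply: integrable_rV.
    apply: (measurable_restrictT _ mball).1; apply: measurable_funTS.
    exact: continuous_measurable_rV.
  exists (Num.max C M); first by rewrite le_max ltW.
  move=> x; rewrite /w patchE; case: ifPn => [/set_mem xM|_].
    split; first by rewrite le_max HC.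
    by rewrite gt_max => /andP[_]; rewrite ltNge xM.
  by rewrite normr0 le_max ltW.
have H2 : `|\int[lebesgue_rV R n]_x (u0 x * phi (0, x)) -
    \int[lebesgue_rV R n]_x (u0 x * g (0, x))| <= eta * B2.
  apply: Rintegral_close => //.
  - exact: integrable_init (Ck1_continuous Cphi) phi0.
  - exact: integrable_init (Ck1_continuous Cg) g0.
  move=> x _; rewrite -mulrBr normrM mulrC /w patchE; case: ifPn => [_|/negP xM].
    by rewrite ler_wpM2r// distrC.
  have Mx : M < `|(0, x) : R * 'rV[R]_n|.
    rewrite prod_normE/= lt_max; apply/orP; right; rewrite ltNge; apply/negP => xM'.
    by apply: xM; rewrite inE.
  by rewrite g0// phiM// subrr normr0 mul0r mulr0.
have key (a b a' b' : R) : `|a - a'| <= eta * B1 -> `|b - b'| <= eta * B2 ->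
    a' + b' = 0 -> `|a + b| <= eta * (B1 + B2).
  move=> h1 h2 ab; have -> : a + b = (a - a') + (b - b') by lra.
  by rewrite mulrDr (le_trans (ler_normD _ _))// lerD.
move: sol; rewrite (Rintegral_slab (L := M)); last first.
  by move=> p pM; exact: (transport_op_supp Cg g0 pM).
move=> sol; rewrite /T (Rintegral_slab (L := M)); last first.
  by move=> p pM; exact: (transport_op_supp Cphi phiM pM).
exact: key H1 H2 sol.
Qed.

End weak.

(*@@P6a*)
Section Ck1_real.
Context (R : realType).

Lemma Ck1_real (f f' : R -> R) : (forall s : R, is_derive s 1 f (f' s)) ->
  continuous f' -> Ck 1 f /\ forall s v, 'd f s v = v * f' s.
Proof.
move=> df cf'; have dd s : differentiable f s.
  by apply/derivable1_diffP; case: (df s).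
have E s v : 'd f s v = v * f' s.
  have <- : 'd f s 1 = f' s.
    by rewrite -deriveE//; exact: derive_val.
  by rewrite -[v in LHS]mulr1 -[v * 1]/(v *: 1) linearZ.
split; last exact: E.
split=> [//|v]; rewrite (_ : (fun x => _) = fun s => v * f' s).
  by apply: continuous_mul => //; exact: cst_continuous.
by apply/funext => s.
Qed.

Lemma Ck1_comp_real (E : normedModType R) (f : E -> R) (g : R -> R) :
  Ck 1 f -> Ck 1 g -> Ck 1 (fun x => g (f x)) /\
  forall x v, 'd (fun x => g (f x)) x v = 'd g (f x) ('d f x v).
Proof.
move=> Cf Cg; have E1 x : is_diff x (g \o f) ('d g (f x) \o 'd f x).
  exact: is_diff_comp (differentiableP (Cf.1 x)) (differentiableP (Cg.1 (f x))).
have E2 x v : 'd (fun x => g (f x)) x v = 'd g (f x) ('d f x v).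
  by have [_ H] := E1 x; exact: (congr1 (fun h => h v) H).
split; last exact: E2.
split=> [x|v]; first by case: (E1 x).
rewrite (_ : (fun x => _) = fun x => 'd f x v * 'd g (f x) 1); last first.
  apply/funext => x; apply: (etrans (E2 x v)).
  by rewrite -[X in 'd g _ X]mulr1 -[_ * 1]/(_ *: 1) linearZ.
apply: continuous_mul; first exact: Cf.2.
exact: (continuous_comp_app (Ck1_continuous Cf) (Cg.2 1)).
Qed.

End Ck1_real.

Section spline.
Context (R : realType).
Implicit Types s : R.

Definition ppart s : R := Num.max 0 s.
Definition psq s : R := s * ppart s.

Lemma ppartE s : (0 <= s -> ppart s = s) /\ (s <= 0 -> ppart s = 0).
Proof. by rewrite /ppart; split => s0; [exact: max_r|exact: max_l]. Qed.

Lemma continuous_ppart : continuous ppart.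
Proof.
rewrite (_ : ppart = fun s => (s + `|s|) / 2).
  apply: continuous_mul; last exact: cst_continuous.
  apply: continuous_add; first exact: continuous_id.
  by apply: continuous_norm; exact: continuous_id.
apply/funext => s; rewrite /ppart; case: (lerP 0 s) => s0.
  by rewrite ger0_norm//; lra.
by rewrite ltr0_norm//; lra.
Qed.

Lemma is_derive_psq s : is_derive s 1 psq (2 * ppart s).
Proof.
apply: (@is_derive_quadratic _ _ _ _ 1) => h; rewrite /psq /ppart mul1r.
have h2 := sqr_ge0 h.
rewrite ler_norml; case: (lerP 0 s) => s0; case: (lerP 0 (s + h)) => sh; nra.
Qed.

(** The quadratic B-spline interpolating a step, and its primitive. *)
Definition step (s : R) : R := 2 * (psq s - 2 * psq (s - 2^-1) + psq (s - 1)).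
Definition dstep (s : R) : R := 4 * (ppart s - 2 * ppart (s - 2^-1) + ppart (s - 1)).
Definition ramp (s : R) : R :=
  2 / 3 * (s * psq s - 2 * ((s - 2^-1) * psq (s - 2^-1)) + (s - 1) * psq (s - 1)).

Lemma step0 s : s <= 0 -> step s = 0.
Proof.
move=> s0; rewrite /step /psq !(ppartE _).2; [ring|lra..].
Qed.

Lemma step1 s : 1 <= s -> step s = 1 /\ dstep s = 0.
Proof. by move=> s0; rewrite /step /dstep /psq !(ppartE _).1; [split; field|lra..]. Qed.

Lemma step_itv s : 0 <= step s <= 1.
Proof.
have [s0|s0] := leP s 0; first by rewrite step0// lexx ler01.
have [s1|s1] := leP 1 s; first by rewrite (step1 s1).1 lexx ler01.
rewrite /step /psq (ppartE s).1; last lra.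
rewrite (ppartE (s - 1)).2; last lra.
have [s2|s2] := leP s 2^-1.
  rewrite (ppartE (s - 2^-1)).2; last lra.
  by apply/andP; split; nra.
rewrite (ppartE (s - 2^-1)).1; last lra.
by apply/andP; split; nra.
Qed.

Lemma ramp0 s : s <= 0 -> ramp s = 0.
Proof. by move=> s0; rewrite /ramp /psq !(ppartE _).2; [ring|lra..]. Qed.

Lemma ramp1 s : 1 <= s -> ramp s = s - 2^-1.
Proof. by move=> s0; rewrite /ramp /psq !(ppartE _).1; [field|lra..]. Qed.

Lemma continuous_step_aux (f : R -> R) (a b c e : R) : continuous f ->
  continuous (fun s => a * (f s - b * f (s - c) + f (s - e))).
Proof.
move=> cf; have cfs (x : R) : continuous (fun s => f (s - x)).
  apply: (continuous_comp_app (f := fun s : R => s - x)) => //.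
  by apply: continuous_sub; [exact: continuous_id|exact: cst_continuous].
apply: continuous_mul; first exact: cst_continuous.
apply: continuous_add => //; apply: continuous_sub => //.
by apply: continuous_mul => //; exact: cst_continuous.
Qed.

Lemma continuous_dstep : continuous dstep.
Proof. exact: continuous_step_aux continuous_ppart. Qed.

Lemma is_derive_aux (f f' : R -> R) (a b c e s : R) :
  (forall s : R, is_derive s 1 f (f' s)) ->
  is_derive s 1 (fun s => a * (f s - b * f (s - c) + f (s - e)))
    (a * (f' s - b * f' (s - c) + f' (s - e))).
Proof.
move=> df; have dfs (x : R) : is_derive s 1 (fun s => f (s - x)) (f' (s - x)).
  have dp : is_derive s 1 (fun y : R => y - x) 1.
    by apply: is_derive_eq (is_deriveB (is_derive_id s 1) (is_derive_cst (x : R) s 1)) _; rewrite subr0.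
  apply: is_derive_eq (@is_derive1_comp _ f (fun y : R => y - x) s _ _ (df (s - x)) dp) _.
  by rewrite mulr1.
exact: (is_deriveZ a (is_deriveD (is_deriveB (df s) (is_deriveZ b (dfs c))) (dfs e))).
Qed.

Lemma is_derive_step s : is_derive s 1 step (dstep s).
Proof.
have H := is_derive_aux 2 2 2^-1 1 s is_derive_psq.
by apply: is_derive_eq H _; rewrite /dstep; ring.
Qed.

Lemma continuous_step : continuous step.
Proof.
move=> s; apply/differentiable_continuous/derivable1_diffP.
by case: (is_derive_step s).
Qed.

Lemma is_derive_ramp s : is_derive s 1 ramp (step s).
Proof.
have d3 (r : R) : is_derive r 1 (fun r => r * psq r) (3 * psq r).
  apply: is_derive_eq (is_deriveM (is_derive_id r 1) (is_derive_psq r)) _.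
  by rewrite /psq /GRing.scale/=; ring.
have H := is_derive_aux (2 / 3) 2 2^-1 1 s d3.
by apply: is_derive_eq H _; rewrite /step; field.
Qed.

End spline.

(*@@P6b*)
Section plateau.
Context (R : realType).
Implicit Types (k a b s t : R).

(** Smooth approximation of the indicator of [`]a, b]], sharper as [k] grows. *)
Definition plateau k a b s : R := step (k * (s - a)) - step (k * (s - b)).

Lemma is_derive_affine (f f' : R -> R) k a s : (forall s : R, is_derive s 1 f (f' s)) ->
  is_derive s 1 (fun s => f (k * (s - a))) (k * f' (k * (s - a))).
Proof.
move=> df; have dp : is_derive s 1 (fun y : R => k * (y - a)) k.
  apply: is_derive_eq (is_deriveZ k (is_deriveB (is_derive_id s 1) (is_derive_cst a s 1))) _.
  by rewrite subr0 /GRing.scale/= mulr1.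
apply: is_derive_eq (@is_derive1_comp _ f (fun y : R => k * (y - a)) s _ _ (df _) dp) _.
exact: mulrC.
Qed.

Lemma continuous_affine (f : R -> R) k a : continuous f ->
  continuous (fun s => f (k * (s - a))).
Proof.
move=> cf; apply: (continuous_comp_app (f := fun s : R => k * (s - a))) => //.
apply: continuous_mul; first exact: cst_continuous.
by apply: continuous_sub; [exact: continuous_id|exact: cst_continuous].
Qed.

Lemma continuous_plateau k a b : continuous (plateau k a b).
Proof.
exact: (continuous_sub (@continuous_affine _ k a (@continuous_step R))
  (@continuous_affine _ k b (@continuous_step R))).
Qed.

Lemma Ck1_plateau k a b : Ck 1 (plateau k a b).
Proof.
have d s := is_deriveB (is_derive_affine k a s (@is_derive_step R))
  (is_derive_affine k b s (@is_derive_step R)).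
have c e : continuous (fun s => k * dstep (k * (s - e))).
  exact: (continuous_mul (@cst_continuous _ _ k)
    (@continuous_affine _ k e (@continuous_dstep R))).
exact: (Ck1_real d (continuous_sub (c a) (c b))).1.
Qed.

Lemma plateau_le1 k a b s : `|plateau k a b s| <= 1.
Proof.
have /andP[h1 h2] := step_itv (k * (s - a)); have /andP[h3 h4] := step_itv (k * (s - b)).
by rewrite /plateau ler_norml; apply/andP; split; lra.
Qed.

Lemma plateau0 k a b s : 1 <= k -> a <= b -> s <= a \/ b + 1 <= s -> plateau k a b s = 0.
Proof.
move=> k1 ab [sa|sb]; rewrite /plateau.
  by rewrite !step0 ?subrr//; nra.
by rewrite !(step1 _).1 ?subrr//; nra.
Qed.

Lemma cvg_plateau a b s : a <= b ->
  plateau j.+1%:R a b s @[j --> \oo] --> ((a < s <= b)%R%:R : R).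
Proof.
move=> ab.
have cstep (r : R) : step (j.+1%:R * r) @[j --> \oo] --> ((0 < r)%R%:R : R).
  have [r0|r0] := leP r 0.
    rewrite [X in X @ _ --> _](_ : _ = fun=> 0); first exact: cvg_cst.
    by apply/funext => j; rewrite step0// mulr_ge0_le0.
  apply: cvg_near_cst; near=> j; rewrite (step1 _).1//.
  rewrite -ler_pdivrMr// mul1r; apply: (@le_trans _ _ j%:R); last by rewrite ler_nat.
  by near: j; exact: nbhs_infty_ger.
rewrite (_ : (a < s <= b)%R%:R = (0 < s - a)%R%:R - (0 < s - b)%R%:R); last first.
  rewrite !subr_gt0; case: (ltP a s) => sa; case: (ltP b s) => sb; rewrite /= ?subr0 ?subrr//.
  by exfalso; lra.
exact: cvgB (cstep (s - a)) (cstep (s - b)).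
Unshelve. all: by end_near. Qed.

(** A primitive of [plateau k a b] on [t >= 0], cut off to have compact support. *)
Definition plateau_prim k a b t : R :=
  (k^-1 * ramp (k * (t - a)) - k^-1 * ramp (k * (t - b)) - (b - a)) * step (1 * (t - - 2)).

Lemma plateau_primP k a b : 1 <= k ->
  Ck 1 (plateau_prim k a b) /\
  forall t, 0 <= t -> 'd (plateau_prim k a b) t 1 = plateau k a b t.
Proof.
move=> k1; have k0 : k != 0 by rewrite gt_eqF//; lra.
pose A t := k^-1 * ramp (k * (t - a)) - k^-1 * ramp (k * (t - b)) - (b - a).
have dA t : is_derive t 1 A (plateau k a b t).
  have d1 := is_deriveZ k^-1 (is_derive_affine k a t (@is_derive_ramp R)).
  have d2 := is_deriveZ k^-1 (is_derive_affine k b t (@is_derive_ramp R)).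
  apply: is_derive_eq (is_deriveB (is_deriveB d1 d2) (is_derive_cst (b - a) t 1)) _.
  have kK (r : R) : k^-1 *: (k * r) = r by rewrite /GRing.scale/= mulrA mulVf// mul1r.
  by rewrite subr0 !kK.
have dB t := is_derive_affine 1 (- 2) t (@is_derive_step R).
have dAB t : is_derive t 1 (plateau_prim k a b)
    (A t * (1 * dstep (1 * (t - - 2))) + step (1 * (t - - 2)) * plateau k a b t).
  exact: (is_deriveM (dA t) (dB t)).
have cA : continuous A.
  by move=> t; apply/differentiable_continuous/derivable1_diffP; case: (dA t).
have [C E] : Ck 1 (plateau_prim k a b) /\ forall t v, 'd (plateau_prim k a b) t v =
    v * (A t * (1 * dstep (1 * (t - - 2))) + step (1 * (t - - 2)) * plateau k a b t).
  apply: (Ck1_real dAB); apply: continuous_add.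
    exact: (continuous_mul cA (continuous_mul (@cst_continuous _ _ (1 : R))
      (@continuous_affine _ 1 (- 2) (@continuous_dstep R)))).
  exact: (continuous_mul (@continuous_affine _ 1 (- 2) (@continuous_step R))
    (@continuous_plateau k a b)).
split => // t t0; apply: (etrans (E t 1)).
have [|-> ->] := @step1 R (1 * (t - - 2)); first lra.
by rewrite !mulr0 !mul1r add0r.
Qed.

Lemma plateau_prim0 k a b t : 1 <= k -> a <= b -> t <= - 2 \/ b + 1 <= t ->
  plateau_prim k a b t = 0.
Proof.
move=> k1 ab [tl|tr]; rewrite /plateau_prim.
  by rewrite step0 ?mulr0//; lra.
have k0 : k != 0 by rewrite gt_eqF//; lra.
have ha : 1 <= k * (t - a) by nra.
have hb : 1 <= k * (t - b) by nra.
rewrite (ramp1 ha) (ramp1 hb).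
have -> : k^-1 * (k * (t - a) - 2^-1) - k^-1 * (k * (t - b) - 2^-1) - (b - a) = 0 by field.
by rewrite mul0r.
Qed.

End plateau.

(*@@P6c*)
Section projections.
Context (R : realType) (n : nat).

Lemma Ck1_fst_comp (f : R -> R) : Ck 1 f ->
  Ck 1 (fun p : R * 'rV[R]_n => f p.1) /\
  forall p v, 'd (fun p : R * 'rV[R]_n => f p.1) p v = 'd f (p.1) (v.1).
Proof.
move=> Cf; have lf : linear (fst : R * 'rV[R]_n -> R) by [].
pose L : {linear (R * 'rV[R]_n)%type -> R} := HB.pack (fst : _ -> R) (GRing.isLinear.Build _ _ _ _ _ lf).
have dL p : is_diff p (fst : R * 'rV[R]_n -> R) L.
  apply: is_diff_bound => [q|eta eta0]; first exact: cvg_fst.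
  exists 1 => // h _; rewrite (_ : _ - L h = 0).
    by rewrite normr0; apply: mulr_ge0 => //; exact: ltW.
  by apply/eqP; rewrite subr_eq add0r /L /= addrC addKr.
have E1 p : is_diff p (f \o fst) ('d f (p.1) \o L).
  exact: is_diff_comp (dL p) (differentiableP (Cf.1 p.1)).
have E2 p v : 'd (fun p : R * 'rV[R]_n => f p.1) p v = 'd f (p.1) (v.1).
  by have [_ H] := E1 p; exact: (congr1 (fun h => h v) H).
split; last exact: E2.
split=> [p|v]; first by case: (E1 p).
rewrite (_ : (fun x => _) = fun p => 'd f (p.1) (v.1)); last by apply/funext => p; exact: E2.
apply: (continuous_comp_app (f := fst : R * 'rV[R]_n -> R) (g := fun t => 'd f t (v.1))).
  by move=> p; exact: cvg_fst.
exact: Cf.2.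
Qed.

Lemma Ck1_snd_comp (f : 'rV[R]_n -> R) : Ck 1 f ->
  Ck 1 (fun p : R * 'rV[R]_n => f p.2) /\
  forall p v, 'd (fun p : R * 'rV[R]_n => f p.2) p v = 'd f (p.2) (v.2).
Proof.
move=> Cf; have lf : linear (snd : R * 'rV[R]_n -> 'rV[R]_n) by [].
pose L : {linear (R * 'rV[R]_n)%type -> 'rV[R]_n} :=
  HB.pack (snd : _ -> 'rV[R]_n) (GRing.isLinear.Build _ _ _ _ _ lf).
have dL p : is_diff p (snd : R * 'rV[R]_n -> 'rV[R]_n) L.
  apply: is_diff_bound => [q|eta eta0]; first exact: cvg_snd.
  exists 1 => // h _; rewrite (_ : _ - L h = 0).
    by rewrite normr0; apply: mulr_ge0 => //; exact: ltW.
  by apply/eqP; rewrite subr_eq add0r /L /= addrC addKr.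
have E1 p : is_diff p (f \o snd) ('d f (p.2) \o L).
  exact: is_diff_comp (dL p) (differentiableP (Cf.1 p.2)).
have E2 p v : 'd (fun p : R * 'rV[R]_n => f p.2) p v = 'd f (p.2) (v.2).
  by have [_ H] := E1 p; exact: (congr1 (fun h => h v) H).
split; last exact: E2.
split=> [p|v]; first by case: (E1 p).
rewrite (_ : (fun x => _) = fun p => 'd f (p.2) (v.2)); last by apply/funext => p; exact: E2.
exact: (continuous_snd_comp (Cf.2 v.2)).
Qed.

End projections.

Section characteristics.
Context (R : realType) (n : nat).
Variables (c : 'rV[R]_n -> 'rV[R]_n) (sg : 'rV[R]_n -> R).
Variables (psi : 'I_n -> 'rV[R]_n -> R) (k0 : 'I_n).
Hypothesis Cc : Ck 1 c.
Hypothesis Csg : Ck 1 sg.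
Hypothesis Cpsi : forall j, Ck 1 (psi j).
Local Notation dx i := (delta_mx ord0 i : 'rV[R]_n).
Hypothesis div_sc : forall x, 'd sg x (c x) + sg x * divc c x = 0.
Hypothesis psi_c : forall j x, 'd (psi j) x (c x) = (j == k0)%:R.

(** The first integrals of the characteristics: [charact] is constant along the
    solutions of [X' = - c(X)], and [charact (t, x)] is [psi] at the point
    reached after following [c] from [x] during the time [t]. *)
Definition charact (p : R * 'rV[R]_n) : 'rV[R]_n := \row_j (psi j p.2 + p.1 * (j == k0)%:R).

Lemma Ck1_charact j :
  Ck 1 (fun p => charact p ord0 j) /\
  forall p v, 'd (fun p => charact p ord0 j) p v = 'd (psi j) (p.2) (v.2) + v.1 * (j == k0)%:R.
Proof.
rewrite (_ : (fun p => charact p ord0 j) = fun p => psi j p.2 + p.1 * (j == k0)%:R); last first.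
  by apply/funext => p; rewrite mxE.
have did (s : R) : is_derive s 1 (fun r : R => r * (j == k0)%:R) (j == k0)%:R.
  apply: is_derive_eq (is_deriveM (is_derive_id s 1) (is_derive_cst ((j == k0)%:R : R) s 1)) _.
  by rewrite /GRing.scale/= mulr0 mulr1 add0r.
have [C1 E1] := Ck1_real did (@cst_continuous _ _ _).
have [C2 E2] := Ck1_fst_comp n C1.
have [C3 E3] := Ck1_snd_comp (Cpsi j).
split; first exact: Ck1D C3 C2.
move=> p v; apply: (etrans (diffD_app v (C3.1 p) (C2.1 p))); congr (_ + _); first exact: E3.
exact: (etrans (E2 p v) (E1 _ _)).
Qed.

Lemma continuous_charact : continuous charact.
Proof. by apply: continuous_rV => j; exact: (Ck1_continuous (Ck1_charact j).1). Qed.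

Lemma Ck1_comp_charact (h : 'rV[R]_n -> R) : Ck 1 h ->
  Ck 1 (fun p => h (charact p)) /\
  forall p, 'd (fun p => h (charact p)) p (1, - c p.2) = 0.
Proof.
move=> Ch; split; first exact: (Ck1_comp (fun j => (Ck1_charact j).1) Ch).
move=> p; have dF : differentiable charact p.
  by apply: differentiable_rV => j; exact: (Ck1_charact j).1.1.
apply: (etrans (diff_comp_rV _ dF (Ch.1 _))); apply: big1 => j _.
have E : 'd (fun y => charact y ord0 j) p (1, - c p.2) = 0.
  apply: (etrans ((Ck1_charact j).2 _ _)) => /=.
  by rewrite linearN psi_c mul1r addNr.
by rewrite E mul0r.
Qed.

Lemma transport_op_dir (phi : R * 'rV[R]_n -> R) p :
  transport_op c phi p = 'd phi p (1, - c p.2) - phi p * divc c p.2.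
Proof.
rewrite /transport_op; congr (_ - _).
have -> : (1, - c p.2) = (1, 0) - \sum_i c p.2 ord0 i *: ((0, dx i) : R * 'rV[R]_n).
  have -> : \sum_i c p.2 ord0 i *: ((0, dx i) : R * 'rV[R]_n) = (0, c p.2).
    rewrite [RHS]surjective_pairing; apply/eqP; rewrite -pair_eqE /=; apply/andP; split; apply/eqP.
      rewrite (big_morph (fst : R * 'rV[R]_n -> R) (id1 := 0) (op1 := +%R))//=.
      by rewrite big1// => i _; rewrite /GRing.scale/= mulr0.
    rewrite (big_morph (snd : R * 'rV[R]_n -> _) (id1 := 0) (op1 := +%R))//=.
    by rewrite -row_sum_delta.
  by congr pair; rewrite /= ?subr0// sub0r.
rewrite [RHS]linearB; congr (_ - _); rewrite [RHS]linear_sum; apply: eq_bigr => i _.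
by rewrite linearZ mulrC.
Qed.

Definition wave (al : R -> R) (h : 'rV[R]_n -> R) (p : R * 'rV[R]_n) : R :=
  sg p.2 * al p.1 * h (charact p).

Lemma Ck1_wave al h : Ck 1 al -> Ck 1 h -> Ck 1 (wave al h).
Proof.
move=> Ca Ch; apply: Ck1M; last exact: (Ck1_comp_charact Ch).1.
exact: (Ck1M (Ck1_snd_comp Csg).1 (Ck1_fst_comp n Ca).1).
Qed.

Lemma transport_op_wave al h p : Ck 1 al -> Ck 1 h ->
  transport_op c (wave al h) p = sg p.2 * 'd al (p.1) 1 * h (charact p).
Proof.
move=> Ca Ch; have [C1 E1] := Ck1_snd_comp Csg; have [C2 E2] := Ck1_fst_comp n Ca.
have [C3 E3] := Ck1_comp_charact Ch.
have alg (s X A a r Y : R) : X + s * Y = 0 -> r * (s * A - a * X) - s * a * r * Y = s * A * r.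
  by move/eqP; rewrite addr_eq0 => /eqP ->; ring.
pose v : R * 'rV[R]_n := (1, - c p.2).
have D12 := diffM_app v (C1.1 p) (C2.1 p).
have D := diffM_app v ((Ck1M C1 C2).1 p) (C3.1 p).
apply: (etrans (transport_op_dir _ _)).
apply: (etrans (congr1 (fun r => r - wave al h p * divc c p.2) D)).
rewrite /wave E3 mulr0 add0r D12 E1 E2 /= linearN mulrN.
exact: alg (div_sc _).
Qed.

End characteristics.

(*@@P6d*)
Section conservation.
Context (R : realType) (n : nat).
Local Notation dx i := (delta_mx ord0 i : 'rV[R]_n).
Local Notation mR := (measurableTypeR R).
Local Notation Rp := (@Rplus_rV R n).
Implicit Types (f phi : R * 'rV[R]_n -> R) (L : R).

Lemma measurable_Rplus : measurable Rp.
Proof.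
rewrite (_ : Rp = `[0, +oo[%classic `*` setT); first exact: measurableX.
by apply/seteqP; split => -[t x]; rewrite /Rplus_rV /= in_itv/= andbT; tauto.
Qed.

Lemma bounded_support_tx f L : continuous f ->
  (forall p : R * 'rV[R]_n, L < `|p| -> f p = 0) -> bounded_support (fun p => `|p|) f.
Proof.
move=> cf f0; have [C C0 HC] := compact_bound (@compact_tx_ball R n L) cf.
exists (Num.max C L); first by rewrite le_max ltW.
move=> p; split; last by rewrite gt_max => /andP[_ /f0].
have [/HC H|/f0 ->] := leP `|p| L; first by rewrite le_max H.
by rewrite normr0 le_max ltW.
Qed.

Lemma integrable_Rplus f L : continuous f ->
  (forall p : R * 'rV[R]_n, L < `|p| -> f p = 0) ->
  (lebesgue_tx R n).-integrable Rp (EFin \o f).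
Proof.
move=> cf f0; apply: (@integrableS _ _ _ _ setT) => //; first exact: measurable_Rplus.
apply: integrable_tx; last exact: bounded_support_tx f0.
exact: continuous_measurable_tx.
Qed.

Lemma integral_Rplus_time phi L : Ck 1 phi ->
  (forall p : R * 'rV[R]_n, L < `|p| -> phi p = 0) ->
  \int[lebesgue_tx R n]_(p in Rp) 'd phi p (1, 0) = - \int[lebesgue_rV R n]_x phi (0, x).
Proof.
move=> Cphi phi0; have d0 p : L < `|p : R * 'rV[R]_n| -> 'd phi p ((1, 0) : R * 'rV[R]_n) = 0.
  by move=> Lp; exact: diff_out_support ((1, 0) : R * 'rV[R]_n) (Cphi.1 p) phi0 Lp.
pose M : R := `|L| + 1; have M0 : 0 < M by rewrite /M ltr_wpDl.
have LM : L < M by rewrite /M (le_lt_trans (ler_norm _))// ltrDl.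
have it := integrable_Rplus (Cphi.2 (1, 0)) d0.
move/(integrable_mkcond _ measurable_Rplus): it => it.
rewrite /Rintegral integral_mkcond -(integral21_prod_meas1 it) /fubini_G.
transitivity (\int[lebesgue_rV R n]_x (- phi (0, x))).
  congr fine; apply: eq_integral => x _.
  transitivity (\int[@lebesgue_measure R]_(t in `[0%R, M[) ('d phi (t, x) (1, 0))%:E)%E.
    rewrite [RHS]integral_mkcond; apply: eq_integral => t _; rewrite !patchE.
    have -> : ((t, x) \in Rp) = (0 <= t) by apply/idP/idP; rewrite inE.
    have -> : (t \in `[0%R, M[%classic) = (0 <= t < M).
      by apply/idP/idP; rewrite inE/= in_itv.
    case: (leP 0 t) => //= t0; case: ltP => // Mt.
    by rewrite d0// (lt_le_trans LM)// prod_normE/= le_max (le_trans Mt)// ler_norm.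
  have dF (s : R) : is_derive s 1 (fun t => phi (t, x)) ('d phi (s, x) (1, 0)).
    have [d1 E1] := diff_time_slice (Cphi.1 (s, x)).
    by rewrite -E1 -deriveE//; apply/derivableP/diff_derivable.
  rewrite (FTC_itvco M0 dF (continuous_time_slice (Cphi.2 (1, 0)))).
  rewrite (phi0 (M, x)) ?sub0r// prod_normE/= lt_max ger0_norm ?LM//; exact: ltW.
have i0 := integrable_init (u0 := fun=> 1) (@cst_continuous _ _ _) (Ck1_continuous Cphi) phi0.
rewrite -mulN1r -RintegralZl//; last first.
  by apply: eq_integrable i0 => // x _ /=; rewrite mul1r.
by apply: eq_Rintegral => x _; rewrite mulN1r.
Qed.

Lemma integral_Rplus_space phi i L : Ck 1 phi ->
  (forall p : R * 'rV[R]_n, L < `|p| -> phi p = 0) ->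
  \int[lebesgue_tx R n]_(p in Rp) 'd phi p ((0, dx i) : R * 'rV[R]_n) = 0.
Proof.
move=> Cphi phi0; have d0 p : L < `|p : R * 'rV[R]_n| -> 'd phi p ((0, dx i) : R * 'rV[R]_n) = 0.
  by move=> Lp; exact: diff_out_support ((0, dx i) : R * 'rV[R]_n) (Cphi.1 p) phi0 Lp.
have it := integrable_Rplus (Cphi.2 (0, dx i)) d0.
move/(integrable_mkcond _ measurable_Rplus): it => it.
rewrite /Rintegral integral_mkcond -(integral12_prod_meas1 it) /fubini_F.
rewrite integral0_eq// => t _.
have sl x : L < `|x : 'rV[R]_n| -> phi (t, x) = 0.
  by move=> Lx; rewrite phi0// prod_normE/= lt_max Lx orbT.
have dsl x := (diff_space_slice (Cphi.1 (t, x))).2 (dx i).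
have := integral_compact_partial i (Ck1_space_slice t Cphi) sl.
have mt : (lebesgue_rV R n).-integrable setT (fun x => ('d phi (t, x) (0, dx i))%:E).
  have cs : continuous (fun x => 'd phi (t, x) (0, dx i)).
    exact: (continuous_space_slice (Cphi.2 (0, dx i))).
  apply: (@integrable_rV R n (fun x => 'd phi (t, x) (0, dx i))).
    exact: continuous_measurable_rV cs.
  have [C C0 HC] := bounded_support_tx (Cphi.2 (0, dx i)) d0.
  exists C => // x; split; first exact: (HC _).1.
  by move=> Cx; apply: (HC _).2; rewrite prod_normE/= lt_max Cx orbT.
move=> I0; transitivity ((0 <= t)%R%:R%:E * \int[lebesgue_rV R n]_x ('d phi (t, x) (0, dx i))%:E)%E.
  rewrite -integralZl//; apply: eq_integral => x _; rewrite patchE.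
  have -> : ((t, x) \in Rp) = (0 <= t) by apply/idP/idP; rewrite inE.
  by case: ifP; rewrite ?mul1e ?mul0e.
rewrite (_ : \int[lebesgue_rV R n]_x _ = 0)%E ?mule0//.
rewrite -[LHS]fineK ?integrable_fin_num//; congr EFin; rewrite -[RHS]I0.
by congr fine; apply: eq_integral => x _; congr EFin; rewrite dsl.
Qed.
End conservation.

(*@@P6e*)
Section mass.
Context (R : realType) (n : nat).
Variable c : 'rV[R]_n -> 'rV[R]_n.
Hypothesis Cc : Ck 1 c.
Local Notation dx i := (delta_mx ord0 i : 'rV[R]_n).
Local Notation Rp := (@Rplus_rV R n).

Lemma transport_op_mass (phi : R * 'rV[R]_n -> R) L : Ck 1 phi ->
  (forall p : R * 'rV[R]_n, L < `|p| -> phi p = 0) ->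
  \int[lebesgue_tx R n]_(p in Rp) transport_op c phi p + \int[lebesgue_rV R n]_x phi (0, x) = 0.
Proof.
move=> Cphi phi0.
pose psi i (p : R * 'rV[R]_n) := phi p * c p.2 ord0 i.
have Cci i := Ck1_snd_comp (Ck1_row Cc i).
have Cpsi i : Ck 1 (psi i) := Ck1M Cphi (Cci i).1.
have psi0 i (p : R * 'rV[R]_n) : L < `|p| -> psi i p = 0.
  by move=> Lp; rewrite /psi phi0// mul0r.
have opE (p : R * 'rV[R]_n) : transport_op c phi p = 'd phi p (1, 0) - \sum_i 'd (psi i) p (0, dx i).
  rewrite /transport_op -addrA -opprD; congr (_ - _).
  rewrite /divc mulr_sumr -big_split/=; apply: eq_bigr => i _; apply/esym.
  apply: (etrans (diffM_app _ (Cphi.1 p) ((Cci i).1.1 p))); rewrite [RHS]addrC; congr (_ + _).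
    by congr (_ * _); exact: (etrans ((Cci i).2 p _)).
  exact: mulrC.
have d0 (phi' : R * 'rV[R]_n -> R) (w p : R * 'rV[R]_n) : Ck 1 phi' ->
    (forall p : R * 'rV[R]_n, L < `|p| -> phi' p = 0) -> L < `|p| -> 'd phi' p w = 0.
  by move=> C' phi'0 Lp; exact: diff_out_support w (C'.1 p) phi'0 Lp.
have ssum (r : seq 'I_n) : \int[lebesgue_tx R n]_(p in Rp)
    (\sum_(i <- r) 'd (psi i) p (0, dx i)) = 0.
  elim: r => [|i r IH].
    by under eq_Rintegral do rewrite big_nil; rewrite Rintegral_cst ?mul0r//; exact: measurable_Rplus.
  under eq_Rintegral do rewrite big_cons.
  rewrite RintegralD ?IH ?(integral_Rplus_space i (Cpsi i) (psi0 i)) ?addr0//.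
  - exact: measurable_Rplus.
  - apply: integrable_Rplus ((Cpsi i).2 _) _ => p; exact: d0 (Cpsi i) (psi0 i).
  - apply: (@integrable_Rplus R n (fun p => \sum_(i <- r) 'd (psi i) p (0, dx i)) L).
      by apply: continuous_sum => j; exact: ((Cpsi j).2 _).
    by move=> p Lp; apply: big1 => j _; exact: d0 (Cpsi j) (psi0 j) Lp.
under eq_Rintegral do rewrite opE.
rewrite RintegralB ?ssum ?(integral_Rplus_time Cphi phi0) ?subr0 ?addNr//.
- exact: measurable_Rplus.
- by apply: integrable_Rplus (Cphi.2 _) _ => p; exact: d0 Cphi phi0.
- apply: (@integrable_Rplus R n (fun p => \sum_i 'd (psi i) p (0, dx i)) L).
    by apply: continuous_sum => j; exact: ((Cpsi j).2 _).
  by move=> p Lp; apply: big1 => j _; exact: d0 (Cpsi j) (psi0 j) Lp.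
Qed.

End mass.

Section duality.
Context (R : realType) (n : nat).
Variables (c : 'rV[R]_n -> 'rV[R]_n) (sg : 'rV[R]_n -> R).
Variables (psi : 'I_n -> 'rV[R]_n -> R) (k0 : 'I_n) (W : 'rV[R]_n -> 'rV[R]_n).
Variables (u0 : 'rV[R]_n -> R) (u : R * 'rV[R]_n -> R).
Hypothesis Cc : Ck 1 c.
Hypothesis Csg : Ck 1 sg.
Hypothesis Cpsi : forall j, Ck 1 (psi j).
Hypothesis div_sc : forall x, 'd sg x (c x) + sg x * divc c x = 0.
Hypothesis psi_c : forall j x, 'd (psi j) x (c x) = (j == k0)%:R.
Hypothesis CW : forall i, Ck 1 (fun y => W y ord0 i).
Hypothesis psiK : forall x, W (\row_j psi j x) = x.
Hypothesis Cu0 : Ck 1 u0.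
Hypothesis u_sol : transport_solution c u0 u.
Local Notation Rp := (@Rplus_rV R n).
Local Notation charact := (charact psi k0).
Local Notation wave := (wave sg psi k0).

Lemma charactK p : W (charact p - p.1 *: delta_mx ord0 k0) = p.2.
Proof.
rewrite -[RHS]psiK; congr W; apply/rowP => j; rewrite !mxE eqxx/=.
by rewrite addrK.
Qed.

Lemma charact_init x : W (charact (0, x)) = x.
Proof. by rewrite -[RHS]psiK; congr W; apply/rowP => j; rewrite !mxE /= mul0r addr0. Qed.

Lemma charact_bound A B : exists L, forall p : R * 'rV[R]_n,
  `|p.1| <= A -> `|charact p| <= B -> `|p| <= L.
Proof.
have cW : continuous (fun y => `|W y|).
  by apply: continuous_norm; apply: continuous_rV => j; exact: Ck1_continuous (CW j).
have [C C0 HC] := compact_bound (@compact_rV_ball R n (B + A)) cW.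
exists (Num.max A C) => p pA pB; rewrite prod_normE/= ge_max !le_max pA/=.
apply/orP; right; have := HC (charact p - p.1 *: delta_mx ord0 k0).
rewrite charactK normr_id; apply; rewrite /= (le_trans (ler_normB _ _))// lerD//.
by rewrite normrZ (le_trans _ pA)// ler_piMr// norm_delta.
Qed.

Lemma wave_supp al h A B L : (forall p : R * 'rV[R]_n,
    `|p.1| <= A -> `|charact p| <= B -> `|p| <= L) ->
  (forall t, A < `|t| -> al t = 0) -> (forall z : 'rV[R]_n, B < `|z| -> h z = 0) ->
  forall p : R * 'rV[R]_n, L < `|p| -> wave al h p = 0.
Proof.
move=> HL al0 h0 p; rewrite ltNge => /negP Lp; rewrite /wave.
have [pA|/al0 ->] := leP `|p.1| A; last by rewrite mulr0 mul0r.
have [pB|/h0 ->] := leP `|charact p| B; last by rewrite mulr0.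
by case: Lp; exact: HL.
Qed.

(** Testing the equation against [wave al be] and comparing with the conserved
    mass of [wave al (u0 \o W * be)]. *)
Lemma duality al be A B : Ck 1 al -> Ck 1 be ->
  (forall t, A < `|t| -> al t = 0) -> (forall z : 'rV[R]_n, B < `|z| -> be z = 0) ->
  \int[lebesgue_tx R n]_(p in Rp)
    ((u p - u0 (W (charact p))) * (sg p.2 * 'd al (p.1) 1 * be (charact p))) = 0.
Proof.
move=> Cal Cbe al0 be0; have [L HL] := charact_bound A B.
pose h z := u0 (W z) * be z.
have Ch : Ck 1 h := Ck1M (Ck1_comp CW Cu0) Cbe.
have h0 z : B < `|z : 'rV[R]_n| -> h z = 0 by move=> /be0; rewrite /h => ->; rewrite mulr0.
have Cp1 : Ck 1 (wave al be) := Ck1_wave Csg Cpsi psi_c Cal Cbe.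
have Cp2 : Ck 1 (wave al h) := Ck1_wave Csg Cpsi psi_c Cal Ch.
have s1 := wave_supp HL al0 be0; have s2 := wave_supp HL al0 h0.
have cu0 : continuous u0 := Ck1_continuous Cu0.
have E1 := weak_C1 Cc cu0 u_sol Cp1 s1.
have E2 := transport_op_mass Cc Cp2 s2.
have init : \int[lebesgue_rV R n]_x wave al h (0, x) =
    \int[lebesgue_rV R n]_x (u0 x * wave al be (0, x)).
  apply: eq_Rintegral => x _; rewrite /wave /h charact_init.
  ring.
have op1 p := transport_op_wave Csg Cpsi div_sc psi_c p Cal Cbe.
have op2 p := transport_op_wave Csg Cpsi div_sc psi_c p Cal Ch.
have f0 (p : R * 'rV[R]_n) : L < `|p| -> sg p.2 * 'd al (p.1) 1 * be (charact p) = 0.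
  by move=> Lp; rewrite -op1; exact: transport_op_supp Cp1 s1 Lp.
pose U p := u0 (W (charact p)); pose f p := sg p.2 * 'd al (p.1) 1 * be (charact p).
have op2' p : transport_op c (wave al h) p = U p * f p.
  by apply: (etrans (op2 p)); rewrite /h /U /f mulrCA.
have iu : (lebesgue_tx R n).-integrable (slab L) (EFin \o (fun p => u p * f p)).
  have -> : f = transport_op c (wave al be) by apply/funext => p; rewrite op1.
  exact: (integrable_slabM u_sol L (continuous_transport_op Cc Cp1)).
have iU : (lebesgue_tx R n).-integrable (slab L) (EFin \o (fun p => U p * f p)).
  have -> : (fun p => U p * f p) = transport_op c (wave al h).
    by apply/funext => p; rewrite op2'.
  apply: (@integrableS _ _ _ _ Rp).
  - exact: measurable_Rplus.
  - exact: measurable_slab.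
  - exact: slab_Rplus.
  apply: (integrable_Rplus (L := L) (continuous_transport_op Cc Cp2)) => p Lp.
  exact: transport_op_supp Cp2 s2 Lp.
rewrite (Rintegral_slab (fun p => u p - U p) f0).
under eq_Rintegral do rewrite mulrBl.
rewrite (RintegralB (measurable_slab L) iu iU) -!(Rintegral_slab _ f0).
have -> : \int[lebesgue_tx R n]_(p in Rp) (u p * f p) =
    \int[lebesgue_tx R n]_(p in Rp) (u p * transport_op c (wave al be) p).
  by apply: eq_Rintegral => p _; rewrite op1.
have -> : \int[lebesgue_tx R n]_(p in Rp) (U p * f p) =
    \int[lebesgue_tx R n]_(p in Rp) transport_op c (wave al h) p.
  by apply: eq_Rintegral => p _; rewrite op2'.
move: E1 E2; rewrite init; set X := \int[_]_(p in _) _; set Y := \int[_]_(p in _) _.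
by move=> /eqP; rewrite addr_eq0 => /eqP -> /eqP; rewrite addr_eq0 => /eqP ->; rewrite subrr.
Qed.

End duality.

(*@@P6f*)
Lemma natr_gt (R : realType) (x : R) : exists k : nat, x < k%:R.
Proof.
exists `|Num.ceil (`|x| + 1)|%N; rewrite natr_absz gtr0_norm.
  by rewrite (lt_le_trans _ (ceil_ge _))// ltr_pwDr// ler_norm.
by rewrite -(ltr_int R) (lt_le_trans _ (ceil_ge _))// ltr_wpDl.
Qed.

Section tx_boxes.
Context (R : realType) (n : nat).
Local Notation mR := (measurableTypeR R).
Implicit Types (a b : option 'I_n -> R).

Definition tx_box a b : set (mR * 'rV[R]_n) :=
  [set p | forall o, a o < tx_coord o (p : R * 'rV[R]_n) <= b o].

Definition tx_boxes : set (set (mR * 'rV[R]_n)) := [set tx_box ab.1 ab.2 | ab in setT].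

Lemma tx_boxesI : setI_closed tx_boxes.
Proof.
move=> _ _ [[a b] _ <-] [[a' b'] _ <-] /=.
exists (fun o => Num.max (a o) (a' o), fun o => Num.min (b o) (b' o)) => //.
apply/seteqP; split => p /=; rewrite /tx_box /=.
  move=> H; split => o; have := H o; rewrite gt_max le_min => /andP[/andP[h1 h2] /andP[h3 h4]];
    exact/andP.
move=> [H H'] o; move: (H o) (H' o) => /andP[h1 h2] /andP[h3 h4].
by rewrite gt_max le_min h1 h2 h3.
Qed.

Lemma measurable_tx_coord d (T : measurableType d) (f : T -> mR * 'rV[R]_n) :
  measurable_fun setT f <-> forall o, measurable_fun setT (fun p => tx_coord o (f p) : mR).
Proof.
split=> [mf [i|]|mf].
- have [_ m2] := (measurable_fun_pairP f).1 mf.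
  exact: (measurable_fun_coordP _).1 m2 i.
- by have [m1 _] := (measurable_fun_pairP f).1 mf.
- apply/measurable_fun_pairP; split; first exact: (mf None).
  by apply/measurable_fun_coordP => i; exact: (mf (Some i)).
Qed.

Lemma measurable_tx_box a b : measurable (tx_box a b).
Proof.
rewrite (_ : tx_box a b = \big[setI/setT]_o
    ((fun p => tx_coord o p) @^-1` `]a o, b o]%classic)).
  apply: bigsetI_measurable => o _; rewrite -[X in measurable X]setTI.
  have /measurable_tx_coord/(_ o) := @measurable_id _ (mR * 'rV[R]_n)%type setT.
  by apply => //; exact: measurable_itv.
apply/seteqP; split => p.
  by move=> H; rewrite -bigcap_seq => o _ /=; rewrite in_itv/=; exact: H.
rewrite -bigcap_seq => H o; have := H o; rewrite /= in_itv/=; apply.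
exact: mem_index_enum.
Qed.

Lemma tx_box_ball (M : R) (p : R * 'rV[R]_n) :
  tx_box (fun=> - M) (fun=> M) p -> `|p| <= M.
Proof.
move=> H; have M0 : 0 <= M by have /andP[h1 h2] := H None; lra.
rewrite prod_normE ge_max/=; apply/andP; split.
  by have /andP[h1 h2] := H None; rewrite ler_norml h2 ltW.
by apply: rV_norm_le => // i; have /andP[h1 h2] := H (Some i); rewrite ler_norml h2 ltW.
Qed.

Lemma ball_tx_box (M : R) (p : R * 'rV[R]_n) :
  `|p| < M -> tx_box (fun=> - M) (fun=> M) p.
Proof.
move=> pM o; have := le_lt_trans (tx_coord_le o p) pM.
by rewrite ltr_norml => /andP[-> /ltW ->].
Qed.

Lemma tx_boxes_generate : @measurable _ (mR * 'rV[R]_n)%type = <<s tx_boxes >>.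
Proof.
apply/seteqP; split; last first.
  apply: smallest_sub; first exact: sigma_algebra_measurable.
  by move=> _ [[a b] _ <-]; exact: measurable_tx_box.
pose T := g_sigma_algebraType tx_boxes.
suff mid : measurable_fun (setT : set T) (id : T -> mR * 'rV[R]_n).
  by move=> S mS; have := mid measurableT S mS; rewrite setTI preimage_id.
apply/measurable_tx_coord => o.
apply: (@measurability _ _ T mR setT (fun p : T => tx_coord o p) (@ocitv R) erefl).
move=> _ [_ [[x y] _ <-] <-]; rewrite setTI /=.
pose a (N : nat) o' : R := if o' == o then x else - N%:R.
pose b (N : nat) o' : R := if o' == o then y else N%:R.
rewrite (_ : _ @^-1` _ = \bigcup_N tx_box (a N) (b N)).
  apply: bigcup_measurable => N _; apply: sub_sigma_algebra.
  by exists (a N, b N).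
apply/seteqP; split => [p /=|p [N _] H] /=.
  rewrite in_itv/= => pxy; have [N pN] := natr_gt `|p : R * 'rV[R]_n|.
  exists N => // o'; rewrite /a /b; case: eqP => [-> //|_].
  exact: (ball_tx_box pN o').
by have := H o; rewrite /a /b eqxx in_itv.
Qed.

End tx_boxes.

(*@@P6g*)
Lemma Ck1_coord (R : realType) n (i : 'I_n) : Ck 1 (fun z : 'rV[R]_n => z ord0 i).
Proof.
apply: (Ck1_row (F := id)); split=> [z|w]; first exact: ex_diff.
rewrite (_ : (fun z => _) = fun=> w); first exact: cst_continuous.
apply/funext => z; have [_ H] := is_diff_id z; exact: (congr1 (fun h => h w) H).
Qed.

Lemma integrable_continuous_slab (R : realType) n (f : R * 'rV[R]_n -> R) L :
  continuous f -> (lebesgue_tx R n).-integrable (slab L) (EFin \o f).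
Proof.
move=> cf; have [C C0 HC] := compact_bound (@compact_tx_ball R n L) cf.
apply/(integrable_mkcond _ (measurable_slab L)); rewrite restrict_EFin.
apply: integrable_tx.
  apply: (measurable_restrictT _ (measurable_slab L)).1; apply: measurable_funTS.
  exact: continuous_measurable_tx.
exists (Num.max C L); first by rewrite le_max ltW.
move=> p; rewrite patchE; case: ifPn => [/set_mem [_ pL]|_].
  split; first by rewrite le_max HC.
  by rewrite gt_max => /andP[_]; rewrite ltNge pL.
by rewrite normr0 le_max ltW.
Qed.

Section representation.
Context (R : realType) (n : nat).
Variables (c : 'rV[R]_n -> 'rV[R]_n) (sg : 'rV[R]_n -> R).
Variables (psi : 'I_n -> 'rV[R]_n -> R) (k0 : 'I_n) (W : 'rV[R]_n -> 'rV[R]_n).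
Variables (u0 : 'rV[R]_n -> R) (u : R * 'rV[R]_n -> R).
Hypothesis Cc : Ck 1 c.
Hypothesis Csg : Ck 1 sg.
Hypothesis Cpsi : forall j, Ck 1 (psi j).
Hypothesis div_sc : forall x, 'd sg x (c x) + sg x * divc c x = 0.
Hypothesis psi_c : forall j x, 'd (psi j) x (c x) = (j == k0)%:R.
Hypothesis CW : forall i, Ck 1 (fun y => W y ord0 i).
Hypothesis psiK : forall x, W (\row_j psi j x) = x.
Hypothesis Cu0 : Ck 1 u0.
Hypothesis u_sol : transport_solution c u0 u.
Local Notation Rp := (@Rplus_rV R n).
Local Notation mR := (measurableTypeR R).
Local Notation charact := (charact psi k0).
Local Notation tx := (lebesgue_tx R n).

Let excess (p : R * 'rV[R]_n) : R := (u p - u0 (W (charact p))) * sg p.2.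
Let flow (p : R * 'rV[R]_n) : R * 'rV[R]_n := (p.1, charact p).

Lemma continuous_pulled : continuous (fun p => u0 (W (charact p))).
Proof.
apply: (continuous_comp_app (f := charact) (g := fun z => u0 (W z))).
  exact: (continuous_charact Cpsi).
exact: (Ck1_continuous (Ck1_comp CW Cu0)).
Qed.

Let continuous_flow : continuous flow.
Proof.
apply: continuous_pair; first by move=> p; exact: cvg_fst.
exact: (continuous_charact Cpsi).
Qed.

Let measurable_flow : measurable_fun setT (flow : mR * 'rV[R]_n -> mR * 'rV[R]_n).
Proof.
apply/measurable_tx_coord => o; apply: continuous_measurable_tx.
by case: o => [i|] /=; [exact: Ck1_continuous (Ck1_charact k0 Cpsi i).1|move=> p; exact: cvg_fst].
Qed.

Let integrable_excess L : tx.-integrable (slab L) (EFin \o excess).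
Proof.
have csg : continuous (fun p : R * 'rV[R]_n => sg p.2).
  exact: continuous_snd_comp (Ck1_continuous Csg).
have iu := integrable_slabM u_sol L csg.
have cU : continuous (fun p => u0 (W (charact p)) * sg p.2).
  exact: continuous_mul continuous_pulled csg.
have iU : tx.-integrable (slab L) (EFin \o (fun p => u0 (W (charact p)) * sg p.2)).
  exact: integrable_continuous_slab.
apply: (eq_integrable (measurable_slab L) _ _ _ (integrableB (measurable_slab L) iu iU)) => p _.
by rewrite /= -EFinB -mulrBl.
Qed.


Lemma cvg_prod_seq (I : Type) (r : seq I) (F : nat -> I -> R) (l : I -> R) :
  (forall i, F j i @[j --> \oo] --> l i) ->
  \prod_(i <- r) F j i @[j --> \oo] --> \prod_(i <- r) l i.
Proof.
move=> Fl; elim: r => [|i r IH].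
  rewrite big_nil (_ : (fun j => _) = fun=> 1); first exact: cvg_cst.
  by apply/funext => j; rewrite big_nil.
rewrite big_cons (_ : (fun j => _) = fun j => F j i * \prod_(i <- r) F j i).
  exact: cvgM (Fl i) IH.
by apply/funext => j; rewrite big_cons.
Qed.

Lemma prod_option (F : option 'I_n -> R) : \prod_o F o = F None * \prod_i F (Some i).
Proof.
rewrite (bigD1 None)//= (reindex_omap Some id)/=; last by case.
by congr (_ * _); apply: eq_bigl => i /=; rewrite eqxx.
Qed.

Lemma flow_box_zero a b :
  (\int[tx]_(p in Rp `&` flow @^-1` tx_box a b) (excess p)%:E = 0)%E.
Proof.
have [ab|/existsNP [i /negP]] := pselect (forall o, a o <= b o); last first.
  rewrite -ltNge => ba; rewrite (_ : _ `&` _ = set0) ?integral_set0//.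
  apply/seteqP; split => // p [_ /(_ i)/andP[h1 h2]].
  by have := lt_trans ba (lt_le_trans h1 h2); rewrite ltxx.
pose A := 2 + \sum_o (`|a o| + `|b o|).
have sA o : `|a o| + `|b o| + 2 <= A.
  rewrite /A addrC lerD2l (bigD1 o)//= lerDl sumr_ge0// => i _; rewrite addr_ge0.
have [L HL] := charact_bound k0 CW psiK A A.
pose al j := plateau_prim j.+1%:R (a None) (b None).
pose be j (z : 'rV[R]_n) := \prod_i plateau j.+1%:R (a (Some i)) (b (Some i)) (z ord0 i).
pose P j p := \prod_o plateau j.+1%:R (a o) (b o) (tx_coord o (flow p)).
have k1 j : 1 <= j.+1%:R :> R by rewrite ler1n.
have Cal j : Ck 1 (al j) := (plateau_primP (a None) (b None) (k1 j)).1.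
have dal j (t : R) : 0 <= t -> 'd (al j) t 1 = plateau j.+1%:R (a None) (b None) t.
  exact: (plateau_primP (a None) (b None) (k1 j)).2.
have ga o : `|a o| + `|b o| + 2 <= A /\ - `|a o| <= a o /\ b o <= `|b o|.
  by split; [exact: sA|rewrite ler_norm lerNl -normrN ler_norm].
have far o (s : R) : A < `|s| -> s <= - 2 /\ s <= a o \/ b o + 1 <= s.
  have [h1 [h2 h3]] := ga o; have h4 := normr_ge0 (a o); have h5 := normr_ge0 (b o).
  case: (lerP 0 s) => s0; [rewrite ger0_norm// => h6; right|rewrite ltr0_norm// => h6; left; split];
    lra.
have al0 j (t : R) : A < `|t| -> al j t = 0.
  by move=> /(far None) tA; apply: plateau_prim0 => //; case: tA => [[]|]; [left|right].
have be0 j (z : 'rV[R]_n) : A < `|z| -> be j z = 0.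
  move=> zA; have [i zi] : exists i, A < `|z ord0 i|.
    apply: contrapT => H; move: zA; apply/negP; rewrite -leNgt; apply: rV_norm_le.
      by have [h1 [h2 h3]] := ga None; have := normr_ge0 (a None); have := normr_ge0 (b None); lra.
    by move=> i; rewrite leNgt; apply/negP => zi; apply: H; exists i.
  rewrite /be (bigD1 i)//= plateau0 ?mul0r//.
  by case: (far (Some i) _ zi) => [[_]|]; [left|right].
have Cbe j : Ck 1 (be j).
  apply: Ck1_prod => i.
  exact: (Ck1_comp_real (Ck1_coord R i) (Ck1_plateau _ _ _)).1.
pose f j p := sg p.2 * 'd (al j) (p.1) 1 * be j (charact p).
have f0 j (p : R * 'rV[R]_n) : L < `|p| -> f j p = 0.
  move=> Lp; apply: (@wave_supp R n sg psi k0 (fun t => 'd (al j) t 1) (be j) A A L HL) => //.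
    by move=> t tA; exact: (diff_out_support (1 : R) ((Cal j).1 t) (al0 j) tA).
  exact: be0.
have I0 : forall j, \int[tx]_(p in slab L) (excess p * P j p) = 0.
  move=> j.
  rewrite -(duality Cc Csg Cpsi div_sc psi_c CW psiK Cu0 u_sol (Cal j) (Cbe j) (al0 j) (be0 j)).
  rewrite (Rintegral_slab (fun p => u p - u0 (W (charact p))) (f0 j)).
  apply: eq_Rintegral => p /set_mem [p0 _]; rewrite /excess -mulrA; congr (_ * _).
  by rewrite /f dal// /P prod_option/= mulrA.
have cP j : continuous (P j).
  rewrite (_ : P j = fun p => plateau j.+1%:R (a None) (b None) p.1 * be j (charact p)).
    apply: continuous_mul.
      apply: (continuous_comp_app (f := fun p : R * 'rV[R]_n => p.1)
        (g := plateau j.+1%:R (a None) (b None))); last exact: continuous_plateau.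
      by move=> p; exact: cvg_fst.
    apply: (continuous_comp_app (f := charact) (g := be j)).
      exact: (continuous_charact Cpsi).
    exact: (Ck1_continuous (Cbe j)).
  by apply/funext => p; rewrite /P prod_option.
have P1 j p : `|P j p| <= 1.
  rewrite /P; elim/big_ind : _ => [|x y x1 y1|o _]; rewrite ?normr1//; last exact: plateau_le1.
  by rewrite normrM mulr_ile1.
have iF j : tx.-integrable (slab L) (fun p => (excess p * P j p)%:E).
  have mP : measurable_fun (slab L) (P j : mR * 'rV[R]_n -> mR).
    by apply: measurable_funTS; exact: continuous_measurable_tx.
  have bP : [bounded P j x | x in slab L].
    exists 1; split; first exact: num_real.
    by move=> y Cy x _; exact: le_trans (P1 j x) (ltW Cy).
  exact: (eq_integrable (measurable_slab L) _ _ (fun x _ => erefl)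
    (integrableMl (measurable_slab L) (integrable_excess L) mP bP)).
pose ind p : R := \prod_o (a o < tx_coord o (flow p) <= b o)%R%:R.
have indT p : tx_box a b (flow p) -> ind p = 1.
  by move=> Hp; apply: big1 => o _; rewrite Hp.
have indF p : ~ tx_box a b (flow p) -> ind p = 0.
  move=> /existsNP [i /negP/negbTE Hi]; rewrite /ind (bigD1 i)//= Hi mul0r.
  by [].
have cF p : (excess p * P j p)%:E @[j --> \oo] --> (excess p * ind p)%:E.
  apply: cvg_EFin; first exact: nearW.
  apply: cvgMr; apply: cvg_prod_seq => o; exact: cvg_plateau (ab o).
have mG : measurable_fun (slab L) (fun p => (excess p * ind p)%:E).
  apply: (emeasurable_fun_cvg (fun j p => (excess p * P j p)%:E)).
    by move=> j; exact: measurable_int (iF j).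
  by move=> p _; exact: cF.
have [||iG _] := dominated_convergence (measurable_slab L)
    (fun j => measurable_int _ (iF j)) mG _ (integrable_abse (integrable_excess L)) _.
- by apply: aeW => p _; exact: cF.
- apply: aeW => p j _ /=; rewrite lee_fin normrM ler_piMr//.
rewrite (_ : [sequence _]_j = fun=> 0%E); last first.
  apply/funext => j /=; rewrite -[LHS]fineK ?integrable_fin_num//; last exact: measurable_slab.
  by rewrite -[fine _]/(\int[tx]_(p in slab L) (excess p * P j p)) I0.
move=> h; have G0 := cvg_lim (@ereal_hausdorff R) h.
rewrite lim_cst// in G0.
transitivity (\int[tx]_(p in slab L) (excess p * ind p)%:E)%E; last by rewrite -G0.
rewrite integral_mkcond [RHS]integral_mkcond; apply: eq_integral => p _.
rewrite !patchE; case: ifPn => [/set_mem [p0 pab]|/negP pab].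
  have cA o : `|tx_coord o (flow p)| <= A.
    have [h1 [h2 h3]] := ga o; have /andP[h4 h5] := pab o.
    have h6 := normr_ge0 (a o); have h7 := normr_ge0 (b o).
    by rewrite ler_norml; apply/andP; split; lra.
  rewrite indT// mulr1 ifT//; apply/mem_set; split => //; apply: HL; first exact: (cA None).
  apply: rV_norm_le => [|i]; last exact: (cA (Some i)).
  exact: le_trans (normr_ge0 _) (cA None).
case: ifPn => // /set_mem [p0 pL]; rewrite indF ?mulr0// => pab'.
by apply: pab; apply/mem_set.
Qed.

Let pull (z : R * 'rV[R]_n) : R * 'rV[R]_n := (z.1, W (z.2 - z.1 *: delta_mx ord0 k0)).

Let flowK p : pull (flow p) = p.
Proof. by rewrite /pull /flow /= (charactK k0 psiK) -surjective_pairing. Qed.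

Let measurable_pull : measurable_fun setT (pull : mR * 'rV[R]_n -> mR * 'rV[R]_n).
Proof.
apply/measurable_tx_coord => o; apply: continuous_measurable_tx.
case: o => [i|] /=; last by move=> p; exact: cvg_fst.
apply: (continuous_comp_app (f := fun z : R * 'rV[R]_n => z.2 - z.1 *: delta_mx ord0 k0)
  (g := fun y => W y ord0 i)); last exact: Ck1_continuous (CW i).
apply: continuous_sub; first by move=> p; exact: cvg_snd.
apply: continuous_scale; first by move=> p; exact: cvg_fst.
exact: cst_continuous.
Qed.

Let cell (M : R) := Rp `&` flow @^-1` tx_box (fun=> - M) (fun=> M).

Let measurable_preflow (S : set (mR * 'rV[R]_n)) : measurable S -> measurable (flow @^-1` S).
Proof. by move=> mS; rewrite -[X in measurable X]setTI; exact: measurable_flow. Qed.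

Let measurable_cell M : measurable (cell M).
Proof.
apply: measurableI; first exact: measurable_Rplus.
by apply: measurable_preflow; exact: measurable_tx_box.
Qed.

Let integrable_cell M : tx.-integrable (cell M) (EFin \o excess).
Proof.
have [L HL] := charact_bound k0 CW psiK M M.
apply: integrableS (integrable_excess L).
- exact: measurable_slab.
- exact: measurable_cell.
move=> p [p0 /tx_box_ball pM]; split => //; apply: HL; apply: le_trans pM.
  by rewrite prod_normE/= le_max lexx.
by rewrite prod_normE/= le_max lexx orbT.
Qed.

Let cell_zero M (S : set (mR * 'rV[R]_n)) : measurable S -> (\int[tx]_(p in cell M `&` flow @^-1` S) (excess p)%:E = 0)%E.
Proof.
move=> mS; have {mS} : <<s @tx_boxes R n >> S by rewrite -tx_boxes_generate.
have mI (S' : set (mR * 'rV[R]_n)) : measurable S' -> measurable (cell M `&` flow @^-1` S').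
  by move=> mS'; apply: measurableI; [exact: measurable_cell|exact: measurable_preflow].
apply: (@dynkin_induction _ _ (@tx_boxes R n)
  (fun S => \int[tx]_(p in cell M `&` flow @^-1` S) (excess p)%:E = 0)%E).
- exact: tx_boxes_generate.
- exact: tx_boxesI.
- by rewrite preimage_setT setIT; exact: flow_box_zero.
- move=> B HB; rewrite /cell -setIA -preimage_setI.
  have [[a b] _ <-] : tx_boxes (tx_box (fun=> - M) (fun=> M) `&` B).
    by apply: tx_boxesI => //; exists (fun=> - M, fun=> M).
  exact: flow_box_zero.
- move=> S' mS' IH.
  have mC : measurable (~` S') by exact: measurableC.
  have E : cell M = (cell M `&` flow @^-1` S') `|` (cell M `&` flow @^-1` (~` S')).
    by rewrite -setIUr -preimage_setU setUv preimage_setT setIT.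
  have := flow_box_zero (fun=> - M) (fun=> M); rewrite -/(cell M) {1}E.
  rewrite integral_setU ?IH ?add0e//.
  - exact: mI.
  - exact: mI.
  - rewrite -E; exact: measurable_int (integrable_cell M).
  - apply/disj_set2P; rewrite -setIIr -preimage_setI setICr preimage_set0 setI0.
    by [].
- move=> F mF tF IH; rewrite preimage_bigcup setI_bigcupr integral_bigcup.
  - by rewrite eseries0// => i _ _; exact: IH.
  - by move=> i j _ _ [p [[_ h1] [_ h2]]]; apply: (tF i j I I); exists (flow p).
  - by move=> k; exact: mI.
  rewrite -setI_bigcupr -preimage_bigcup; apply: (integrableS (measurable_cell M)).
  - by apply: mI; exact: bigcup_measurable.
  - by move=> p [].
  - exact: integrable_cell.
Qed.

(** Uniqueness of the weak solution, in the form of its representation along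
    the characteristics. *)
Lemma weak_representation : (forall x, sg x != 0) ->
  {ae tx, forall p, Rp p -> u p = u0 (W (charact p))}.
Proof.
move=> sg0.
have H (k : nat) : ae_eq tx (cell k%:R) (EFin \o excess) (cst 0%E).
  apply: integral_ae_eq.
  - exact: measurable_cell.
  - exact: integrable_cell.
  - exact: measurable_cst.
  move=> E EZ mE; rewrite integral0.
  have -> : E = cell k%:R `&` flow @^-1` (pull @^-1` E).
    apply/seteqP; split => [p Ep|p [_]] /=; last by rewrite flowK.
    by split; [exact: EZ|rewrite flowK].
  apply: cell_zero; rewrite -[X in measurable X]setTI; exact: measurable_pull.
apply: filterS (ae_foralln H) => p Hp p0.
have [k kp] := natr_gt `|flow p|.
have /eqP := Hp k (conj p0 (ball_tx_box kp)).
by rewrite /= eqe /excess mulf_eq0 (negbTE (sg0 _)) orbF subr_eq0 => /eqP.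
Qed.
End representation.

(*@@P7a*)
Section clebsch.
Context (R : realType) (n : nat).
Local Notation dx i := (delta_mx ord0 i : 'rV[R]_n.+2).

Lemma dotv_cof m k (g : 'I_m -> 'rV[R]_m -> R) (w x : 'rV[R]_m) :
  dotv w (cof g k x) = detr (set_row (jac g x) k w).
Proof. by rewrite [in RHS](row_sum_delta w) detr_sum; apply: eq_bigr => i _; rewrite mxE. Qed.

Lemma set_rowC m j k (w : 'I_m -> 'rV[R]_m) :
  detr (set_row w k (w j)) = (j == k)%:R * detr w.
Proof.
have [->|jk] := eqVneq j k; first by rewrite set_row_id mul1r.
rewrite mul0r; apply: (detr_alternate jk).
by rewrite /set_row eqxx (negbTE jk).
Qed.

Lemma gradient_product_cof (v : 'I_n.+2 -> 'rV[R]_n.+2 -> R) x : gradient_product v x = cof v ord0 x.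
Proof.
case: n v x => [|k] v x.
  apply/rowP => i; rewrite /gradient_product /cof !mxE !big_ord_recl big_ord0.
  rewrite /detr (expand_det_row _ ord0) !big_ord_recl big_ord0 /cofactor !det_mx11 !mxE /set_row /=.
  have -> : lift (lift ord0 ord0) (0 : 'I_1) = ord0 :> 'I_2 by apply/val_inj.
  have -> : lift ord0 (0 : 'I_1) = lift ord0 ord0 :> 'I_2 by apply/val_inj.
  set D0 := 'D_(delta_mx ord0 ord0) _ _; set D1 := 'D_(delta_mx ord0 (lift ord0 ord0)) _ _.
  case: (unliftP ord0 i) => [j|] ->; rewrite ?(ord1 j) /=; ring.
apply/rowP => i; rewrite /gradient_product /cross_product /cof !mxE /det_rows /detr.
congr (\det _); apply/matrixP => a c; rewrite !mxE; case: splitP => a' Ea.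
  have -> : a = ord0 by apply/val_inj; rewrite /= Ea (ord1 a').
  by rewrite /set_row eqxx (ord1 a').
have -> : a = lift ord0 a' by apply/val_inj; rewrite /= Ea.
by rewrite /set_row /= !mxE.
Qed.

Variables (b : 'rV[R]_n.+2 -> 'rV[R]_n.+2) (sigma : 'rV[R]_n.+2 -> R).
Variable v : 'I_n.+2 -> 'rV[R]_n.+2 -> R.
Hypothesis b_C1 : Ck 1 b.
Hypothesis b_per : Yd_periodic b.
Hypothesis sigma_per : Yd_periodic sigma.
Hypothesis sigma_gt0 : forall x, 0 < sigma x.
Hypothesis Pv : periodic_C2 v.
Hypothesis b_v1 : forall x, Yd x -> dotv (b x) (grad (v ord0) x) = 1.
Hypothesis sigma_b : forall x, Yd x -> sigma x *: b x = gradient_product v x.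

Lemma sigma_b_cof x : sigma x *: b x = cof v ord0 x.
Proof.
have [k Yx] := frac_part x.
by rewrite -(sigma_per x k) -(b_per x k) -(cof_periodic ord0 Pv x k) sigma_b// gradient_product_cof.
Qed.

Lemma dotvZl (a : R) (x y : 'rV[R]_n.+2) : dotv (a *: x) y = a * dotv x y.
Proof. by rewrite /dotv mulr_sumr; apply: eq_bigr => i _; rewrite mxE mulrA. Qed.

Lemma dotvC (x y : 'rV[R]_n.+2) : dotv x y = dotv y x.
Proof. by apply: eq_bigr => i _; rewrite mulrC. Qed.

Lemma sigma_b_grad x j : sigma x * dotv (b x) (grad (v j) x) = (j == ord0)%:R * detr (jac v x).
Proof. by rewrite -dotvZl sigma_b_cof dotvC dotv_cof -[grad _ _]/(jac v x j) set_rowC. Qed.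

Lemma sigma_det x : sigma x = detr (jac v x).
Proof.
have [k Yx] := frac_part x.
have := sigma_b_grad x ord0.
by rewrite -(b_per x k) -((Pv ord0).2 x k) b_v1// eqxx mul1r mulr1.
Qed.

Lemma b_grad j x : 'd (v j) x (b x) = (j == ord0)%:R.
Proof.
apply: (etrans (diff_grad _ ((Pv j).1.1 x))).
apply: (mulfI (lt0r_neq0 (sigma_gt0 x))).
by rewrite sigma_b_grad -sigma_det mulrC.
Qed.

Lemma Ck1_sigma : Ck 1 sigma.
Proof.
rewrite (_ : sigma = fun x => detr (jac v x)); last by apply/funext => x; exact: sigma_det.
by apply: (@Ck1_detr _ _ _ (fun j x => jac v x j)) => i j; exact: Ck1_grad (Pv i).1.
Qed.

Lemma div_sigma_b x : 'd sigma x (b x) + sigma x * divc b x = 0.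
Proof.
rewrite -(div_cof ord0 x (fun j => (Pv j).1)) diff_rVE /divc mulr_sumr -big_split/=.
apply: eq_bigr => i _; rewrite (_ : (fun y => cof v ord0 y ord0 i) = fun y => sigma y * b y ord0 i).
  have D := diffM_app (dx i) (Ck1_sigma.1 x) ((Ck1_row b_C1 i).1 x).
  exact: (etrans (addrC _ _) (esym D)).
by apply/funext => y; rewrite -sigma_b_cof mxE.
Qed.

Let P j := periods (v j).

Lemma mean_sigma : mean sigma = detr P.
Proof. by rewrite -mean_det//; congr mean; apply/funext => x; exact: sigma_det. Qed.

Lemma mean_sigma_gt0 : 0 < mean sigma.
Proof. exact: mean_gt0 (Ck1_continuous Ck1_sigma) sigma_gt0. Qed.

Definition drift := (mean sigma)^-1 *: meanv (fun x => sigma x *: b x).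

Lemma drift_periods j : dotv drift (periods (v j)) = (j == ord0)%:R.
Proof.
rewrite -[periods _]/(P j) dotvZl dotvC; have -> : meanv (fun x => sigma x *: b x) =
    \row_i detr (set_row P ord0 (dx i)).
  apply/rowP => i; rewrite !mxE -mean_cof//; congr mean; apply/funext => x.
  by rewrite sigma_b_cof.
have -> : dotv (P j) (\row_i detr (set_row P ord0 (dx i))) = detr (set_row P ord0 (P j)).
  by rewrite [in RHS](row_sum_delta (P j)) detr_sum; apply: eq_bigr => i _; rewrite mxE.
rewrite set_rowC -mean_sigma mulrCA mulVf ?mulr1//.
exact: lt0r_neq0 mean_sigma_gt0.
Qed.

End clebsch.

(*@@P7b*)
Section dilation.
Context (R : realType) (E F : normedModType R).

Lemma diff_dilate (f : E -> F) (a : R) (x : E) : differentiable f (a *: x) ->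
  differentiable (fun y => f (a *: y)) x /\
  forall v, 'd (fun y => f (a *: y)) x v = a *: 'd f (a *: x) v.
Proof.
move=> df; have d1 : is_diff x (fun y : E => a *: y) (a \*: id) := is_diffZ a (is_diff_id x).
have [d2 E2] := is_diff_comp d1 (differentiableP df).
split => // v; rewrite -linearZ; exact: (congr1 (fun h => h v) E2).
Qed.

Lemma Ck1_dilate (f : E -> F) (a : R) : Ck 1 f -> Ck 1 (fun y => f (a *: y)).
Proof.
move=> Cf; split=> [x|v]; first exact: (diff_dilate (Cf.1 _)).1.
rewrite (_ : (fun x => _) = fun x => a *: 'd f (a *: x) v); last first.
  by apply/funext => x; exact: (diff_dilate (Cf.1 _)).2.
apply: continuous_scale; first exact: cst_continuous.
apply: (continuous_comp_app (f := fun x : E => a *: x) (g := fun x => 'd f x v)).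
  by apply: continuous_scale; [exact: cst_continuous|exact: continuous_id].
exact: Cf.2.
Qed.

End dilation.

Section homogenization.
Context (R : realType) (n : nat).
Variables (b : 'rV[R]_n.+2 -> 'rV[R]_n.+2) (sigma : 'rV[R]_n.+2 -> R).
Variable v : 'I_n.+2 -> 'rV[R]_n.+2 -> R.
Hypothesis b_C1 : Ck 1 b.
Hypothesis b_per : Yd_periodic b.
Hypothesis sigma_per : Yd_periodic sigma.
Hypothesis sigma_gt0 : forall x, 0 < sigma x.
Hypothesis Pv : periodic_C2 v.
Hypothesis b_v1 : forall x, Yd x -> dotv (b x) (grad (v ord0) x) = 1.
Hypothesis sigma_b : forall x, Yd x -> sigma x *: b x = gradient_product v x.
Variable W : 'rV[R]_n.+2 -> 'rV[R]_n.+2.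
Hypotheses (VK : cancel (rmap v) W) (WK : cancel W (rmap v)).
Variables (u0 : 'rV[R]_n.+2 -> R).
Hypothesis Cu0 : Ck 1 u0.
Local Notation dx i := (delta_mx ord0 i : 'rV[R]_n.+2).

Definition cell_coord (e : R) j (x : 'rV[R]_n.+2) : R := e * v j (e^-1 *: x).

(** The position at time [t] on the characteristic through [x]. *)
Definition trajectory (e : R) (p : R * 'rV[R]_n.+2) : 'rV[R]_n.+2 :=
  e *: W (e^-1 *: charact (cell_coord e) ord0 p).

Let sgE := sigma_det b_per sigma_per Pv b_v1 sigma_b.
Let det_neq0 x : detr (jac v x) != 0.
Proof. by rewrite -sgE; exact: lt0r_neq0. Qed.
Let CW i : Ck 1 (fun y => W y ord0 i) := Ck1_inv Pv det_neq0 VK WK i.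

Section scale.
Variable e : R.
Hypothesis e0 : 0 < e.
Let en0 : e != 0. Proof. exact: lt0r_neq0. Qed.

Let Cc : Ck 1 (fun x => b (e^-1 *: x)). Proof. exact: Ck1_dilate. Qed.

Let Csg : Ck 1 (fun x => sigma (e^-1 *: x)).
Proof. exact: (Ck1_dilate _ (Ck1_sigma b_per sigma_per Pv b_v1 sigma_b)). Qed.

Let Cpsi j : Ck 1 (cell_coord e j).
Proof.
have C1 : Ck 1 (fun x => v j (e^-1 *: x)) := Ck1_dilate _ (Ck2_Ck1 (Pv j).1).
exact: (Ck1M (Ck1_cst _ e) C1).
Qed.

Let psi_c j x : 'd (cell_coord e j) x (b (e^-1 *: x)) = (j == ord0)%:R.
Proof.
have C1 : Ck 1 (fun x => v j (e^-1 *: x)) := Ck1_dilate _ (Ck2_Ck1 (Pv j).1).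
have D := diffM_app (b (e^-1 *: x)) ((Ck1_cst _ e).1 x) (C1.1 x).
apply: (etrans D); rewrite diff_cst_app mulr0 addr0.
have H := (diff_dilate ((Ck2_Ck1 (Pv j).1).1 (e^-1 *: x))).2 (b (e^-1 *: x)).
apply: (etrans (congr1 (fun r => e * r) H)).
rewrite (b_grad b_per sigma_per sigma_gt0 Pv b_v1 sigma_b).
by rewrite /GRing.scale/= mulrA divff// mul1r.
Qed.

Let div_sc x : 'd (fun x => sigma (e^-1 *: x)) x (b (e^-1 *: x)) +
  sigma (e^-1 *: x) * divc (fun x => b (e^-1 *: x)) x = 0.
Proof.
have Cs := Ck1_sigma b_per sigma_per Pv b_v1 sigma_b.
have -> : divc (fun x => b (e^-1 *: x)) x = e^-1 * divc b (e^-1 *: x).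
  rewrite /divc mulr_sumr; apply: eq_bigr => i _.
  exact: ((diff_dilate ((Ck1_row b_C1 i).1 (e^-1 *: x))).2 (dx i)).
have H := (diff_dilate (Cs.1 (e^-1 *: x))).2 (b (e^-1 *: x)).
apply: (etrans (congr1 (fun r => r + _) H)).
rewrite mulrCA -mulrDr (div_sigma_b b_C1 b_per sigma_per Pv b_v1 sigma_b).
by rewrite mulr0.
Qed.

Let CWe i : Ck 1 (fun y => (e *: W (e^-1 *: y)) ord0 i).
Proof.
rewrite (_ : (fun y => _) = fun y => e * W (e^-1 *: y) ord0 i).
  have C1 : Ck 1 (fun y => W (e^-1 *: y) ord0 i) := Ck1_dilate _ (CW i).
  exact: (Ck1M (Ck1_cst _ e) C1).
by apply/funext => y; rewrite mxE.
Qed.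

Let psiK x : e *: W (e^-1 *: \row_j cell_coord e j x) = x.
Proof.
have -> : e^-1 *: \row_j cell_coord e j x = rmap v (e^-1 *: x).
  by apply/rowP => j; rewrite !mxE /cell_coord mulKf.
by rewrite VK scalerA divff// scale1r.
Qed.

Lemma continuous_trajectory : continuous (fun p => u0 (trajectory e p)).
Proof. exact: (continuous_pulled Cpsi CWe Cu0). Qed.

Lemma trajectory_solution (u : R * 'rV[R]_n.+2 -> R) :
  transport_solution (fun x => b (e^-1 *: x)) u0 u ->
  {ae lebesgue_tx R n.+2, forall p, Rplus_rV p -> u p = u0 (trajectory e p)}.
Proof.
move=> u_sol.
apply: (weak_representation Cc Csg Cpsi div_sc psi_c CWe psiK Cu0 u_sol) => x.
exact: lt0r_neq0.
Qed.

End scale.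
End homogenization.

(*@@P7c*)
(** An invertible linear map is bounded below. *)
Lemma detr_lower_bound (R : realType) m (P : 'I_m -> 'rV[R]_m) : detr P != 0 ->
  exists2 C, 0 < C & forall (h : 'rV[R]_m) B, 0 <= B ->
    (forall j, `|dotv h (P j)| <= B) -> `|h| <= C * B.
Proof.
move=> P0; pose g j := fun z : 'rV[R]_m => dotv z (P j).
have Pg : periodic_C2 g.
  by move=> j; split; [exact: Ck2_dotv|move=> x z; rewrite !grad_dotv].
have g0 x : detr (jac g x) != 0.
  rewrite (_ : jac g x = P)//; apply/funext => j; exact: grad_dotv.
have [C C0 HC] := inv_col_bound Pg g0.
exists (m.+1%:R * C); first by rewrite mulr_gt0.
move=> h B B0 hB; apply: rV_norm_le => [|i]; first by rewrite !mulr_ge0// ltW.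
rewrite -(inv_colP Pg g0 i 0 h) (le_trans (dotv_norm _ (HC i 0)))//.
have m1 : m%:R <= m.+1%:R :> R by rewrite ler_nat.
apply: ler_pM => //; first by rewrite mulr_ge0// ltW.
  by rewrite ler_wpM2r// ltW.
apply: rV_norm_le => // j; rewrite mxE (diff_dotv (P j) 0 h).2; exact: hB.
Qed.

Lemma periodic_bound (R : realType) m (p : 'rV[R]_m -> R) :
  continuous p -> Yd_periodic p -> exists2 B, 0 < B & forall x, `|p x| <= B.
Proof.
move=> cp pp; have [B B0 HB] := compact_bound (@compact_rV_ball R m 1) cp.
exists B => // x; have [k Yx] := frac_part x; rewrite -(pp x k); apply: HB.
exact: Yd_norm.
Qed.

Section limit.
Context (R : realType) (n : nat).
Variables (b : 'rV[R]_n.+2 -> 'rV[R]_n.+2) (sigma : 'rV[R]_n.+2 -> R).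
Variable v : 'I_n.+2 -> 'rV[R]_n.+2 -> R.
Hypothesis b_C1 : Ck 1 b.
Hypothesis b_per : Yd_periodic b.
Hypothesis sigma_per : Yd_periodic sigma.
Hypothesis sigma_gt0 : forall x, 0 < sigma x.
Hypothesis Pv : periodic_C2 v.
Hypothesis b_v1 : forall x, Yd x -> dotv (b x) (grad (v ord0) x) = 1.
Hypothesis sigma_b : forall x, Yd x -> sigma x *: b x = gradient_product v x.
Variable W : 'rV[R]_n.+2 -> 'rV[R]_n.+2.
Hypotheses (VK : cancel (rmap v) W) (WK : cancel W (rmap v)).

(** In the coordinates [v], the trajectory moves at unit speed along the first
    axis; each [v j] is linear up to a bounded function. *)
Lemma trajectory_drift : exists2 C, 0 < C & forall e p, 0 < e ->
  `|trajectory v W e p - (p.2 + p.1 *: drift b sigma)| <= C * e.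
Proof.
have := drift_periods b_per sigma_per sigma_gt0 Pv b_v1 sigma_b.
move: (drift b sigma) => xi xiP.
pose P j := periods (v j).
have P0 : detr P != 0.
  rewrite -(mean_sigma b_per sigma_per Pv b_v1 sigma_b); apply: lt0r_neq0.
  exact: (mean_sigma_gt0 b_per sigma_per sigma_gt0 Pv b_v1 sigma_b).
have [C C0 HC] := detr_lower_bound P0.
pose q j x := v j x - dotv x (P j).
have /choice[B HB] : forall j, exists B, 0 < B /\ forall x, `|q j x| <= B.
  move=> j.
  have [C1q pq _] := periodic_part (Pv j).1 (Pv j).2.
  by have [B B0 HB] := periodic_bound (Ck1_continuous C1q) pq; exists B.
pose D := \sum_j B j.
have BD j : B j <= D.
  by rewrite /D (bigD1 j)//= lerDl sumr_ge0// => i _; exact: ltW (HB i).1.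
have D0 : 0 < D := lt_le_trans (HB ord0).1 (BD ord0).
exists (C * (2 * D)); first by rewrite !mulr_gt0.
move=> e [t x] e0 /=; have en0 := lt0r_neq0 e0.
pose y := W (e^-1 *: charact (cell_coord v e) ord0 (t, x)).
pose h := y - e^-1 *: x - (e^-1 * t) *: xi.
have -> : trajectory v W e (t, x) - (x + t *: xi) = e *: h.
  rewrite /h !scalerBr !scalerA mulrA divff// scale1r mul1r /trajectory -/y.
  by rewrite opprD addrA.
rewrite normrZ gtr0_norm// mulrC ler_wpM2r//; first exact: ltW.
apply: HC => [|j]; first by rewrite mulr_ge0// ltW.
have vy : v j y = v j (e^-1 *: x) + e^-1 * t * (j == ord0)%:R.
  have := congr1 (fun z : 'rV_n.+2 => z ord0 j) (WK (e^-1 *: charact (cell_coord v e) ord0 (t, x))).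
  rewrite -/y !mxE => ->; rewrite mulrDr /cell_coord mulKf// mulrA.
  by [].
have -> : dotv h (P j) = q j (e^-1 *: x) - q j y.
  rewrite /q /P vy /h !dotvB !dotvZl xiP.
  ring.
rewrite (le_trans (ler_normB _ _))// mulr_natl mulr2n lerD// (le_trans _ (BD j))//.
  exact: (HB j).2.
exact: (HB j).2.
Qed.

End limit.

(*@@P7d*)
(* The dimension is d = n.+2, and v ord0 is v_1. *)
Theorem corollary4p4 (R : realType) (n : nat)
  (b : 'rV[R]_n.+2 -> 'rV[R]_n.+2) (sigma : 'rV[R]_n.+2 -> R)
  (v : 'I_n.+2 -> 'rV[R]_n.+2 -> R) (u0 : 'rV[R]_n.+2 -> R)
  (u : R -> R * 'rV[R]_n.+2 -> R)
  (b_C1 : Ck 1 b) (b_per : Yd_periodic b)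
  (sigma_C0 : Ck 0 sigma) (sigma_per : Yd_periodic sigma)
  (sigma_gt0 : forall x, 0 < sigma x)
  (v_C2 : forall i, Ck 2 (v i)) (gradv_per : forall i, Yd_periodic (grad (v i)))
  (b_v1 : forall x, Yd x -> dotv (b x) (grad (v ord0) x) = 1)
  (sigma_b : forall x, Yd x -> sigma x *: b x = gradient_product v x)
  (u0_C1 : Ck 1 u0)
  (u_sol : forall e, 0 < e ->
     transport_solution (fun x => b (e^-1 *: x)) u0 (u e)) :
  let xi := (mean sigma)^-1 *: meanv (fun x => sigma x *: b x) in
  C0loc_cvg0 u (fun p => u0 (p.2 + p.1 *: xi)).
Proof.
have Pv : periodic_C2 v by move=> j; split.
have sg := sigma_det b_per sigma_per Pv b_v1 sigma_b.
have det_neq0 x : detr (jac v x) != 0 by rewrite -sg; exact: lt0r_neq0.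
have [W VK WK] := rmap_bij Pv det_neq0.
have [C C0 HC] := trajectory_drift b_per sigma_per sigma_gt0 Pv b_v1 sigma_b WK.
move=> xi; exists (fun e p => u0 (trajectory v W e p)); split=> [e e0|K cK _].
  split.
    apply: continuous_subspaceT.
    exact: (continuous_trajectory b_per sigma_per sigma_gt0 Pv b_v1 sigma_b VK WK u0_C1).
  have H := trajectory_solution b_C1 b_per sigma_per sigma_gt0 Pv b_v1 sigma_b VK WK u0_C1 e0 (u_sol e e0).
  exact: H.
have cu0 : continuous u0 := Ck1_continuous u0_C1.
pose line (p : R * 'rV[R]_n.+2) := p.2 + p.1 *: xi.
have cline : continuous (fun p => `|line p|).
  apply: continuous_norm; apply: continuous_add; first by move=> p; exact: cvg_snd.
  by apply: continuous_scale; [move=> p; exact: cvg_fst|exact: cst_continuous].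
have [L L0 HL] := compact_bound cK cline.
move=> Q /uniform_nbhs [U [entU UQ]].
have [eta /= eta0 etaU] : exists2 eta : R, 0 < eta & forall x y : R, `|x - y| < eta -> U (x, y).
  move: entU; rewrite -entourage_ballE => -[eta /= eta0 H]; exists eta => // x y xy.
  exact: H.
have [k k0 Hk] := compact_ucont (@compact_rV_ball R n.+2 L) cu0 eta0.
have kC : 0 < k / C by rewrite divr_gt0.
near=> e; apply: UQ => p Kp.
apply: etaU; rewrite distrC; apply: Hk; first by rewrite /= -normr_id; exact: HL.
have e0 : 0 < e by near: e; exact: nbhs_right_gt.
apply: le_lt_trans (HC e p e0) _; rewrite mulrC -ltr_pdivlMr//.
Unshelve. all: by end_near. Qed.
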